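(* Let $f\in C^1_b(\mathbb{R})\cap C^2(\mathbb{R})$, $0<\gamma<\beta<\alpha$, and let $(u,m)\in C^{2,\alpha}(\mathbb{T}^d)\times C^{2,\alpha}(\mathbb{T}^d)$ be a stable solution of the MFG system. Then there exists a neighborhood $\mathcal{O}$ of $(u,m)$ in $C^{2,\beta}(\mathbb{T}^d)\times C^{2,\gamma}(\mathbb{T}^d)$ such that, if $(u^0,m^0)\in\mathcal{O}$, the sequence $(u^k,m^k)$ generated by Newton's method $(u^{k+1},m^{k+1}) + T\big(G(u^k,m^k)+dG[u^k,m^k](u^{k+1}-u^k,m^{k+1}-m^k)\big)=0$ converges superlinearly to $(u,m)$ in $C^{2,\beta}(\mathbb{T}^d)\times C^{2,\gamma}(\mathbb{T}^d)$. If moreover $f\in C^{2,1}_{\mathrm{loc}}(\mathbb{R})$, the convergence is quadratic.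
   Context: $\mathbb{T}^d$ is the flat torus, $\lambda>0$, $\alpha\in(0,1)$, $m_0\in C^{0,\alpha}(\mathbb{T}^d)$ a probability density. $C^1_b(\mathbb{R})$: $C^1$ functions with $f,f'$ bounded; $C^{2,1}_{\mathrm{loc}}(\mathbb{R})$: $C^2$ functions with $f''$ Lipschitz on bounded sets. The MFG system is $-\Delta u + \tfrac12|Du|^2 + \lambda u = f(m)$, $-\Delta m - \operatorname{div}(m Du) + \lambda m = \lambda m_0$ in $\mathbb{T}^d$ (classical solution: $C^2$ pair satisfying it pointwise). A classical solution $(u,m)$ is stable if $(0,0)$ is the unique classical solution of $-\Delta v + Du\cdot Dv + \lambda v = f'(m)\rho$, $-\Delta\rho - \operatorname{div}(\rho Du) + \lambda\rho = \operatorname{div}(m Dv)$. $T$ maps $(\xi,\zeta)\in C^{0,\alpha}\times C^{0,\beta}(\mathbb{T}^d)$ to the solution $(v,\rho)$ of $-\Delta v+\lambda v=\xi$, $-\Delta\rho+\lambda\rho=\zeta$. $G(v,\rho)=(\tfrac12|Dv|^2-f(\rho),-\operatorname{div}(\rho Dv)-\lambda m_0)$, $dG[v,\rho](w,\mu)=(Dv\cdot Dw-f'(\rho)\mu,-\operatorname{div}(\mu Dv)-\operatorname{div}(\rho Dw))$. (The Newton initial guess is denoted $(u^0,m^0)$, distinct from the datum $m_0$.) *)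

(* Defs.v *)
From HB Require Import structures.
From mathcomp Require Import all_boot all_order all_algebra.
From mathcomp Require Import all_classical all_reals all_analysis.
Set Implicit Arguments. Unset Strict Implicit. Unset Printing Implicit Defensive.
Import Order.TTheory GRing.Theory Num.Theory.
Import numFieldNormedType.Exports.
Local Open Scope classical_set_scope.
Local Open Scope ring_scope.

(* Points of R^d are row vectors 'rV[R]_d; functions on the flat torus
   T^d = R^d / Z^d are 1-periodic functions 'rV[R]_d -> R. *)
Section MFG.
Variables (R : realType) (d : nat).
Notation pt := 'rV[R]_d.

Definition e_ (i : 'I_d) : pt := delta_mx 0 i.

Definition periodic (g : pt -> R) : Prop :=
  forall x i, g (x + e_ i) = g x.

Definition partial (i : 'I_d) (g : pt -> R) : pt -> R :=
  fun x => 'D_(e_ i) g x.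

Definition C2 (g : pt -> R) : Prop :=
  (forall x, differentiable g x) /\
  (forall i x, differentiable (partial i g) x) /\
  (forall i j, continuous (partial j (partial i g))).

Definition lap (g : pt -> R) : pt -> R :=
  fun x => \sum_(i < d) partial i (partial i g) x.

Definition gdot (u v : pt -> R) : pt -> R :=
  fun x => \sum_(i < d) partial i u x * partial i v x.

Definition div_mul_grad (rho v : pt -> R) : pt -> R :=
  fun x => \sum_(i < d) partial i (fun y => rho y * partial i v y) x.

Definition supnorm (g : pt -> R) : \bar R :=
  ereal_sup [set (`|g x|)%:E | x in setT].

Definition holder_semi (b : R) (g : pt -> R) : \bar R :=
  ereal_sup [set z | exists x y : pt, x != y /\
                     z = (`|g x - g y| / (`|x - y| `^ b))%:E].

Local Open Scope ereal_scope.

Definition norm0 (b : R) (g : pt -> R) : \bar R :=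
  supnorm g + holder_semi b g.

Definition norm2 (b : R) (g : pt -> R) : \bar R :=
  supnorm g + (\sum_(i < d) supnorm (partial i g))
  + (\sum_(i < d) \sum_(j < d) supnorm (partial j (partial i g)))
  + (\sum_(i < d) \sum_(j < d) holder_semi b (partial j (partial i g))).

Local Close Scope ereal_scope.

Definition C0holder (b : R) (g : pt -> R) : Prop :=
  periodic g /\ continuous g /\ (norm0 b g < +oo)%E.

Definition C2holder (b : R) (g : pt -> R) : Prop :=
  periodic g /\ C2 g /\ (norm2 b g < +oo)%E.

Definition dist2 (b : R) (g h : pt -> R) : R := fine (norm2 b (g \- h)).

Fixpoint iint (s : seq 'I_d) (g : pt -> R) (x : pt) : R :=
  match s with
  | [::] => g x
  | i :: s' => Rintegral (@lebesgue_measure R) `[0, 1]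
                 (fun t => iint s' g (x + (t - x 0 i) *: e_ i))
  end.

Definition torus_integral (g : pt -> R) : R := iint (enum 'I_d) g 0.

Definition prob_density (g : pt -> R) : Prop :=
  (forall x, 0 <= g x) /\ torus_integral g = 1.

Definition MFG_classical_solution (f : R -> R) (lam : R) (m0 u m : pt -> R)
  : Prop :=
  periodic u /\ periodic m /\ C2 u /\ C2 m /\
  (forall x, - lap u x + (gdot u u x) / 2 + lam * u x = f (m x)) /\
  (forall x, - lap m x - div_mul_grad m u x + lam * m x = lam * m0 x).

(* stability: the linearized system has only the trivial classical solution *)
Definition stable (f : R -> R) (lam : R) (m0 u m : pt -> R) : Prop :=
  MFG_classical_solution f lam m0 u m /\
  forall v rho : pt -> R,
    periodic v -> periodic rho -> C2 v -> C2 rho ->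
    (forall x, - lap v x + gdot u v x + lam * v x = (derive1 f) (m x) * rho x) ->
    (forall x, - lap rho x - div_mul_grad rho u x + lam * rho x
               = div_mul_grad m v x) ->
    v = (fun _ => 0) /\ rho = (fun _ => 0).

(* One Newton step, with T written out:
   (u',m') = - T( G(u,m) + dG[u,m](u'-u, m'-m) ), i.e.
   -Δu' + λu' = -( 1/2|Du|^2 - f(m) + Du.D(u'-u) - f'(m)(m'-m) )
   -Δm' + λm' = -( -div(m Du) - λ m0 - div((m'-m) Du) - div(m D(u'-u)) ) *)
Definition newton_step (f : R -> R) (lam : R) (m0 u m u' m' : pt -> R)
  : Prop :=
  (forall x, - lap u' x + lam * u' x =
     - ((gdot u u x) / 2 - f (m x) + gdot u (u' \- u) x
        - (derive1 f) (m x) * (m' x - m x))) /\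
  (forall x, - lap m' x + lam * m' x =
     - (- div_mul_grad m u x - lam * m0 x
        - div_mul_grad (m' \- m) u x - div_mul_grad m (u' \- u) x)).

Definition newton_sequence (f : R -> R) (lam b c : R) (m0 : pt -> R)
  (us ms : nat -> pt -> R) : Prop :=
  (forall k, C2holder b (us k) /\ C2holder c (ms k)) /\
  (forall k, newton_step f lam m0 (us k) (ms k) (us k.+1) (ms k.+1)).

End MFG.

Definition C1b_C2 (R : realType) (f : R -> R) : Prop :=
  (forall x, derivable f x 1) /\ (forall x, derivable (derive1 f) x 1) /\
  continuous (derive1 f) /\ continuous (derive1 (derive1 f)) /\
  (exists M, forall x, `|f x| <= M /\ `|(derive1 f) x| <= M).

Definition C21loc (R : realType) (f : R -> R) : Prop :=
  (forall x, derivable f x 1) /\ (forall x, derivable (derive1 f) x 1) /\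
  continuous (derive1 (derive1 f)) /\
  forall B : R, exists L : R, forall x y, `|x| <= B -> `|y| <= B ->
    `|(derive1 (derive1 f)) x - (derive1 (derive1 f)) y| <= L * `|x - y|.

(* Main.v *)
(* The resolvent of the Laplacian on the torus is obtained from a lazy random
   walk on a mesh of size h = 1/n.  The geometric sum of the powers of the walk
   inverts the discretized operator, and by the central limit behaviour of the
   binomial law second differences of the k-th power applied to a function in
   C^{0,b} are of order h^b k^(b/2-1), which sums to a bound uniform in h; the
   limit h -> 0 is taken along an ultrafilter.  Applying the bound to the
   differences of translates of the data gives C^{0,b} -> C^{2,b'} for b' < b.
   This loss is harmless: the Newton errors solve the linearized system with
   data in C^{0,alpha} x C^{0,beta}, and gamma < beta < alpha.
   After elimination of the Laplacian of v from div(m Dv) the linearized system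
   is a compact perturbation of the resolvent, so stability and Riesz's theorem
   give solvability and an estimate at (u,m), which persist at nearby (U,M) by
   absorption.  The data of the error equation are quadratic in the error, up
   to the modulus of continuity of f''. *)
Require Import Defs.
From HB Require Import structures.
From mathcomp Require Import all_boot all_order all_algebra.
From mathcomp Require Import all_classical all_reals all_analysis.
From mathcomp Require Import ring lra.
Set Implicit Arguments. Unset Strict Implicit. Unset Printing Implicit Defensive.
Import Order.TTheory GRing.Theory Num.Theory.
Import numFieldNormedType.Exports.
Local Open Scope classical_set_scope.
Local Open Scope ring_scope.

(* mathcomp-analysis has its own [periodic], on R. *)
Local Notation periodic := Defs.periodic.

(** The second equation dictates the two exponents. Its coefficient [lap U] is no smoother than the
    second derivatives of the iterate [U], so this equation lives in C^{0,beta} and the density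
    error is recovered in C^{2,gamma}. The first equation contains only first derivatives of [U] and
    no derivative of [M], so it lives in C^{0,alpha} and yields C^{2,beta}. Hence a step returns to
    the space where it started, although the resolvent loses a little regularity. As f is merely
    C^2, two terms need care. The coefficient difference f'(M) - f'(m) has a small supremum but no
    small Lipschitz constant; interpolation gives it a Hölder size of order dl^(1-alpha), dl being
    the error, which suffices for absorption. The Taylor remainder of f must be of second order in a
    Hölder norm and not only pointwise, and the modulus of f'' enters through its increments.
    Estimates are written with gauges, predicates such as [hol b K g] in which one constant bounds
    every part of a norm. *)

Section BinomialMean.
Variable R : realType.

(** The expectation of [p] under the binomial law with [m] fair trials, defined by conditioning on
    one trial, so that identities are proved by induction without binomial coefficients. *)
Fixpoint bmean (m : nat) (p : nat -> R) : R :=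
  match m with
  | 0%N => p 0%N
  | m'.+1 => (bmean m' p + bmean m' (fun k => p k.+1)) / 2
  end.

Lemma eq_bmean m p q : p =1 q -> bmean m p = bmean m q.
Proof. by move=> /funext->. Qed.

Lemma bmeanD m p q : bmean m (fun k => p k + q k) = bmean m p + bmean m q.
Proof. by elim: m p q => [//|m IH] p q /=; rewrite !IH; field. Qed.

Lemma bmeanZ m a p : bmean m (fun k => a * p k) = a * bmean m p.
Proof. by elim: m p => [//|m IH] p /=; rewrite !IH; field. Qed.

Lemma bmean_cst m a : bmean m (fun=> a) = a.
Proof. by elim: m => [//|m IH] /=; rewrite !IH; field. Qed.

Lemma bmean_le m p q : (forall k, p k <= q k) -> bmean m p <= bmean m q.
Proof.
elim: m p q => [|m IH] p q pq /=; first exact: pq.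
by rewrite ler_wpM2r ?invr_ge0// lerD// IH.
Qed.

Lemma bmean_norm m p q : (forall k, `|p k| <= q k) -> `|bmean m p| <= bmean m q.
Proof.
move=> pq; rewrite ler_norml -[- _]mulN1r -bmeanZ; apply/andP; split;
  apply: bmean_le => k; move: (pq k); rewrite ler_norml ?mulN1r => /andP[]//.
Qed.

(* The first moment of the centred binomial law against p is a discrete
   integration by parts. *)
Lemma bmean_ibp m p :
  bmean m (fun k => (2 * k%:R - m%:R) * p k) =
  m%:R / 2 * (bmean m.-1 (fun k => p k.+1) - bmean m.-1 p).
Proof.
elim: m p => [|m IH] p /=; first by rewrite mulr0 subr0 !mul0r.
have -> : bmean m (fun k => (2 * k%:R - m.+1%:R) * p k) =
  bmean m (fun k => (2 * k%:R - m%:R) * p k) - bmean m p.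
  rewrite -[- bmean m p]mulN1r -bmeanZ -bmeanD; apply: eq_bmean => k /=.
  by rewrite -natr1; ring.
have -> : bmean m (fun k => (2 * k.+1%:R - m.+1%:R) * p k.+1) =
  bmean m (fun k => (2 * k%:R - m%:R) * p k.+1) + bmean m (fun k => p k.+1).
  by rewrite -bmeanD; apply: eq_bmean => k /=; rewrite -!natr1; ring.
rewrite !IH; case: m {IH} => [|m] /=; first by rewrite !mul0r; field.
by rewrite -!natr1; field.
Qed.

Lemma bmean_var m : bmean m (fun k => (2 * k%:R - m%:R) ^+ 2) = m%:R.
Proof.
rewrite (eq_bmean _ (fun k => expr2 _)) bmean_ibp.
rewrite -[- bmean _ _]mulN1r -bmeanZ -bmeanD.
rewrite (eq_bmean _ (q := fun=> 2)) ?bmean_cst; first by field.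
by move=> k; rewrite -natr1; ring.
Qed.

(** This is [bmean_ibp] read backwards. The centred variable 2k - (m+1) has standard deviation
    sqrt(m+1), so dividing by m+1 gains a factor of order m^(-1/2) for each difference. *)
Lemma bmean_diff m p :
  bmean m (fun k => p k.+1) - bmean m p =
  2 / m.+1%:R * bmean m.+1 (fun k => (2 * k%:R - m.+1%:R) * p k).
Proof.
by rewrite bmean_ibp /=; field; rewrite addrC natr1 pnatr_eq0.
Qed.

(** With s = sqrt(m+1), y^(1+a) is at most s^(1+a) for y <= s and at most y^2 s^(a-1) for y > s. The
    variance turns the second bound into s^(1+a) as well, whence the constant 2. *)
Lemma bmean_moment m (a : R) : 0 <= a <= 1 ->
  bmean m.+1 (fun k => `|2 * k%:R - m.+1%:R| `^ (1 + a)) <=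
  2 * Num.sqrt m.+1%:R `^ (1 + a).
Proof.
move=> /andP[a0 a1]; set s := Num.sqrt _.
have s0 : 0 < s by rewrite sqrtr_gt0 ltr0n.
have s2 : s ^+ 2 = m.+1%:R by rewrite sqr_sqrtr.
have H k : `|2 * k%:R - m.+1%:R| `^ (1 + a) <=
    s `^ (1 + a) + (s `^ (1 + a) / s ^+ 2) * (2 * k%:R - m.+1%:R : R) ^+ 2.
  rewrite -(real_normK (num_real (2 * k%:R - m.+1%:R : R))).
  set y := `| _ |; have y0 : 0 <= y by rewrite normr_ge0.
  have [ys|sy] := leP y s.
    apply: (@le_trans _ _ (s `^ (1 + a))).
      by rewrite ge0_ler_powR ?nnegrE ?addr_ge0// ltW.
    by rewrite lerDl mulr_ge0 ?divr_ge0 ?powR_ge0 ?sqr_ge0.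
  have y1 : 0 < y by apply: lt_trans s0 sy.
  have E z : 0 < z -> z `^ (1 + a) = z ^+ 2 * z `^ (a - 1).
    move=> z0; rewrite -powR_mulrn ?ltW// -powRD ?(gt_eqF z0) ?implybT//.
    by congr (_ `^ _); lra.
  rewrite ler_wpDl ?powR_ge0// (E _ s0) (E _ y1).
  have -> : s ^+ 2 * s `^ (a - 1) / s ^+ 2 = s `^ (a - 1).
    by field; rewrite gt_eqF.
  rewrite mulrC ler_wpM2r ?sqr_ge0//.
  rewrite -(opprB 1 a) !powRN lef_pV2 ?posrE ?powR_gt0//.
  by rewrite ge0_ler_powR ?nnegrE ?subr_ge0 ?(ltW s0) ?(ltW sy).
apply: le_trans (bmean_le _ H) _.
rewrite bmeanD bmean_cst bmeanZ bmean_var -s2 divfK ?sqrf_eq0 ?gt_eqF//.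
by rewrite mulrDl !mul1r.
Qed.

(** Constants drop out of the difference, so [p] may be recentred at any [c]; the hypothesis then
    turns the first moment in [bmean_diff] into a moment of order 1+a. *)
Lemma bmean_diff_le m p (K a c : R) : 0 <= a <= 1 -> 0 <= K ->
  (forall k, `|p k - c| <= K * `|2 * k%:R - m.+1%:R| `^ a) ->
  `|bmean m (fun k => p k.+1) - bmean m p| <=
  4 * K * m.+1%:R `^ ((a - 1) / 2).
Proof.
move=> a01 K0 pK; pose q k := p k - c.
have -> : bmean m (fun k => p k.+1) - bmean m p =
    bmean m (fun k => q k.+1) - bmean m q.
  have D g : bmean m (fun k => g k - c) = bmean m g - c.
    by rewrite (bmeanD m g (fun=> - c)) bmean_cst.
  by rewrite (D (fun k => p k.+1)) D; ring.
rewrite bmean_diff normrM ger0_norm ?divr_ge0//.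
have n0 : 0 < m.+1%:R :> R by rewrite ltr0n.
have H : `|bmean m.+1 (fun k => (2 * k%:R - m.+1%:R) * q k)| <=
    K * (2 * Num.sqrt m.+1%:R `^ (1 + a)).
  apply: le_trans (ler_wpM2l K0 (bmean_moment m a01)); rewrite -bmeanZ.
  apply: bmean_norm => k; rewrite normrM.
  case: (eqVneq (2 * k%:R - m.+1%:R : R) 0) => [->|nz].
    by rewrite normr0 mul0r mulr_ge0 ?powR_ge0.
  apply: le_trans (ler_wpM2l (normr_ge0 _) (pK k)) _.
  rewrite powRD; last by rewrite normr_eq0 (negPf nz) implybT.
  by rewrite powRr1// mulrCA.
apply: le_trans (ler_wpM2l _ H) _; first by rewrite divr_ge0.
have -> : Num.sqrt m.+1%:R `^ (1 + a) = m.+1%:R * m.+1%:R `^ ((a - 1) / 2) :> R.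
  rewrite -powR12_sqrt ?ltW// -powRrM.
  rewrite -{2}(powRr1 (ltW n0)) -powRD ?(gt_eqF n0) ?implybT//.
  by congr (_ `^ _); lra.
by rewrite le_eqVlt; apply/orP; left; apply/eqP; field; rewrite addrC natr1 pnatr_eq0.
Qed.

End BinomialMean.

(** * Power sums with and without geometric damping *)

Section PowerSums.
Variable R : realType.

(** Young's inequality with exponents 1/t and 1/(1-t), applied to x^t and 1. *)
Lemma powR_bernoulli (x t : R) : 0 <= x -> 0 < t < 1 -> x `^ t <= 1 - t + t * x.
Proof.
move=> x0 /andP[t0 t1].
have t10 : 0 < 1 - t by rewrite subr_gt0.
have := @conjugate_powR R (x `^ t) 1 t^-1 (1 - t)^-1 (powR_ge0 _ _) ler01.
rewrite !invr_gt0 !invrK => /(_ t0 t10) H.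
rewrite mulr1 -powRrM mulfV ?gt_eqF// powRr1// powR1 mul1r in H.
by rewrite addrC [t * x]mulrC; apply: H; ring.
Qed.

(** A discrete comparison with the integral of s^(t-1): Bernoulli's inequality at M/(M+1) bounds the
    new term by the increment of M^t / t. *)
Lemma sum_powR_le (t : R) M : 0 < t < 1 ->
  \sum_(n < M) n.+1%:R `^ (t - 1) <= M%:R `^ t / t.
Proof.
move=> t01; have /andP[t0 t1] := t01.
elim: M => [|M IH]; first by rewrite big_ord0 divr_ge0 ?powR_ge0 ?ltW.
rewrite big_ord_recr /=; apply: le_trans (lerD IH (lexx _)) _.
have m0 : 0 < M.+1%:R :> R by rewrite ltr0n.
have -> : M%:R `^ t = (M%:R / M.+1%:R) `^ t * M.+1%:R `^ t :> R.
  by rewrite -powRM ?divr_ge0// divfK ?gt_eqF.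
have -> : M.+1%:R `^ (t - 1) = M.+1%:R `^ t / M.+1%:R :> R.
  rewrite powRD ?(gt_eqF m0) ?implybT// powRN powRr1 ?ltW//.
rewrite -(ler_pM2r t0) mulrDl !divfK ?gt_eqF//.
have x0 : 0 <= M%:R / M.+1%:R :> R by rewrite divr_ge0.
have := ler_wpM2r (powR_ge0 M.+1%:R t) (powR_bernoulli x0 t01).
move=> B; apply: le_trans (lerD B (lexx _)) _.
rewrite le_eqVlt; apply/orP; left; apply/eqP.
by rewrite -natr1; field; rewrite natr1 gt_eqF.
Qed.

Lemma sum_geom_le (c : R) N : 0 < c < 1 -> \sum_(n < N) c ^+ n <= (1 - c)^-1.
Proof.
move=> /andP[c0 c1]; have d0 : 0 < 1 - c by rewrite subr_gt0.
rewrite -(ler_pM2r d0) mulVf ?gt_eqF//.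
have -> : (\sum_(n < N) c ^+ n) * (1 - c) = 1 - c ^+ N.
  elim: N => [|N IH]; first by rewrite big_ord0 expr0; ring.
  by rewrite big_ord_recr mulrDl IH exprS; ring.
by rewrite lerBlDr lerDl exprn_ge0 ?ltW.
Qed.

(** Before time [M] the damping is discarded, afterwards the decreasing power is replaced by its
    value at [M]. For [M] of order 1/(1-c) both parts have the same order. *)
Lemma sum_geom_powR_le (c t : R) M N : 0 < c < 1 -> 0 < t < 1 -> (0 < M)%N ->
  \sum_(n < N) c ^+ n * n.+1%:R `^ (t - 1) <=
  M%:R `^ t / t + M%:R `^ (t - 1) / (1 - c).
Proof.
move=> c01 t01 M0; have /andP[c0 c1] := c01; have /andP[t0 t1] := t01.
have M0' : 0 < M%:R :> R by rewrite ltr0n.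
apply: (@le_trans _ _ (\sum_(n < N) ((if (n < M)%N then n.+1%:R `^ (t - 1) else 0)
    + M%:R `^ (t - 1) * c ^+ n))).
  apply: ler_sum => n _; case: ltnP => nM.
    apply: (@le_trans _ _ (n.+1%:R `^ (t - 1))).
      by rewrite ler_piMl ?powR_ge0// exprn_ile1 ?ltW.
    by rewrite lerDl mulr_ge0 ?powR_ge0 ?exprn_ge0 ?ltW.
  rewrite add0r mulrC ler_wpM2r ?exprn_ge0 ?(ltW c0)//.
  rewrite -(opprB 1 t) !powRN lef_pV2 ?posrE ?powR_gt0 ?ltr0n//.
  by rewrite ge0_ler_powR ?nnegrE ?subr_ge0 ?(ltW t1)// ler_nat ltnW.
rewrite big_split /= lerD//; last first.
  by rewrite -mulr_sumr ler_wpM2l ?powR_ge0// sum_geom_le.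
apply: le_trans (sum_powR_le M t01).
rewrite -(big_mkord xpredT (fun n => if (n < M)%N then n.+1%:R `^ (t - 1) else 0)).
rewrite -(big_mkord xpredT (fun n => n.+1%:R `^ (t - 1))).
rewrite -big_mkcond /=.
have [NM|MN] := leqP N M.
  rewrite (big_cat_nat (leq0n N) NM)/= [X in X <= _](_ : _ = \sum_(0 <= i < N) i.+1%:R `^ (t - 1)); last first.
    by rewrite big_nat_cond [RHS]big_nat_cond; apply: eq_bigl => i; case: ltnP => //= iN; rewrite (leq_trans iN NM).
  by rewrite lerDl sumr_ge0// => i _; rewrite powR_ge0.
rewrite (big_cat_nat (leq0n M) (ltnW MN))/= [X in _ + X](_ : _ = 0).
  rewrite addr0 le_eqVlt; apply/orP; left; apply/eqP.
  by rewrite big_nat_cond [RHS]big_nat_cond; apply: eq_bigl => i; case: ltnP => //= iN; rewrite andbT.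
rewrite big_nat_cond big_pred0// => i.
by apply/negP => /andP[/andP[Mi _]]; rewrite ltnNge Mi.
Qed.

End PowerSums.

(** * Translation invariant contractions and their smoothing effect on differences *)

Section AveragingOperators.
Variables (R : realType) (V : normedModType R).
Implicit Types (f g : V -> R) (x y z : V) (L : (V -> R) -> V -> R).

(** Abstracts convolution with a measure of total variation at most one. *)
Definition averaging L :=
  [/\ forall a f g x, L (fun z => a * f z + g z) x = a * L f x + L g x,
      forall y f x, L (fun z => f (z + y)) x = L f (x + y)
    & forall K f, (forall x, `|f x| <= K) -> forall x, `|L f x| <= K].

Definition holder (b H : R) g := forall x y, `|g (x + y) - g x| <= H * `|y| `^ b.

Definition trans y g := fun x => g (x + y).
Definition avg y g := fun x => (g x + g (x + y)) / 2.
Definition fdiff y g := fun x => g (x + y) - g x.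

Lemma averaging_id : averaging id. Proof. by []. Qed.

Lemma averaging_comp L L' : averaging L -> averaging L' -> averaging (L \o L').
Proof.
move=> [l t c] [l' t' c']; split => /=.
- by move=> a f g x; rewrite -l; congr (L _ x); apply/funext => z; rewrite l'.
- by move=> y f x; rewrite -t; congr (L _ x); apply/funext => z; rewrite t'.
- by move=> K f fK; apply: c; apply: c'.
Qed.

Lemma averaging_iter L n : averaging L -> averaging (iter n L).
Proof. by move=> avO; elim: n => // n IH; exact: (averaging_comp avO IH). Qed.

Lemma averaging_trans y : averaging (trans y).
Proof. by split=> // *; rewrite /trans// -!addrA (addrC y). Qed.

Lemma averaging_avg y : averaging (avg y).
Proof.
split=> [a f g x|z f x|K f fK x]; rewrite /avg.
- by field.
- by rewrite -!addrA (addrC y).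
- rewrite normrM [`|2^-1|]ger0_norm ?invr_ge0// ler_pdivrMr//.
  by rewrite (le_trans (ler_normD _ _))// mulr_natr lerD.
Qed.

Section Comm.
Variables (L : (V -> R) -> V -> R) (avO : averaging L).

Lemma averaging0 : L (fun=> 0) = fun=> 0.
Proof.
case: avO => _ _ c; apply/funext => x; apply/normr0_eq0/eqP.
by rewrite eq_le normr_ge0 andbT c// => z; rewrite normr0.
Qed.

Lemma averagingZ a f : L (fun z => a * f z) = fun x => a * L f x.
Proof.
case: (avO) => l _ _; apply/funext => x; have := l a f (fun=> 0) x.
rewrite averaging0 addr0 => <-; congr (L _ x); apply/funext => z.
by rewrite addr0.
Qed.

Lemma averagingD f g : L (fun z => f z + g z) = fun x => L f x + L g x.
Proof.
case: (avO) => l _ _; apply/funext => x; rewrite -[L f x]mul1r -l.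
by congr (L _ x); apply/funext => z; rewrite mul1r.
Qed.

Lemma averaging_diff y f : L (fdiff y f) = fdiff y (L f).
Proof.
case: (avO) => l t _; apply/funext => x.
rewrite /fdiff -t -[- L f x]mulN1r addrC -l.
by congr (L _ x); apply/funext => z; rewrite mulN1r addrC.
Qed.

Lemma averagingC_avg y f : L (avg y f) = avg y (L f).
Proof.
case: (avO) => l t _; apply/funext => x.
rewrite [RHS]/avg -t mulrDl mulrC [_ / 2]mulrC.
have -> : 2^-1 * L (fun z => f (z + y)) x = L (fun z => 2^-1 * f (z + y)) x.
  by rewrite averagingZ.
rewrite -l; congr (L _ x); apply/funext => z.
by rewrite /avg -mulrDr mulrC.
Qed.

Lemma averagingC_trans y f : L (trans y f) = trans y (L f).
Proof. by case: (avO) => _ t _; apply/funext => x; rewrite /trans -t. Qed.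

(** A modulus of continuity is a sup bound on [fdiff y], which commutes with [L]. *)
Lemma averaging_holder b H f : holder b H f -> holder b H (L f).
Proof.
move=> fH x y; rewrite -[L f _ - _]/(fdiff y (L f) x) -averaging_diff.
by case: (avO) => _ _ c; apply: c => z; exact: fH.
Qed.

Lemma averaging_inv y f :
  (forall x, f (x + y) = f x) -> forall x, L f (x + y) = L f x.
Proof.
by case: (avO) => _ t _ fy x; rewrite -t; congr (L _ x); exact/funext.
Qed.

End Comm.

Lemma iter_avg m y g x : iter m (avg y) g x = bmean m (fun k => g (x + y *+ k)).
Proof.
elim: m x => [|m IH] x /=; first by rewrite mulr0n addr0.
rewrite /avg !IH; congr ((_ + _) / 2); apply: eq_bmean => k.
by rewrite mulrS addrA.
Qed.

Lemma diff_iter_avg m y g x : fdiff y (iter m (avg y) g) x =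
  bmean m (fun k => g (x + y *+ k.+1)) - bmean m (fun k => g (x + y *+ k)).
Proof.
rewrite /fdiff !iter_avg; congr (_ - _).
by apply: eq_bmean => k; rewrite mulrS addrA.
Qed.

Lemma diff_iter_avg_sup m y g (K : R) : (forall x, `|g x| <= K) ->
  forall x, `|fdiff y (iter m (avg y) g) x| <= 4 * K * m.+1%:R `^ (- 2^-1).
Proof.
move=> gK x; rewrite diff_iter_avg.
have K0 : 0 <= K by apply: le_trans (gK 0).
have -> : - 2^-1 = (0 - 1) / 2 :> R by lra.
apply: (bmean_diff_le (c := 0) (p := fun k => g (x + y *+ k))) => //.
  by rewrite lexx ler01.
by move=> k; rewrite subr0 powRr0 mulr1.
Qed.

Lemma diff_iter_avg_holder m y g (b H : R) : 0 <= b <= 1 -> 0 <= H ->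
  holder b H g -> forall x, `|fdiff y (iter m (avg y) g) x| <=
  4 * (H * (`|y| / 2) `^ b) * m.+1%:R `^ ((b - 1) / 2).
Proof.
move=> b01 H0 gH x; rewrite diff_iter_avg.
(* The centre is the value of [g] at the mean position x + ((m+1)/2) y, at distance |2k - (m+1)| |y|
   / 2 from x + k y. *)
apply: (bmean_diff_le (c := g (x + (m.+1%:R / 2) *: y))
  (p := fun k => g (x + y *+ k))) => // [|k].
  by rewrite mulr_ge0 ?powR_ge0.
have -> : x + y *+ k = x + (m.+1%:R / 2) *: y + (k%:R - m.+1%:R / 2) *: y.
  by rewrite -addrA -scalerDl addrCA subrr addr0 scaler_nat.
apply: le_trans (gH _ _) _; rewrite -mulrA ler_wpM2l// -powRM ?divr_ge0//.
rewrite normrZ le_eqVlt; apply/orP; left; apply/eqP; congr (_ `^ _).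
have -> : k%:R - m.+1%:R / 2 = (2 * k%:R - m.+1%:R) / 2 :> R by field.
by rewrite normrM [`|2^-1|]ger0_norm ?invr_ge0//; ring.
Qed.

Lemma iter_comp (L1 L2 : (V -> R) -> V -> R) n g :
  (forall f, L1 (L2 f) = L2 (L1 f)) ->
  iter n (fun f => L1 (L2 f)) g = iter n L1 (iter n L2 g).
Proof.
move=> C; elim: n => [//|n IH] /=; rewrite IH; congr (L1 _).
move: (iter n L2 g) => h; elim: n {IH} => [//|n IH] /=.
by rewrite -C; congr (L1 _).
Qed.

(** One difference is spent on each smoothing factor. The powers of [avg z] turn Hölder continuity
    into order n^((b-1)/2) for the z-difference, and the powers of [avg y] gain n^(-1/2) from the
    supremum of the result; [L] acts only as a contraction. *)
Lemma diff2_iter_holder L y z (b H : R) n g : averaging L -> 0 <= b <= 1 -> 0 <= H ->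
  holder b H g -> forall x,
  `|fdiff y (fdiff z (iter n (fun f => avg y (avg z (L f))) g)) x| <=
  16 * (H * (`|z| / 2) `^ b) * n.+1%:R `^ (b / 2 - 1).
Proof.
move=> avO b01 H0 gH x.
have avy := averaging_avg y; have avz := averaging_avg z.
have aviy := averaging_iter n avy; have aviz := averaging_iter n avz.
rewrite (iter_comp (L1 := avg y)); last first.
  move=> f; rewrite -(averagingC_avg avz) -(averagingC_avg avO) //.
rewrite (iter_comp (L1 := avg z)); last by move=> f; rewrite -(averagingC_avg avO).
set G := iter n L g.
have GH : holder b H G by apply: averaging_holder => //; exact: averaging_iter.
rewrite -(averaging_diff aviy).
have F := diff_iter_avg_holder n z b01 H0 GH.
apply: le_trans (diff_iter_avg_sup n y F x) _.
rewrite mulrCA -!mulrA mulrCA !mulrA -mulrA -powRD; last first.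
  by rewrite pnatr_eq0 implybT.
have -> : (b - 1) / 2 - 2^-1 = b / 2 - 1 :> R by lra.
by rewrite le_eqVlt; apply/orP; left; apply/eqP; ring.
Qed.

End AveragingOperators.

(** * Lazy random walks and their damped geometric sums *)

Section Resolvent.
Variables (R : realType) (V : normedModType R).
Implicit Types (f g : V -> R) (x y z : V) (L : (V -> R) -> V -> R) (s : seq V).

(** The weights are 1/4, 1/2, 1/4. Laziness makes the walk a shifted square of [avg y], which leaves
    two smoothing factors for a repeated difference in one direction. *)
Definition walk y f := trans (- y) (avg y (avg y f)).

Lemma averaging_walk y : averaging (walk y).
Proof.
apply: (averaging_comp (averaging_trans (- y))).
by apply: (averaging_comp (averaging_avg y)); exact: averaging_avg.
Qed.

Lemma walkE y f x : walk y f x = (f (x - y) + f x *+ 2 + f (x + y)) / 4.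
Proof. by rewrite /walk /trans /avg subrK mulr2n; field. Qed.

Lemma walk_diff y f x : walk y f x - f x = fdiff y (fdiff y f) (x - y) / 4.
Proof. by rewrite walkE /fdiff subrK; field. Qed.

Lemma walk_close y f (e : R) x : (forall x, `|f (x - y) - f x| <= e) ->
  `|walk y f x - f x| <= e.
Proof.
move=> fe; have e0 : 0 <= e by apply: le_trans (fe 0).
have H1 := fe x; have := fe (x + y); rewrite addrK distrC => H2.
rewrite walkE.
have -> : (f (x - y) + f x *+ 2 + f (x + y)) / 4 - f x =
  ((f (x - y) - f x) + (f (x + y) - f x)) / 4 by field.
rewrite normrM [X in _ * X]ger0_norm ?invr_ge0// ler_pdivrMr//.
apply: le_trans (ler_normD _ _) _; apply: le_trans (lerD H1 H2) _; lra.
Qed.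

Definition walks s := foldr (fun y L => walk y \o L) id s.

Lemma averaging_walks s : averaging (walks s).
Proof.
elim: s => [|y s IH] /=; first exact: averaging_id.
exact: averaging_comp (averaging_walk y) IH.
Qed.

Lemma walks_factor1 s y : y \in s ->
  exists2 L, averaging L & forall f, walks s f = avg y (L f).
Proof.
elim: s => [//|z s IH]; rewrite inE => /predU1P[->|/IH[L avL E]].
  exists (trans (- z) \o (avg z \o walks s)).
    apply: averaging_comp (averaging_trans _) _.
    by apply: averaging_comp (averaging_avg _) (averaging_walks s).
  by move=> f /=; rewrite (averagingC_trans (averaging_avg _)).
exists (walk z \o L); first exact: averaging_comp (averaging_walk z) avL.
by move=> f /=; rewrite E (averagingC_avg (averaging_walk z)).
Qed.

(** For y = z both factors come from one lazy walk, otherwise one factor is taken from each of two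
    walks; everything left over is collected in [L]. *)
Lemma walks_factor s y z : y \in s -> z \in s ->
  exists2 L, averaging L & forall f, walks s f = avg y (avg z (L f)).
Proof.
have avgC u w f : avg u (avg w f) = avg w (avg u f).
  by rewrite (averagingC_avg (averaging_avg _)).
have K u w t : w \in u :: t ->
    exists2 L, averaging L & forall f, walks (u :: t) f = avg u (avg w (L f)).
  rewrite inE => /predU1P[->|/walks_factor1[L avL E]].
    exists (trans (- u) \o walks t).
      by apply: averaging_comp (averaging_trans _) (averaging_walks t).
    by move=> f /=; rewrite !(averagingC_trans (averaging_avg _)).
  exists (trans (- u) \o (avg u \o L)).
    apply: averaging_comp (averaging_trans _) _.
    by apply: averaging_comp (averaging_avg _) avL.
  move=> f /=; rewrite E !(averagingC_trans (averaging_avg _)) /walk.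
  by rewrite (avgC w u).
elim: s => [//|u s IH] ys zs; move: (ys) (zs); rewrite !inE.
move=> /predU1P[yu|ys'] /predU1P[zu|zs'].
- by rewrite yu; apply: K.
- by rewrite yu; apply: K.
- by rewrite zu; have [L avL E] := K u y s ys; exists L => // f; rewrite avgC.
have [L avL E] := IH ys' zs'.
exists (walk u \o L); first exact: averaging_comp (averaging_walk u) avL.
by move=> f /=; rewrite E !(averagingC_avg (averaging_walk u)).
Qed.

(** The generator of a composition differs from the sum of the generators by shifts over one step. A
    new walk averages the earlier second differences, each at cost [e], and shifts its own by one
    step; the induction closes because n^2 + n + 1 <= (n+1)^2. *)
Lemma walks_close s f (k e : R) : 0 <= e ->
  (forall y z x, y \in s -> z \in s ->
    `|fdiff y (fdiff y f) (x - z) - fdiff y (fdiff y f) x| * k <= e) ->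
  0 <= k -> forall x,
  `|4 * k * (walks s f x - f x) - \sum_(y <- s) k * fdiff y (fdiff y f) x| <=
  (size s)%:R ^+ 2 * e.
Proof.
move=> e0 H k0; elim: s H => [|u s IH] H x.
  by rewrite big_nil /= subrr mulr0 subr0 normr0 expr0n mul0r.
pose F y x := k * fdiff y (fdiff y f) x.
pose G x := 4 * k * (walks s f x - f x) - \sum_(y <- s) F y x.
have HG z : `|G z| <= (size s)%:R ^+ 2 * e.
  by apply: IH => y w t ys ws; apply: H; rewrite inE ?ys ?ws orbT.
have HF y z w : y \in u :: s -> z \in u :: s -> `|F y (w - z) - F y w| <= e.
  by move=> ys zs; rewrite -mulrBr normrM (ger0_norm k0) mulrC H.
have wG : `|walk u G x| <= (size s)%:R ^+ 2 * e.
  by case: (averaging_walk u) => _ _; apply.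
have -> : 4 * k * (walks (u :: s) f x - f x) -
      \sum_(y <- u :: s) k * fdiff y (fdiff y f) x =
    walk u G x + \sum_(y <- s) (walk u (F y) x - F y x) + (F u (x - u) - F u x).
  have S : walk u (fun x => \sum_(y <- s) F y x) x = \sum_(y <- s) walk u (F y) x.
    elim: (s) => [|y t IHt]; first by rewrite big_nil walkE !big_nil; field.
    by rewrite big_cons -IHt !walkE !big_cons; field.
  have wGE : walk u G x = 4 * k * (walk u (walks s f) x - walk u f x) -
      walk u (fun x => \sum_(y <- s) F y x) x.
    by rewrite !walkE /G; field.
  have FuE : F u (x - u) = 4 * k * (walk u f x - f x).
    by rewrite walk_diff /F; field.
  rewrite sumrB -S wGE FuE big_cons -/(F u x) /=.
  by rewrite [\sum_(y <- s) k * _](_ : _ = \sum_(y <- s) F y x)//; ring.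
have sz : 0 <= (size s)%:R ^+ 2 * e by apply: le_trans (HG 0).
apply: le_trans (ler_normD _ _) _.
apply: le_trans (lerD (ler_normD _ _) (lexx _)) _.
have B1 : `|\sum_(y <- s) (walk u (F y) x - F y x)| <= (size s)%:R * e.
  have : {subset s <= s} by [].
  elim: {1 3 4}(s) => [|y t IHt] ts.
    by rewrite big_nil normr0 mul0r.
  rewrite big_cons /= -natr1 mulrDl mul1r addrC.
  apply: le_trans (ler_normD _ _) _; apply: lerD.
    by apply: IHt => z zt; apply: ts; rewrite inE zt orbT.
  apply: walk_close => w; apply: HF; rewrite inE ?eqxx//.
  by rewrite ts ?orbT// inE eqxx.
have B2 : `|F u (x - u) - F u x| <= e by apply: HF; rewrite inE eqxx.
apply: le_trans (lerD (lerD wG B1) B2) _ => /=.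
rewrite -natr1 -subr_ge0.
have -> : ((size s)%:R + 1) ^+ 2 * e - ((size s)%:R ^+ 2 * e + (size s)%:R * e + e) = (size s)%:R * e by ring.
by rewrite mulr_ge0.
Qed.

Section ResolventSum.
Variables (L : (V -> R) -> V -> R) (avL : averaging L) (c : R).

(** The truncated Neumann series of 1 - c L; [rsum_resolvent] exhibits the truncation error. *)
Fixpoint rsum N g : V -> R :=
  if N is N'.+1 then fun x => rsum N' g x + c ^+ N' * iter N' L g x
  else fun=> 0.

Lemma rsum_resolvent N g x :
  rsum N g x - c * L (rsum N g) x = g x - c ^+ N * iter N L g x.
Proof.
elim: N x => [|N IH] x /=.
  by rewrite averaging0// mulr0 subr0 expr0 mul1r subrr.
have -> : L (fun x => rsum N g x + c ^+ N * iter N L g x) x =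
    L (rsum N g) x + c ^+ N * L (iter N L g) x.
  by rewrite averagingD// averagingZ.
rewrite exprS -[in RHS](subrK (c ^+ N * iter N L g x) (g x)) -IH; ring.
Qed.

Lemma rsum_transB N g y x :
  rsum N g (x + y) - rsum N g x = rsum N (fun z => g (z + y) - g z) x.
Proof.
elim: N => [|N IH] /=; first by rewrite subrr.
rewrite -IH -/(fdiff y g) (averaging_diff (averaging_iter N avL)) /fdiff; ring.
Qed.

Lemma rsum_inv N g y : (forall x, g (x + y) = g x) ->
  forall x, rsum N g (x + y) = rsum N g x.
Proof.
move=> gy; elim: N => [//|N IH] x /=; rewrite IH.
by rewrite (averaging_inv (averaging_iter N avL) gy).
Qed.

Lemma rsum_norm N g (K : R) : 0 <= c -> (forall x, `|g x| <= K) ->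
  forall x, `|rsum N g x| <= (\sum_(n < N) c ^+ n) * K.
Proof.
move=> c0 gK x; elim: N => [|N IH] /=; first by rewrite big_ord0 mul0r normr0.
rewrite big_ord_recr mulrDl; apply: le_trans (ler_normD _ _) _; apply: lerD => //.
rewrite normrM ger0_norm ?exprn_ge0// ler_wpM2l ?exprn_ge0//.
by case: (averaging_iter N avL) => _ _; apply.
Qed.

Lemma rsum_diff2 N g y z (B : nat -> R) : 0 <= c ->
  (forall n x, `|fdiff y (fdiff z (iter n L g)) x| <= B n) ->
  forall x, `|fdiff y (fdiff z (rsum N g)) x| <= \sum_(n < N) c ^+ n * B n.
Proof.
move=> c0 gB x; elim: N => [|N IH] /=.
  by rewrite big_ord0 /fdiff !subrr normr0.
rewrite big_ord_recr.
have -> : fdiff y (fdiff z (rsum N.+1 g)) x =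
    fdiff y (fdiff z (rsum N g)) x + c ^+ N * fdiff y (fdiff z (iter N L g)) x.
  by rewrite /fdiff /=; ring.
apply: le_trans (ler_normD _ _) _; apply: lerD => //.
by rewrite normrM ger0_norm ?exprn_ge0// ler_wpM2l ?exprn_ge0.
Qed.

End ResolventSum.
End Resolvent.

(** * Hölder functions on the torus *)

Section TorusBasics.
Variables (R : realType) (d : nat).
Notation pt := 'rV[R]_d.
Implicit Types (x y z : pt) (g : pt -> R).

Lemma powR_le (x y r : R) : 0 <= r -> 0 <= x -> x <= y -> x `^ r <= y `^ r.
Proof.
by move=> r0 x0 xy; rewrite ge0_ler_powR ?nnegrE// (le_trans x0).
Qed.

Lemma normr_coord x i : `|x 0 i| <= `|x|.
Proof.
rewrite [`|x|]mx_normrE -[`|x 0 i|]/((fun p : 'I_1 * 'I_d => `|x p.1 p.2|) (0, i)).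
exact: le_bigmax.
Qed.

Lemma normr_row_le x (K : R) : 0 <= K -> (forall i, `|x 0 i| <= K) -> `|x| <= K.
Proof.
move=> K0 xK; rewrite [`|x|]mx_normrE; apply/bigmax_leP; split=> // -[a i] _ /=.
by rewrite ord1.
Qed.

Lemma norm_e (i : 'I_d) : `|e_ R i| = 1.
Proof.
apply/eqP; rewrite eq_le; apply/andP; split.
  apply: normr_row_le => // j; rewrite /e_ mxE eqxx /=.
  by case: (_ == _); rewrite ?normr1 ?normr0.
by have := normr_coord (e_ R i) i; rewrite /e_ mxE !eqxx normr1.
Qed.

(** A gauge instead of a norm: estimates become implications between such predicates, with no
    supremum to be shown finite or attained. *)
Definition hol (b K : R) g :=
  [/\ periodic g, forall x, `|g x| <= K & holder b K g].

Lemma hol_ge0 (b K : R) g : hol b K g -> 0 <= K.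
Proof. by case=> _ gK _; apply: le_trans (gK 0). Qed.

(** For |y| <= 1 the larger power is the smaller number; for |y| > 1 twice the supremum suffices,
    whence the factor 2. *)
Lemma holder_lower (b s K : R) g : 0 < s -> s <= b -> (forall x, `|g x| <= K) ->
  holder b K g -> holder s (2 * K) g.
Proof.
move=> s0 sb gK gH x y; have K0 : 0 <= K by apply: le_trans (gK 0).
have [y1|y1] := leP `|y| 1.
  apply: le_trans (gH x y) _; rewrite -mulrA mulr_natl mulr2n.
  apply: ler_wpDl; first by rewrite mulr_ge0 ?powR_ge0.
  rewrite ler_wpM2l//; have [->|y0] := eqVneq y 0.
    by rewrite normr0 !powR0 ?gt_eqF// (lt_le_trans s0).
  by rewrite ger_powR// normr_gt0 y0.
apply: (@le_trans _ _ (2 * K)).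
  by rewrite mulr_natl mulr2n (le_trans (ler_normB _ _)) ?lerD.
rewrite ler_peMr ?mulr_ge0//.
by have := powR_le (ltW s0) ler01 (ltW y1); rewrite powR1.
Qed.

Lemma hol_lower (b s K : R) g : 0 < s -> s <= b -> hol b K g -> hol s (2 * K) g.
Proof.
move=> s0 sb gH; have K0 := hol_ge0 gH; case: gH => gp gK gH; split=> //.
  by move=> x; apply: le_trans (gK x) _; rewrite mulr_natl mulr2n lerDl.
exact: holder_lower gH.
Qed.

(** The second difference of [g] is symmetric in [y] and [z], hence at most 2 H min(|y|,|z|)^b, and
    this power of the minimum is at most |y|^(b-s) |z|^s. A sup bound depending on the [s]-Hölder
    constant thus becomes a Hölder bound of exponent b-s when applied to translates. *)
Lemma holder_transB (b s H : R) g y : 0 < s -> s < b -> 0 <= H -> holder b H g ->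
  holder s (2 * H * `|y| `^ (b - s)) (fun z => g (z + y) - g z).
Proof.
move=> s0 sb H0 gH x z /=.
have E (w : R) : w `^ b = w `^ s * w `^ (b - s).
  rewrite -powRD; first by rewrite addrC subrK.
  by rewrite addrC subrK gt_eqF// (lt_trans s0).
have P (w w' : R) : 0 <= w -> w <= w' -> w `^ (b - s) <= w' `^ (b - s).
  by apply: powR_le; rewrite subr_ge0 ltW.
have Q (w w' : R) : 0 <= w -> w <= w' -> w `^ s <= w' `^ s.
  by apply: powR_le; rewrite ltW.
have M : Num.min `|y| `|z| `^ b <= `|y| `^ (b - s) * `|z| `^ s.
  rewrite E mulrC; apply: ler_pM; rewrite ?powR_ge0//.
    by apply: P; rewrite ?le_min ?normr_ge0 ?ge_min ?lexx.
  by apply: Q; rewrite ?le_min ?normr_ge0 ?ge_min ?lexx ?orbT.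
rewrite -mulrA -mulrA; apply: (@le_trans _ _ (2 * (H * Num.min `|y| `|z| `^ b))).
  rewrite mulr_natl mulr2n; case: (leP `|y| `|z|) => _.
    have -> : g (x + z + y) - g (x + z) - (g (x + y) - g x) =
      (g (x + z + y) - g (x + z)) - (g (x + y) - g x) by [].
    by rewrite (le_trans (ler_normB _ _))// lerD.
  have -> : g (x + z + y) - g (x + z) - (g (x + y) - g x) =
      (g (x + y + z) - g (x + y)) - (g (x + z) - g x).
    by rewrite -!addrA (addrC y z); ring.
  by rewrite (le_trans (ler_normB _ _))// lerD.
by apply: ler_wpM2l => //; rewrite -?mulrA; apply: ler_wpM2l.
Qed.

Lemma periodicB_trans g y : periodic g -> periodic (fun z => g (z + y) - g z).
Proof. by move=> gp x i; rewrite addrAC !gp. Qed.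

End TorusBasics.

(** * Schauder bounds on a mesh, uniform in its size *)

Section DiscreteSchauder.
Variables (R : realType) (d : nat) (lam : R) (lam0 : 0 < lam).
Notation pt := 'rV[R]_d.
Implicit Types (x y z : pt) (g : pt -> R).

Section Mesh.
Variable n : nat.
Definition mesh : R := n.+1%:R^-1.
Let h := mesh.
Definition step (i : 'I_d) : pt := h *: e_ R i.
(** Chosen so that (4 / h^2) (1/c - [dwalk]) equals [lam] + (4 / h^2) (1 - [dwalk]), the discrete
    operator; this is also the origin of the factor c h^2 / 4 in [dres]. *)
Definition damp : R := (1 + lam * h ^+ 2 / 4)^-1.
Let c := damp.
Definition dwalk := walks [seq step i | i <- enum 'I_d].
(** The series is cut after h^(-3) terms: one step damps by 1 - O(h^2), so the truncation error
    vanishes with h, as [damp_pow] shows. *)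
Definition dres g x := c * h ^+ 2 / 4 * rsum dwalk c (n.+1 ^ 3) g x.

Let h0 : 0 < h. Proof. by rewrite invr_gt0 ltr0n. Qed.
Let D0 : 0 < 1 + lam * h ^+ 2 / 4.
Proof. by rewrite addr_gt0// divr_gt0// mulr_gt0// exprn_gt0. Qed.

Lemma damp01 : 0 < c < 1.
Proof.
rewrite invr_gt0 D0 /= /c /damp invf_lt1// ltrDl divr_gt0// mulr_gt0//.
by rewrite exprn_gt0.
Qed.

Lemma damp_resolvent : c * h ^+ 2 / 4 / (1 - c) = lam^-1.
Proof.
have -> : 1 - c = c * (lam * h ^+ 2 / 4).
  rewrite -[X in X - c](mulVf (lt0r_neq0 D0)) -/damp -/c; ring.
have /andP[c0 _] := damp01.
by field; rewrite !lt0r_neq0.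
Qed.

Lemma norm_step i : `|step i| = h.
Proof. by rewrite normrZ norm_e mulr1 gtr0_norm. Qed.

Lemma averaging_dwalk : averaging dwalk. Proof. exact: averaging_walks. Qed.

Lemma dresB g x y :
  dres g (x + y) - dres g x = dres (fun z => g (z + y) - g z) x.
Proof. by rewrite /dres -mulrBr rsum_transB//; exact: averaging_dwalk. Qed.

Lemma dres_periodic g : periodic g -> periodic (dres g).
Proof.
move=> gp x i; congr (_ * _); apply: rsum_inv => [|z]; last exact: gp.
exact: averaging_dwalk.
Qed.

Let kappa0 : 0 <= c * h ^+ 2 / 4.
Proof.
by have /andP[c0 _] := damp01; rewrite divr_ge0// mulr_ge0 ?exprn_ge0 ?ltW.
Qed.

Lemma dres_norm g K : (forall x, `|g x| <= K) -> forall x, `|dres g x| <= K / lam.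
Proof.
move=> gK x; have K0 : 0 <= K by apply: le_trans (gK 0).
have /andP[c0 c1] := damp01.
rewrite /dres normrM ger0_norm// mulrC -damp_resolvent.
apply: le_trans (ler_wpM2r kappa0 (rsum_norm averaging_dwalk _ (ltW c0) gK x)) _.
have := ler_wpM2l (mulr_ge0 K0 kappa0) (sum_geom_le (n.+1 ^ 3) damp01).
set S := \sum_(_ < _) _ => B.
rewrite [X in X <= _](_ : _ = K * (c * h ^+ 2 / 4) * S); last by ring.
by rewrite [X in _ <= X]mulrA.
Qed.

(** Summing k^(b/2-1) up to the diffusive time h^(-2) costs h^(-b), which the factor h^b from the
    step length cancels; later the damping takes over. The two ranges of time produce 8/b and
    16/lam, both free of h. *)
Lemma dres_diff2 g (b H : R) : 0 < b < 1 -> 0 <= H -> holder b H g ->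
  forall i j x, `|fdiff (step j) (fdiff (step i) (dres g)) x| <=
  h ^+ 2 * ((8 / b + 16 / lam) * H).
Proof.
move=> /andP[b0 b1] H0 gH i j x; have /andP[c0 c1] := damp01.
have mem k : step k \in [seq step i | i <- enum 'I_d].
  by apply/mapP; exists k => //; rewrite mem_enum.
have [L avL E] := walks_factor (mem j) (mem i).
have B m z : `|fdiff (step j) (fdiff (step i) (iter m dwalk g)) z| <=
    16 * (H * h `^ b) * m.+1%:R `^ (b / 2 - 1).
  have -> : iter m dwalk g =
      iter m (fun f => avg (step j) (avg (step i) (L f))) g.
    by congr (iter m _ g); apply/funext => f; rewrite -E.
  apply: le_trans (diff2_iter_holder _ _ m avL _ H0 gH z) _.
    by rewrite !ltW.
  apply: ler_wpM2r; rewrite ?powR_ge0//; do 2! apply: ler_wpM2l => //.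
  apply: powR_le; rewrite ?(ltW b0) ?divr_ge0 ?normr_ge0// norm_step.
  by rewrite ler_pdivrMr// ler_peMr ?(ltW h0)// ler1n.
have S := rsum_diff2 (n.+1 ^ 3) (ltW c0) B x.
have -> : fdiff (step j) (fdiff (step i) (dres g)) x =
    c * h ^+ 2 / 4 * fdiff (step j) (fdiff (step i) (rsum dwalk c (n.+1 ^ 3) g)) x.
  by rewrite /fdiff /dres; ring.
rewrite normrM (ger0_norm kappa0).
apply: le_trans (ler_wpM2l kappa0 S) _.
have -> : \sum_(k < n.+1 ^ 3) c ^+ k * (16 * (H * h `^ b) * k.+1%:R `^ (b / 2 - 1)) =
   16 * H * h `^ b * \sum_(k < n.+1 ^ 3) c ^+ k * k.+1%:R `^ (b / 2 - 1).
  by rewrite mulr_sumr; apply: eq_bigr => k _; ring.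
have b2 : 0 < b / 2 < 1 by apply/andP; split; lra.
(* The sum is split at time h^(-2), the order of 1/(1-c). *)
have M0 : (0 < n.+1 ^ 2)%N by rewrite expn_gt0.
have T := sum_geom_powR_le (n.+1 ^ 3) damp01 b2 M0.
have n0 : 0 < n.+1%:R :> R by rewrite ltr0n.
have P : (n.+1 ^ 2)%:R `^ (b / 2) = (h `^ b)^-1 :> R.
  rewrite natrX -powR_mulrn ?ltW// -powRrM mulrC divfK//.
  have hn : h `^ b * n.+1%:R `^ b = 1.
    rewrite -powRM ?(ltW h0) ?(ltW n0)// /h /mesh mulVf ?powR1//.
  by rewrite -[LHS]mul1r -[X in X * _](mulVf (lt0r_neq0 (powR_gt0 b h0))) -mulrA hn mulr1.
have P' : (n.+1 ^ 2)%:R `^ (b / 2 - 1) = (h `^ b)^-1 * h ^+ 2 :> R.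
  rewrite powRD ?pnatr_eq0 ?expn_eq0 ?implybT// P; congr (_ * _).
  by rewrite powRN powRr1// /h /mesh natrX exprVn.
rewrite P P' in T.
have hb : 0 < h `^ b by rewrite powR_gt0.
have T2 := ler_wpM2l (ltW hb) T.
have T3 := ler_wpM2l (mulr_ge0 (ler0n R 16) H0) T2.
have T4 := ler_wpM2l kappa0 T3.
rewrite -[16 * H * h `^ b * _]mulrA; apply: le_trans T4 _.
have -> : c * h ^+ 2 / 4 * (16 * H * (h `^ b * ((h `^ b)^-1 / (b / 2) +
    (h `^ b)^-1 * h ^+ 2 / (1 - c)))) =
  c * h ^+ 2 * 8 * H / b + (c * h ^+ 2 / 4 / (1 - c)) * 16 * H * h ^+ 2.
  by field; rewrite !gt_eqF ?subr_gt0.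
rewrite damp_resolvent.
have -> : h ^+ 2 * ((8 / b + 16 / lam) * H) =
  1 * h ^+ 2 * 8 * H / b + lam^-1 * 16 * H * h ^+ 2.
  by field; rewrite !gt_eqF.
rewrite lerD// !ler_wpM2r ?invr_ge0 ?(ltW b0) ?exprn_ge0 ?(ltW h0)//.
exact: ltW.
Qed.

Lemma trans_steps g i x : periodic g -> g (x + step i *+ n.+1) = g x.
Proof.
by move=> gp; rewrite /step -scaler_nat scalerA divff ?pnatr_eq0// scale1r gp.
Qed.

(* The increments of a periodic function along one period sum to zero, so each
   is bounded by their oscillation. *)
Lemma dres_diff g (b H : R) : 0 < b < 1 -> 0 <= H -> periodic g ->
  holder b H g -> forall i x,
  `|fdiff (step i) (dres g) x| <= h * ((8 / b + 16 / lam) * H).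
Proof.
move=> b01 H0 gp gH i x; set C := (_ * H).
have C0 : 0 <= C.
  have /andP[b0 _] := b01.
  by rewrite mulr_ge0// addr_ge0// divr_ge0// ltW.
pose G := fdiff (step i) (dres g).
have n0 : 0 < n.+1%:R :> R by rewrite ltr0n.
have osc k : (k <= n)%N -> `|G x - G (x + step i *+ k)| <= h * C.
  move=> kn; have : `|G x - G (x + step i *+ k)| <= k%:R * (h ^+ 2 * C).
    elim: k {kn} => [|k IH]; first by rewrite mulr0n addr0 subrr normr0 mul0r.
    have -> : G x - G (x + step i *+ k.+1) = (G x - G (x + step i *+ k)) -
        fdiff (step i) G (x + step i *+ k).
      by rewrite /fdiff mulrSr addrA; ring.
    rewrite -natr1 mulrDl mul1r (le_trans (ler_normB _ _))// lerD//.
    exact: (dres_diff2 b01).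
  move=> /le_trans; apply.
  have kh : k%:R * h <= 1.
    by rewrite ler_pdivrMr// mul1r ler_nat ltnW.
  have -> : k%:R * (h ^+ 2 * C) = (k%:R * h) * (h * C) by ring.
  by rewrite ler_piMl// mulr_ge0// ltW.
have tele : \sum_(k < n.+1) G (x + step i *+ k) = 0.
  have H1 N : \sum_(k < N) G (x + step i *+ k) = dres g (x + step i *+ N) - dres g x.
    elim: N => [|N IH]; first by rewrite big_ord0 mulr0n addr0 subrr.
    by rewrite big_ord_recr /= IH mulrSr [x + (_ + _)]addrA /G /fdiff; ring.
  by rewrite H1 trans_steps ?subrr//; exact: dres_periodic.
rewrite -(ler_pM2l n0) -[X in X * `| _ |](normr_nat R) -normrM.
have -> : n.+1%:R * fdiff (step i) (dres g) x =
    \sum_(k < n.+1) (G x - G (x + step i *+ k)).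
  by rewrite sumrB tele subr0 sumr_const card_ord mulr_natl.
apply: le_trans (ler_norm_sum _ _ _) _.
apply: (@le_trans _ _ (\sum_(k < n.+1) h * C)).
  by apply: ler_sum => k _; apply: osc; rewrite -ltnS.
by rewrite sumr_const card_ord mulr_natl.
Qed.

(** Bernoulli's inequality for powers of 1/c = 1 + lam h^2 / 4: after h^(-3) steps the linear term
    is lam / (4 h). *)
Lemma damp_pow : c ^+ (n.+1 ^ 3) <= 4 / lam * h.
Proof.
have /andP[c0 c1] := damp01.
have n0 : 0 < n.+1%:R :> R by rewrite ltr0n.
have B m : 1 + m%:R * (lam * h ^+ 2 / 4) <= (c ^+ m)^-1.
  elim: m => [|m IH]; first by rewrite mul0r addr0 expr0 invr1.
  rewrite [c ^+ _.+1]exprS invfM [c^-1]invrK.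
  have q0 : 0 <= lam * h ^+ 2 / 4 by rewrite divr_ge0// mulr_ge0 ?exprn_ge0 ?ltW.
  apply: le_trans (ler_wpM2l (ltW D0) IH).
  rewrite -natr1 -subr_ge0.
  have -> : (1 + lam * h ^+ 2 / 4) * (1 + m%:R * (lam * h ^+ 2 / 4)) -
      (1 + (m%:R + 1) * (lam * h ^+ 2 / 4)) = m%:R * (lam * h ^+ 2 / 4) ^+ 2 by ring.
  by rewrite mulr_ge0 ?exprn_ge0.
have := B (n.+1 ^ 3)%N; rewrite natrX.
have -> : n.+1%:R ^+ 3 * (lam * h ^+ 2 / 4) = lam / 4 * h^-1.
  by rewrite /h /mesh; field; rewrite addrC natr1 pnatr_eq0.
move=> B1; have l0 : 0 < lam / 4 * h^-1 by rewrite mulr_gt0 ?divr_gt0 ?invr_gt0.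
have : lam / 4 * h^-1 <= (c ^+ (n.+1 ^ 3))^-1.
  by apply: le_trans B1; rewrite lerDr.
rewrite -lef_pV2 ?posrE ?invr_gt0 ?exprn_gt0// invrK => /le_trans; apply.
by rewrite le_eqVlt; apply/orP; left; apply/eqP; field; rewrite !gt_eqF.
Qed.

(** The resolvent identity gives the equation for 4 h^(-2) ([dwalk] - 1) up to the truncation error,
    and [walks_close] replaces this operator by the sum of second difference quotients at the price
    d^2 e. *)
Lemma dres_eq g (e K : R) : 0 <= e -> (forall x, `|g x| <= K) ->
  (forall i j x, `|fdiff (step i) (fdiff (step i) (dres g)) (x - step j) -
                   fdiff (step i) (fdiff (step i) (dres g)) x| <= h ^+ 2 * e) ->
  forall x, `|lam * dres g x - \sum_(i < d) h ^- 2 *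
     fdiff (step i) (fdiff (step i) (dres g)) x - g x| <=
    d%:R ^+ 2 * e + 4 / lam * h * K.
Proof.
move=> e0 gK H x; have /andP[c0 c1] := damp01.
have K0 : 0 <= K by apply: le_trans (gK 0).
have k0 : 0 <= h ^- 2 by rewrite invr_ge0 exprn_ge0 ?ltW.
have := walks_close (s := [seq step i | i <- enum 'I_d]) (f := dres g) e0 _ k0 x.
rewrite size_map size_enum_ord big_map big_enum /= => W0.
have W : `|4 * h ^- 2 * (dwalk (dres g) x - dres g x) -
   \sum_(i < d) h ^- 2 * fdiff (step i) (fdiff (step i) (dres g)) x| <= d%:R ^+ 2 * e.
  apply: W0 => // y z w /mapP[i _ ->] /mapP[j _ ->].
  by rewrite -ler_pdivlMr ?invr_gt0 ?exprn_gt0// invrK mulrC; exact: H.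
have E : lam * dres g x - 4 * h ^- 2 * (dwalk (dres g) x - dres g x) - g x =
    - (c ^+ (n.+1 ^ 3) * iter (n.+1 ^ 3) dwalk g x).
  have /esym := rsum_resolvent averaging_dwalk c (n.+1 ^ 3) g x.
  have -> : dwalk (dres g) x = c * h ^+ 2 / 4 * dwalk (rsum dwalk c (n.+1 ^ 3) g) x.
    by rewrite /dres averagingZ//; exact: averaging_dwalk.
  rewrite /dres; set r := rsum _ _ _ _ _; set q := dwalk _ x.
  set t := c ^+ _ * _ => E; have -> : g x = r - c * q + t by rewrite -E subrK.
  have -> : lam = (c^-1 - 1) * 4 / h ^+ 2.
    by rewrite /c /damp invrK; field; rewrite gt_eqF.
  by field; rewrite !gt_eqF.
have T : `|c ^+ (n.+1 ^ 3) * iter (n.+1 ^ 3) dwalk g x| <= 4 / lam * h * K.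
  rewrite normrM ger0_norm ?exprn_ge0 ?(ltW c0)//; apply: ler_pM => //.
  - by rewrite exprn_ge0 ?ltW.
  - exact: damp_pow.
  - by case: (averaging_iter (n.+1 ^ 3) averaging_dwalk) => _ _; apply.
move: W E T; set S := \sum_(i < d) _; set q := 4 * _ * _; set t := c ^+ _ * _.
move=> W E T.
have -> : lam * dres g x - S - g x = (q - S) + (lam * dres g x - q - g x) by ring.
by rewrite E (le_trans (ler_normD _ _))// normrN lerD.
Qed.

End Mesh.
End DiscreteSchauder.

(** * Limits along an ultrafilter *)

Section UltraLimit.
Variables (R : realType) (U : set_system nat).
Hypotheses (ultraU : UltraFilter U) (leU : \oo `<=` U).

(** One ultrafilter serves all bounded sequences, so solutions and difference quotients converge at
    every point together, without extraction of subsequences. *)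
Definition ulim (a : nat -> R) : R := lim (a @ U).

Lemma ulim_cvg (K : R) a : (forall n, `|a n| <= K) -> a @ U --> ulim a.
Proof.
move=> aK.
(* A finer proper filter cannot contain a set whose complement has its preimage in [U], so the image
   filter is maximal. *)
have ultra_a : UltraFilter (a @ U).
  split=> [|G PG sub]; first exact: fmap_proper_filter.
  apply/seteqP; split=> [B GB|]; last exact: sub.
  have [//|nB] := in_ultra_setVsetC (a @^-1` B) ultraU.
  have GnB : G (~` B) by apply: sub; rewrite /= /nbhs /= in nB *.
  by have := @filterI _ G PG _ _ GB GnB; rewrite setICr => /(@filter_not_empty _ G PG).
have := @segment_compact R (- K) K; rewrite compact_ultra => /(_ _ ultra_a).
have aIn : (a @ U) `[- K, K]%classic.
  apply: leU; exists 0%N => // n _ /=.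
  by rewrite in_itv /= -ler_norml aK.
move=> /(_ aIn)[p [_ pl]].
by apply: (cvgP p); exact: pl.
Qed.

Lemma cvg_ultra (a : nat -> R) (l : R) : a @ \oo --> l -> a @ U --> l.
Proof. by move=> al; apply: cvg_trans al => A /= HA; exact: leU. Qed.

Lemma ulim_norm_le (a e : nat -> R) (l c : R) : a @ U --> l ->
  (forall n, `|a n| <= c + e n) -> e @ \oo --> 0 -> `|l| <= c.
Proof.
move=> al ae e0; rewrite -[c]addr0.
apply: (ler_cvg_to (a := U) (f := fun n => `|a n|) (g := fun n => c + e n)).
- exact: cvg_norm.
- by apply: cvgD; [exact: cvg_cst|exact: cvg_ultra].
- by apply: nearW.
Qed.

Lemma ulim_norm_le0 (a : nat -> R) (l c : R) : a @ U --> l ->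
  (forall n, `|a n| <= c) -> `|l| <= c.
Proof.
move=> al ac; apply: (ulim_norm_le (e := fun=> 0) al); last exact: cvg_cst.
by move=> n; rewrite addr0.
Qed.

End UltraLimit.

Lemma ultra_nat : exists U : set_system nat, UltraFilter U /\ \oo `<=` U.
Proof. exact: ultraFilterLemma. Qed.

(** * Differentiability from Taylor inequalities *)

Section TaylorCriterion.
Variables (R : realType) (d : nat).
Notation pt := 'rV[R]_d.
Implicit Types (x y z : pt) (g : pt -> R).

Definition dotlin (w : 'I_d -> R) (y : pt) : R := \sum_(i < d) y 0 i * w i.

Lemma dotlin_linear w : linear (dotlin w).
Proof.
move=> a x y; rewrite /dotlin scaler_sumr -big_split; apply: eq_bigr => i _ /=.
by rewrite !mxE mulrDl -mulrA.
Qed.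
HB.instance Definition _ w :=
  GRing.isLinear.Build R pt R *:%R (dotlin w) (dotlin_linear w).

Lemma dotlin_continuous w : continuous (dotlin w).
Proof.
rewrite /dotlin; apply: continuous_big => [|i _]; first exact: add_continuous.
have C : continuous (fun y : pt => y 0 i) by exact: coord_continuous.
by move=> x; exact: cvgM (C x) (cvg_cst _).
Qed.

Lemma dotlin_e w i : dotlin w (e_ R i) = w i.
Proof.
rewrite /dotlin (bigD1 i)//= big1 ?addr0 => [|j ji]; rewrite /e_ mxE !eqxx ?mul1r//=.
by rewrite (negPf ji) mul0r.
Qed.

(** Derivatives do not pass to pointwise limits but Taylor inequalities do, so the differentiability
    of the limit of the mesh solutions is read off from a remainder of order 1+a. *)
Lemma differentiable_taylor g w x (M a : R) : 0 < a ->
  (forall y, `|g (x + y) - g x - dotlin w y| <= M * `|y| `^ (1 + a)) ->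
  differentiable g x /\ forall i, 'D_(e_ R i) g x = w i.
Proof.
move=> a0 H.
have M0 : 0 <= `|M| + 1 by rewrite addr_ge0.
have E : (g : pt -> R^o) \o shift x =
    cst (g x : R^o) + (dotlin w : {linear pt -> R^o}) +o_ (0 : pt) id.
  apply/eqaddoP => _/posnumP[eps].
  have r0 : 0 < (eps%:num / (`|M| + 1)) `^ a^-1.
    by rewrite powR_gt0// divr_gt0// ltr_pwDr.
  near=> y.
  rewrite /= /cst !fctE /= [y + x]addrC opprD addrA.
  apply: le_trans (H y) _; have [->|y0] := eqVneq y 0.
    by rewrite normr0 powR0 ?mulr0// gt_eqF// addr_gt0.
  rewrite powRD ?normr_eq0 ?(negPf y0) ?implybT// powRr1// mulrCA mulrC.
  rewrite ler_wpM2r//; apply: (@le_trans _ _ ((`|M| + 1) * `|y| `^ a)).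
    by rewrite ler_wpM2r ?powR_ge0// (le_trans (ler_norm M))// lerDl.
  rewrite mulrC -ler_pdivlMr ?ltr_pwDr//.
  have -> : eps%:num / (`|M| + 1) = ((eps%:num / (`|M| + 1)) `^ a^-1) `^ a.
    by rewrite -powRrM mulVf ?gt_eqF// powRr1// divr_ge0.
  apply: powR_le; [exact: ltW|exact: normr_ge0|].
  by near: y; exact: (@nbhs0_le _ pt _ r0).
have dE := diff_unique (@dotlin_continuous w) E.
have dg : differentiable g x.
  by apply/diff_locallyP; rewrite dE; split => //; exact: dotlin_continuous.
by split=> // i; rewrite deriveE// dE; exact: dotlin_e.
Unshelve. all: by end_near. Qed.

(** A backward step from [x] is a forward step from its end point; exchanging the base points costs
    a Hölder increment of [k], whence the factor 2. *)
Lemma taylor_axis g (k : pt -> R) (C a : R) i x t : 0 < a ->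
  (forall x s, 0 <= s -> `|g (x + s *: e_ R i) - g x - s * k x| <= C * s `^ (1 + a)) ->
  holder a C k ->
  `|g (x + t *: e_ R i) - g x - t * k x| <= 2 * C * `|t| `^ (1 + a).
Proof.
move=> a0 H kH.
have E (s : R) : 0 <= s -> s `^ (1 + a) = s * s `^ a.
  move=> s0; rewrite powRD ?powRr1// .
  by apply/implyP; rewrite gt_eqF// addr_gt0.
have C0 : 0 <= C.
  have := H x 1 ler01; rewrite powR1 mulr1; exact: le_trans.
have [t0|t0] := leP 0 t.
  rewrite (ger0_norm t0) (le_trans (H _ _ t0))// -mulrA ler_peMl//.
    by rewrite mulr_ge0 ?powR_ge0.
  by rewrite ler1n.
set y := x + t *: e_ R i.
have := H y (- t); rewrite oppr_ge0 => /(_ (ltW t0)).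
have -> : y + - t *: e_ R i = x by rewrite /y scaleNr addrK.
have := kH x (t *: e_ R i); rewrite -/y normrZ norm_e mulr1 (ltr0_norm t0).
move=> H1 H2.
have -> : g y - g x - t * k x = - (g x - g y - (- t) * k y) + t * (k y - k x) by ring.
rewrite (le_trans (ler_normD _ _))// normrN -mulrA mulr_natl mulr2n lerD//.
rewrite normrM (ltr0_norm t0) (E (- t)) ?oppr_ge0 ?(ltW t0)// mulrCA.
by apply: ler_wpM2l => //; rewrite oppr_ge0 ltW.
Qed.

Lemma C1_taylor g (w : 'I_d -> pt -> R) (C a : R) : 0 < a ->
  (forall i x s, 0 <= s ->
    `|g (x + s *: e_ R i) - g x - s * w i x| <= C * s `^ (1 + a)) ->
  (forall i, holder a C (w i)) ->
  (forall x, differentiable g x) /\ forall i, partial i g = w i.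
Proof.
move=> a0 H wH.
suff S x : differentiable g x /\ forall i, 'D_(e_ R i) g x = w i x.
  by split=> [x|i]; [case: (S x)|apply/funext => x; case: (S x) => _; exact].
apply: (@differentiable_taylor g (w^~ x) x (d%:R * (3 * C)) a) => // y.
(* Coordinates are changed one at a time, [cut s] keeping those in [s]. Each change costs 2C by
   [taylor_axis] and C for moving the base point of [w i] back to [x]. *)
pose cut (s : seq 'I_d) : pt := \row_j (y 0 j *+ (j \in s)).
have cut_le s : `|cut s| <= `|y|.
  apply: normr_row_le => // j; rewrite mxE; case: (j \in s).
    exact: normr_coord.
  by rewrite mulr0n normr0.
have E (s : R) : 0 <= s -> s `^ (1 + a) = s * s `^ a.
  move=> s0; rewrite powRD ?powRr1// .
  by apply/implyP; rewrite gt_eqF// addr_gt0.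
have main s : uniq s ->
    `|g (x + cut s) - g x - \sum_(i <- s) y 0 i * w i x| <=
    (size s)%:R * (3 * C) * `|y| `^ (1 + a).
  elim: s => [_|i s IH /= /andP[ins us]].
    have -> : cut [::] = 0 by apply/rowP => j; rewrite !mxE mulr0n.
    by rewrite addr0 big_nil subrr subr0 normr0 !mul0r.
  have C0 : 0 <= C.
    have := H i x 1 ler01; rewrite powR1 mulr1; exact: le_trans.
  have cutS : x + cut (i :: s) = (x + cut s) + y 0 i *: e_ R i.
    rewrite -addrA; congr (_ + _); apply/rowP => j; rewrite !mxE eqxx inE /=.
    have [->|ji] := eqVneq j i; first by rewrite (negPf ins) mulr0n add0r mulr1 mulr1n.
    by rewrite mulr0 addr0.
  rewrite big_cons cutS; set z := x + cut s.
  have T := taylor_axis z (y 0 i) a0 (H i) (wH i).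
  have W := wH i x (cut s); rewrite -/z in W.
  have -> : g (z + y 0 i *: e_ R i) - g x -
      (y 0 i * w i x + \sum_(j <- s) y 0 j * w j x) =
    (g z - g x - \sum_(j <- s) y 0 j * w j x) +
    ((g (z + y 0 i *: e_ R i) - g z - y 0 i * w i z) +
     y 0 i * (w i z - w i x)) by ring.
  have -> : (size (i :: s))%:R * (3 * C) * `|y| `^ (1 + a) =
      (size s)%:R * (3 * C) * `|y| `^ (1 + a) + 3 * C * `|y| `^ (1 + a).
    by rewrite /= -natr1; ring.
  rewrite (le_trans (ler_normD _ _))// lerD ?IH//.
  rewrite (le_trans (ler_normD _ _))//.
  have -> : 3 * C * `|y| `^ (1 + a) = 2 * C * `|y| `^ (1 + a) + `|y| * (C * `|y| `^ a).
    by rewrite !E//; ring.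
  apply: lerD.
    apply: (le_trans T); rewrite ler_wpM2l ?mulr_ge0//.
    by apply: powR_le; rewrite ?normr_coord// addr_ge0// ltW.
  rewrite normrM ler_pM ?normr_coord//; apply: (le_trans W).
  by rewrite ler_wpM2l// powR_le ?cut_le// ltW.
have := main (enum 'I_d) (enum_uniq _); rewrite size_enum_ord big_enum /=.
have -> : cut (enum 'I_d) = y by apply/rowP => j; rewrite mxE mem_enum mulr1n.
by [].
Qed.

Lemma holder_continuous g (C a : R) : 0 < a -> holder a C g -> continuous g.
Proof.
move=> a0 gH x; apply/(@cvgrPdist_le _ _ _ (nbhs x) (nbhs_filter x)) => e e0.
have C0 : 0 < `|C| + 1 by rewrite ltr_pwDr.
have r0 : 0 < (e / (`|C| + 1)) `^ a^-1 by rewrite powR_gt0// divr_gt0.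
have := @cvgr_dist_le _ pt _ (nbhs x) (nbhs_filter x) id x cvg_id _ r0.
apply: filterS => y /=; rewrite distrC => yr.
have -> : y = x + (y - x) by rewrite addrC subrK.
rewrite distrC (le_trans (gH _ _))//.
apply: (@le_trans _ _ ((`|C| + 1) * `|y - x| `^ a)).
  by rewrite ler_wpM2r ?powR_ge0// (le_trans (ler_norm C))// lerDl.
rewrite mulrC -ler_pdivlMr//.
have -> : e / (`|C| + 1) = ((e / (`|C| + 1)) `^ a^-1) `^ a.
  by rewrite -powRrM mulVf ?gt_eqF// powRr1// divr_ge0// ltW.
by apply: powR_le; rewrite ?(ltW a0).
Qed.

Lemma C2_taylor g (w1 : 'I_d -> pt -> R) (w2 : 'I_d -> 'I_d -> pt -> R) (C a : R) :
  0 < a ->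
  (forall i x s, 0 <= s ->
    `|g (x + s *: e_ R i) - g x - s * w1 i x| <= C * s `^ (1 + a)) ->
  (forall i j x s, 0 <= s ->
    `|w1 i (x + s *: e_ R j) - w1 i x - s * w2 i j x| <= C * s `^ (1 + a)) ->
  (forall i, holder a C (w1 i)) -> (forall i j, holder a C (w2 i j)) ->
  [/\ C2 g, forall i, partial i g = w1 i &
      forall i j, partial j (partial i g) = w2 i j].
Proof.
move=> a0 T1 T2 H1 H2.
have [d1 p1] := C1_taylor a0 T1 H1.
have S i := C1_taylor a0 (T2 i) (H2 i).
have p2 i j : partial j (partial i g) = w2 i j by rewrite p1; case: (S i).
split=> //; split=> //; split=> i; first by rewrite p1; case: (S i).
by move=> j; rewrite p2; exact: holder_continuous (H2 i j).
Qed.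

End TaylorCriterion.

(** * Passage to the limit in the mesh problem *)

Section SchauderExistence.
Variables (R : realType) (d : nat).
Notation pt := 'rV[R]_d.
Implicit Types (x y z : pt) (g : pt -> R).

Definition c2h (b K : R) g :=
  [/\ periodic g, C2 g, forall x, `|g x| <= K,
      forall i x, `|partial i g x| <= K &
      forall i j, (forall x, `|partial j (partial i g) x| <= K) /\
        holder b K (partial j (partial i g))].

(** The length [t] is covered by floor(t/h) mesh steps, where the increment is exactly h times [k],
    and a rest of length at most h, which is responsible for the terms that vanish with h. *)
Lemma taylor_mesh n (g k : pt -> R) (C a t : R) i x : 0 < a -> 0 <= t ->
  (forall x, `|k x| <= C) -> holder a C g -> holder a C k ->
  (forall x, fdiff (step R n i) g x = mesh R n * k x) ->
  `|g (x + t *: e_ R i) - g x - t * k x| <=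
    C * t `^ (1 + a) + C * (mesh R n `^ a + mesh R n).
Proof.
move=> a0 t0 kC gH kH gk; set h := mesh R n.
have h0 : 0 < h by rewrite invr_gt0 ltr0n.
have C0 : 0 <= C by apply: le_trans (kC 0).
pose l := Num.truncn (t / h).
have /andP[l1 l2] : l%:R <= t / h < l.+1%:R.
  by apply: Num.Theory.truncn_itv; rewrite divr_ge0// ltW.
have lt : l%:R * h <= t by rewrite -ler_pdivlMr.
pose r := t - l%:R * h.
have r0 : 0 <= r by rewrite subr_ge0.
have rh : r <= h.
  by move: l2; rewrite ltr_pdivrMr// -natr1 mulrDl mul1r /r => /ltW; rewrite lerBlDl.
have E1 : `|g (x + t *: e_ R i) - g (x + step R n i *+ l)| <= C * h `^ a.
  have -> : x + t *: e_ R i = x + step R n i *+ l + r *: e_ R i.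
    rewrite /step -scaler_nat scalerA -addrA -scalerDl /r; congr (_ + _ *: _).
    by rewrite addrC subrK.
  apply: (le_trans (gH _ _)); rewrite ler_wpM2l// powR_le ?(ltW a0)//.
  by rewrite normrZ norm_e mulr1 ger0_norm.
have E2 m : (m <= l)%N ->
    `|g (x + step R n i *+ m) - g x - m%:R * h * k x| <= m%:R * h * (C * t `^ a).
  elim: m => [_|m IH ml].
    by rewrite mulr0n addr0 subrr !mul0r subr0 normr0.
  have := gk (x + step R n i *+ m); rewrite /fdiff -addrA -mulrSr => gS.
  have -> : g (x + step R n i *+ m.+1) - g x - m.+1%:R * h * k x =
      (g (x + step R n i *+ m) - g x - m%:R * h * k x) +
      h * (k (x + step R n i *+ m) - k x).
    by rewrite -natr1 mulrBr -gS; ring.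
  rewrite (le_trans (ler_normD _ _))// -natr1 !mulrDl !mul1r.
  rewrite lerD ?IH ?(ltnW ml)// normrM gtr0_norm// ler_wpM2l ?(ltW h0)//.
  apply: (le_trans (kH _ _)); rewrite ler_wpM2l// powR_le ?(ltW a0)//.
  rewrite normrMn norm_step -/h -mulr_natl; apply: le_trans lt.
  by rewrite ler_wpM2r ?(ltW h0)// ler_nat ltnW.
have -> : g (x + t *: e_ R i) - g x - t * k x =
    (g (x + t *: e_ R i) - g (x + step R n i *+ l)) +
    (g (x + step R n i *+ l) - g x - l%:R * h * k x) - r * k x.
  by rewrite /r; ring.
have E3 : `|r * k x| <= C * h.
  by rewrite normrM ger0_norm// mulrC ler_pM.
have E4 : l%:R * h * (C * t `^ a) <= C * t `^ (1 + a).
  rewrite powRD ?powRr1//; last by apply/implyP; rewrite gt_eqF// addr_gt0.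
  by rewrite mulrCA ler_wpM2l// ler_wpM2r ?powR_ge0.
have -> : C * t `^ (1 + a) + C * (h `^ a + h) =
    C * h `^ a + C * t `^ (1 + a) + C * h by ring.
apply: (le_trans (ler_normB _ _)); apply: lerD => //.
by apply: le_trans (ler_normD _ _) (lerD E1 (le_trans (E2 l (leqnn l)) E4)).
Qed.

Lemma mesh_cvg0 : mesh R n @[n --> \oo] --> 0.
Proof. exact: cvg_harmonic. Qed.

Lemma mesh_powR_cvg0 (a : R) : 0 < a -> mesh R n `^ a @[n --> \oo] --> 0.
Proof.
move=> a0; apply/cvgrPdist_le => e e0.
have r0 : 0 < e `^ a^-1 by rewrite powR_gt0.
move/cvgrPdist_le : mesh_cvg0 => /(_ _ r0); apply: filterS => n.
rewrite !sub0r !normrN ger0_norm; last by rewrite invr_ge0.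
rewrite ger0_norm ?powR_ge0// => H.
have -> : e = (e `^ a^-1) `^ a.
  by rewrite -powRrM mulVf ?gt_eqF// powRr1// ltW.
by apply: powR_le; rewrite ?(ltW a0)// invr_ge0.
Qed.

Section Limit.
Variables (U : set_system nat) (ultraU : UltraFilter U) (leU : \oo `<=` U).

Definition plim (g : nat -> pt -> R) x := ulim U (fun n => g n x).

Lemma plim_cvg (g : nat -> pt -> R) (C : R) : (forall n x, `|g n x| <= C) ->
  forall x, g n x @[n --> U] --> plim g x.
Proof. by move=> gC x; apply: (ulim_cvg ultraU leU (K := C)). Qed.

Lemma plim_norm (g : nat -> pt -> R) (C : R) : (forall n x, `|g n x| <= C) ->
  forall x, `|plim g x| <= C.
Proof.
move=> gC x; apply: (ulim_norm_le0 ultraU leU (@plim_cvg g C gC x)) => n.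
exact: gC.
Qed.

Lemma plim_holder (g : nat -> pt -> R) (C a K : R) : (forall n x, `|g n x| <= C) ->
  (forall n, holder a K (g n)) -> holder a K (plim g).
Proof.
move=> gC gH x y; have G := @plim_cvg g C gC.
apply: (ulim_norm_le0 ultraU leU (cvgB (G (x + y)) (G x))) => n.
exact: gH.
Qed.

Lemma plim_periodic (g : nat -> pt -> R) : (forall n, periodic (g n)) ->
  periodic (plim g).
Proof. by move=> gp x i; congr (ulim _ _); apply/funext => n; rewrite gp. Qed.

Lemma plim_taylor (g k : nat -> pt -> R) (C a : R) i : 0 < a ->
  (forall n x, `|g n x| <= C) -> (forall n x, `|k n x| <= C) ->
  (forall n, holder a C (g n)) -> (forall n, holder a C (k n)) ->
  (forall n x, fdiff (step R n i) (g n) x = mesh R n * k n x) ->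
  forall x t, 0 <= t ->
  `|plim g (x + t *: e_ R i) - plim g x - t * plim k x| <= C * t `^ (1 + a).
Proof.
move=> a0 gC kC gH kH gk x t t0.
have G := plim_cvg gC; have K := @plim_cvg k C kC.
apply: (ulim_norm_le ultraU leU (e := fun n => C * (mesh R n `^ a + mesh R n))
  (cvgB (cvgB (G (x + t *: e_ R i)) (G x)) (cvgM (cvg_cst t) (K x)))).
  by move=> n; apply: taylor_mesh.
rewrite [X in _ --> X](_ : _ = C * (0 + 0)); last by ring.
apply: cvgM; first exact: cvg_cst.
by apply: cvgD; [exact: mesh_powR_cvg0|exact: mesh_cvg0].
Qed.

End Limit.

Lemma schauder_existence (lam b b' : R) : 0 < lam -> 0 < b' -> b' < b -> b < 1 ->
  exists2 C : R, 0 <= C & forall H xi, hol b H xi ->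
    exists2 w, c2h b' (C * H) w & forall x, lam * w x - lap w x = xi x.
Proof.
move=> lam0 b'0 b'b b1.
have b0 : 0 < b by apply: lt_trans b'b.
(* The exponent is shared: increments of [xi] under translation by [y] are [s]-Hölder with a
   constant of order |y|^b', so mesh bounds at exponent [s] become Hölder bounds of exponent b'. *)
pose s := b - b'; have s0 : 0 < s by rewrite subr_gt0.
have sb : s < b by rewrite /s ltrBlDr ltrDl.
have s01 : 0 < s < 1 by rewrite s0 (lt_trans sb).
have b01 : 0 < b < 1 by rewrite b0.
have bs : b - s = b' by rewrite /s opprB addrC subrK.
pose D (a : R) := 8 / a + 16 / lam.
have D0 a : 0 < a -> 0 <= D a by move=> a0; rewrite addr_ge0// divr_ge0// ltW.
pose C := 2 / lam + D b + 2 * D s.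
have l0 : 0 <= 2 / lam by rewrite divr_ge0// ltW.
have DB := D0 b b0; have DS := D0 s s0.
exists C; first by rewrite /C; move: DB DS l0; lra.
move=> H xi xiH; have H0 := hol_ge0 xiH; case: xiH => xip xiK xiH.
have C1 : H / lam <= C * H.
  rewrite mulrC; apply: ler_wpM2r => //; rewrite /C; have : lam^-1 <= 2 / lam.
    by rewrite ler_peMl ?ler1n ?invr_ge0 ?(ltW lam0).
  by move: DB DS; lra.
have C2' : 2 * H / lam <= C * H.
  rewrite mulrAC; apply: ler_wpM2r => //; rewrite /C; move: DB DS; lra.
have C3 : D b * H <= C * H by apply: ler_wpM2r => //; rewrite /C; move: DB DS l0; lra.
have C4 : 2 * D s * H <= C * H by apply: ler_wpM2r => //; rewrite /C; move: DB DS l0; lra.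
have [U [uU leU]] := ultra_nat.
pose h n := mesh R n.
have h0 n : 0 < h n by rewrite invr_gt0 ltr0n.
pose v n := dres lam n xi.
pose p i n x := (h n)^-1 * fdiff (step R n i) (v n) x.
pose q i j n x := (h n)^-1 * fdiff (step R n j) (p i n) x.
have qE i j n x : q i j n x = h n ^- 2 * fdiff (step R n j) (fdiff (step R n i) (v n)) x.
  by rewrite /q /p /fdiff -mulrBr mulrA -expr2 exprVn.
have tB y : (forall z, `|xi (z + y) - xi z| <= 2 * H * `|y| `^ b').
  by move=> z; apply: (holder_lower b'0 (ltW b'b) xiK xiH).
have tH y : holder s (2 * H * `|y| `^ b') (fun z => xi (z + y) - xi z).
  by rewrite -bs; apply: holder_transB.
have t0 y : 0 <= 2 * H * `|y| `^ b' by rewrite !mulr_ge0 ?powR_ge0.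
have tp y := periodicB_trans y xip.
have vp n : periodic (v n) by apply: dres_periodic.
have vB n x : `|v n x| <= C * H by apply: le_trans C1; exact: dres_norm.
(* Here and in [pH], [qH], the increment of a quotient is the same quotient for the mesh problem
   whose datum is the increment of [xi]. *)
have vH n : holder b' (C * H) (v n).
  move=> x y; rewrite /v dresB//; apply: le_trans (dres_norm lam0 n (tB y) x) _.
  by rewrite mulrAC ler_wpM2r ?powR_ge0.
have pB i n x : `|p i n x| <= C * H.
  apply: le_trans C3; rewrite normrM gtr0_norm ?invr_gt0// mulrC ler_pdivrMr//.
  by rewrite [_ * h n]mulrC; exact: dres_diff.
have pH i n : holder b' (C * H) (p i n).
  move=> x y; rewrite /p -mulrBr normrM gtr0_norm ?invr_gt0// mulrC ler_pdivrMr//.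
  have -> : fdiff (step R n i) (v n) (x + y) - fdiff (step R n i) (v n) x =
      fdiff (step R n i) (dres lam n (fun z => xi (z + y) - xi z)) x.
    by rewrite /fdiff -!dresB// /v -!addrA (addrC y); ring.
  apply: le_trans (dres_diff lam0 n s01 (t0 y) (tp y) (tH y) i x) _.
  rewrite mulrC ler_wpM2r ?(ltW (h0 n))//.
  by rewrite mulrA ler_wpM2r ?powR_ge0// mulrA [D s * 2]mulrC.
have qB i j n x : `|q i j n x| <= C * H.
  apply: le_trans C3; rewrite qE normrM gtr0_norm ?invr_gt0 ?exprn_gt0//.
  rewrite mulrC ler_pdivrMr ?exprn_gt0// [_ * h n ^+ 2]mulrC.
  exact: dres_diff2.
have qH i j n : holder b' (C * H) (q i j n).
  move=> x y; rewrite !qE -mulrBr normrM gtr0_norm ?invr_gt0 ?exprn_gt0//.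
  rewrite mulrC ler_pdivrMr ?exprn_gt0//.
  have -> : fdiff (step R n j) (fdiff (step R n i) (v n)) (x + y) -
      fdiff (step R n j) (fdiff (step R n i) (v n)) x =
      fdiff (step R n j) (fdiff (step R n i) (dres lam n (fun z => xi (z + y) - xi z))) x.
    rewrite /fdiff -!dresB// /v -!addrA !(addrC y) !addrA; ring.
  apply: le_trans (dres_diff2 lam0 n s01 (t0 y) (tH y) i j x) _.
  rewrite mulrC ler_wpM2r ?exprn_ge0 ?(ltW (h0 n))//.
  by rewrite mulrA ler_wpM2r ?powR_ge0// mulrA [D s * 2]mulrC.
have [C2w P1 P2] := C2_taylor (g := plim U v) (w1 := fun i => plim U (p i))
  (w2 := fun i j => plim U (q i j)) b'0
  (fun i x t t0 => plim_taylor uU leU b'0 vB (pB i) vH (pH i)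
     (fun n x => esym (mulVKf (lt0r_neq0 (h0 n)) _)) x t0)
  (fun i j x t t0 => plim_taylor uU leU b'0 (pB i) (qB i j) (pH i) (qH i j)
     (fun n x => esym (mulVKf (lt0r_neq0 (h0 n)) _)) x t0)
  (fun i => plim_holder uU leU (pB i) (pH i))
  (fun i j => plim_holder uU leU (qB i j) (qH i j)).
exists (plim U v).
  split => //.
  - exact: plim_periodic.
  - exact: plim_norm.
  - by move=> i; rewrite P1; exact: plim_norm.
  - move=> i j; rewrite P2; split; first exact: plim_norm.
    by apply: plim_holder => //; exact: qB.
move=> x; apply/eqP; rewrite -subr_eq0 -normr_le0.
have lapE : lap (plim U v) x = \sum_(i < d) plim U (q i i) x.
  by apply: eq_bigr => i _; rewrite P2.
have V := @plim_cvg U uU leU v _ vB; have Q i j := @plim_cvg U uU leU (q i j) _ (qB i j).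
have QQ : (\sum_(i < d) q i i n x) @[n --> U] --> \sum_(i < d) plim U (q i i) x.
  by apply: cvg_big => [|i _]; [exact: add_continuous|exact: Q].
rewrite lapE.
(* The discrete equation holds up to a vanishing error: by [qH] a second quotient changes by at most
   C H h^b' over one step, and truncation adds (4 / lam) h H. *)
apply: (ulim_norm_le uU leU
  (a := fun n => lam * v n x - \sum_(i < d) q i i n x - xi x)
  (e := fun n => d%:R ^+ 2 * (C * H * h n `^ b') + 4 / lam * h n * H)
  (cvgB (cvgB (cvgM (cvg_cst lam) (V x)) QQ) (cvg_cst (xi x)))).
  move=> n; rewrite add0r /=.
  have -> : \sum_(i < d) q i i n x = \sum_(i < d) h n ^- 2 *
      fdiff (step R n i) (fdiff (step R n i) (v n)) x.
    by apply: eq_bigr => i _; rewrite qE.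
  apply: dres_eq => //; first by rewrite mulr_ge0 ?powR_ge0// (le_trans (normr_ge0 _) (vB 0%N 0)).
  move=> i j z; have := qH i i n z (- step R n j).
  rewrite !qE -mulrBr normrM gtr0_norm ?invr_gt0 ?exprn_gt0// normrN norm_step.
  by rewrite mulrC ler_pdivrMr ?exprn_gt0// [_ * h n ^+ 2]mulrC.
rewrite [X in _ --> X](_ : _ = d%:R ^+ 2 * (C * H * 0) + 4 / lam * 0 * H); last by ring.
apply: cvgD.
  by apply: cvgM; [exact: cvg_cst|apply: cvgM; [exact: cvg_cst|exact: mesh_powR_cvg0]].
apply: cvgM; [|exact: cvg_cst].
by apply: cvgM; [exact: cvg_cst|exact: mesh_cvg0].
Qed.

End SchauderExistence.

(** * Periodic calculus and the maximum principle *)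

Section TorusCalculus.
Variables (R : realType) (d : nat).
Notation pt := 'rV[R]_d.
Implicit Types (x y z v : pt) (g : pt -> R).

Lemma is_derive_line g x v t : derivable g (x + t *: v) v ->
  is_derive t 1 (fun s => g (x + s *: v)) ('D_v g (x + t *: v)).
Proof.
have E : (fun h : R => h^-1 *: (((fun s => g (x + s *: v)) \o shift t) (h *: 1)
      - g (x + t *: v))) =
    (fun h => h^-1 *: ((g \o shift (x + t *: v)) (h *: v) - g (x + t *: v))).
  apply/funext => h /=; congr (_ *: (g _ - _)).
  by rewrite [h%:A]mulr1 scalerDl addrCA.
by move=> dg; split; rewrite /derivable /derive E.
Qed.

Lemma MVT_line g x v : (forall y, differentiable g y) ->
  exists c, g (x + v) - g x = 'D_v g (x + c *: v).
Proof.
move=> dg.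
have D (t : R) : is_derive t 1 (fun s => g (x + s *: v)) ('D_v g (x + t *: v)).
  exact/is_derive_line/diff_derivable.
have C : {within `[0, 1], continuous (fun s => g (x + s *: v))}.
  apply: continuous_subspaceT => t.
  have [dt _] := D t.
  exact/differentiable_continuous/derivable1_diffP.
have [c _] := MVT ltr01 (fun t _ => D t) C.
by rewrite scale1r scale0r addr0 subr0 mulr1 => H; exists c.
Qed.

Lemma derive_partial g y v : differentiable g y ->
  'D_v g y = \sum_(i < d) v 0 i * partial i g y.
Proof.
move=> dg; rewrite deriveE// {1}(row_sum_delta v) linear_sum.
by apply: eq_bigr => i _; rewrite linearZ /partial deriveE.
Qed.

Lemma lipschitz_partial g (K : R) : (forall y, differentiable g y) ->
  (forall i y, `|partial i g y| <= K) ->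
  forall x y, `|g (x + y) - g x| <= d%:R * K * `|y|.
Proof.
move=> dg gK x y; have [c ->] := MVT_line x y dg.
rewrite derive_partial// (le_trans (ler_norm_sum _ _ _))//.
apply: (@le_trans _ _ (\sum_(i < d) `|y| * K)).
  by apply: ler_sum => i _; rewrite normrM ler_pM// normr_coord.
by rewrite sumr_const card_ord -[_ *+ d]mulr_natl -mulrA [K * _]mulrC.
Qed.

(** A positive second derivative would stay positive nearby. The first derivative vanishes at the
    maximum, so two applications of the mean value theorem along the axis would give a larger
    value. *)
Lemma partial2_max_le0 g x i : C2 g -> (forall y, g y <= g x) ->
  partial i (partial i g) x <= 0.
Proof.
move=> [dg [dp cp]] gx; rewrite leNgt; apply/negP => pos.
have D0 (t : R) : is_derive t 1 (fun s => g (x + s *: e_ R i))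
    (partial i g (x + t *: e_ R i)).
  exact/is_derive_line/diff_derivable.
have D1 (t : R) : is_derive t 1 (fun s => partial i g (x + s *: e_ R i))
    (partial i (partial i g) (x + t *: e_ R i)).
  exact/is_derive_line/diff_derivable.
have cont (F dF : R -> R) (a b : R) : (forall t : R, is_derive t 1 F (dF t)) ->
    {within `[a, b], continuous F}.
  move=> DF; apply: continuous_subspaceT => t; have [dt _] := DF t.
  exact/differentiable_continuous/derivable1_diffP.
have p0 : partial i g x = 0.
  have : is_derive (0 : R) 1 (fun s => g (x + s *: e_ R i)) 0.
    apply: (derive1_at_max (a := -1) (b := 1)) => [|t _||t _].
    - by lra.
    - by have [] := D0 t.
    - by rewrite in_itv /=; apply/andP; split; lra.
    - by rewrite scale0r addr0.
  by case=> _ <-; case: (D0 0) => _ ->; rewrite scale0r addr0.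
have [r r0 rpos] : exists2 r, 0 < r & forall t, 0 < t -> t < r ->
    0 < partial i (partial i g) (x + t *: e_ R i).
  have L : (x + t *: e_ R i) @[t --> (0 : R)] --> x.
    have : (x + t *: e_ R i) @[t --> (0 : R)] --> x + (0 : R) *: e_ R i.
      by apply: cvgD; [exact: cvg_cst|apply: cvgZr_tmp; exact: cvg_id].
    by rewrite scale0r addr0.
  have C := cvg_comp _ _ L (cp i i x).
  have /nbhs_norm0P[r /= r0 rB] : \forall t \near (0 : R),
      0 < partial i (partial i g) (x + t *: e_ R i) by exact: (cvgr_gt _ C).
  exists r => [|t t0 tr]; first exact: r0.
  by apply: (rB t) => /=; rewrite (gtr0_norm t0); exact: tr.
have r2 : 0 < r / 2 by rewrite divr_gt0.
have r2r : r / 2 < r by lra.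
have [c] := MVT r2 (fun t _ => D0 t) (cont _ _ _ _ D0).
rewrite in_itv /= => /andP[c0 cr] E.
have [c'] := MVT c0 (fun t _ => D1 t) (cont _ _ _ _ D1).
rewrite in_itv /= => /andP[c'0 c'c] E'.
have := rpos _ c'0 (lt_trans c'c (lt_trans cr r2r)) => P.
move: E'; rewrite scale0r addr0 p0 !subr0 => E'.
have : 0 < g (x + (r / 2) *: e_ R i) - g (x + 0 *: e_ R i).
  by rewrite E subr0 mulr_gt0// E' mulr_gt0.
by rewrite scale0r addr0 subr_gt0 ltNge gx.
Qed.

Lemma periodic_int g (z : int) i x : periodic g -> g (x + z%:~R *: e_ R i) = g x.
Proof.
move=> gp; have H (n : nat) y : g (y + n%:R *: e_ R i) = g y.
  elim: n y => [|n IH] y; first by rewrite scale0r addr0.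
  by rewrite -natr1 scalerDl scale1r addrA gp IH.
case: z => n; first exact: H.
by rewrite NegzE mulrNz scaleNr -[LHS](H n.+1) subrK.
Qed.

(** One [y] serves all periodic functions, so compactness of the unit cube can stand for compactness
    of the torus. *)
Lemma fold_cube x : exists y, (forall i, 0 <= y 0 i < 1) /\
  forall g, periodic g -> g x = g y.
Proof.
exists (\row_i (x 0 i - (Num.floor (x 0 i))%:~R)); split=> [i|g gp].
  rewrite mxE subr_ge0 ltrBlDr.
  have := Num.Theory.floor_itv (x 0 i); rewrite intrD => /andP[-> /=].
  by rewrite addrC.
pose f i := Num.floor (x 0 i).
have H (s : seq 'I_d) : g (x - \sum_(i <- s) (f i)%:~R *: e_ R i) = g x.
  elim: s => [|i s IH]; first by rewrite big_nil subr0.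
  rewrite big_cons opprD addrCA addrC -scaleNr -mulrNz periodic_int//.
rewrite -(H (enum 'I_d)); congr g; apply/rowP => j; rewrite !mxE; congr (_ - _).
rewrite summxE big_enum /= (bigD1 j)//= big1 ?addr0 => [|i ij].
  by rewrite /e_ !mxE !eqxx mulr1.
by rewrite /e_ !mxE eqxx eq_sym (negPf ij) mulr0.
Qed.

Lemma periodic_max g : periodic g -> continuous g -> exists c, forall x, g x <= g c.
Proof.
move=> gp gc.
pose A := [set v : pt | forall i, `[0, 1]%classic (v ord0 i)].
have cA : compact A.
  exact: (@rV_compact R d (fun=> `[0, 1]%classic) (fun=> @segment_compact R 0 1)).
have A0 : A !=set0.
  by exists 0 => i /=; rewrite in_itv /= mxE lexx ler01.
have W : {within A, continuous g} by exact: continuous_subspaceT.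
have [c _ cmax] := compact_EVT_max A0 cA W.
exists c => x; have [y [y01 ->//]] := fold_cube x.
apply: cmax; rewrite inE => i /=; rewrite in_itv /=.
by have /andP[-> /ltW] := y01 i.
Qed.

Lemma C2_continuous g : C2 g -> continuous g.
Proof. by move=> [dg _] x; exact: differentiable_continuous. Qed.

Lemma max_principle (lam : R) g : 0 < lam -> periodic g -> C2 g ->
  (forall x, lam * g x - lap g x <= 0) -> forall x, g x <= 0.
Proof.
move=> lam0 gp gC H x.
have [c cmax] := periodic_max gp (C2_continuous gC).
apply: le_trans (cmax x) _.
have L : lap g c <= 0 by apply: sumr_le0 => i _; exact: partial2_max_le0.
rewrite -(pmulr_rle0 _ lam0); have := H c; rewrite subr_le0 => /le_trans; exact.
Qed.

Lemma periodic_bounded g : periodic g -> continuous g ->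
  exists K, forall x, `|g x| <= K.
Proof.
move=> gp gc; have [c H] := periodic_max gp gc.
have gpN : periodic (fun x => - g x) by move=> x i; rewrite gp.
have gcN : continuous (fun x => - g x) by move=> x; apply: (@continuousN _ _ _ g); exact: gc.
have [c' H'] := periodic_max gpN gcN.
exists (Num.max (g c) (- g c')) => x; rewrite ler_norml le_max H orTb andbT.
by rewrite lerNl le_max H' orbT.
Qed.

Lemma periodic_partial g i : periodic g -> periodic (partial i g).
Proof.
move=> gp x j; rewrite /partial /derive.
suff -> : (fun h => h^-1 *: ((g \o shift (x + e_ R j)) (h *: e_ R i) - g (x + e_ R j)))
  = (fun h => h^-1 *: ((g \o shift x) (h *: e_ R i) - g x)) by [].
by apply/funext => h /=; rewrite gp addrA gp.
Qed.

End TorusCalculus.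

(** * Compact embedding between Hölder spaces *)

Section CompactEmbedding.
Variables (R : realType) (d : nat).
Notation pt := 'rV[R]_d.
Implicit Types (x y : pt).
Variables (U : set_system nat) (ultraU : UltraFilter U) (leU : \oo `<=` U).

Lemma plim_hol (g : nat -> pt -> R) (b K : R) : (forall n, hol b K (g n)) ->
  hol b K (plim U g).
Proof.
move=> gH; split.
- by apply: plim_periodic => n; case: (gH n).
- by apply: plim_norm => // n; case: (gH n).
- by apply: plim_holder => // n; case: (gH n).
Qed.

(** Arzelà-Ascoli for an ultrafilter: convergence is simultaneous on a finite grid since filters are
    stable under finite intersections, and the common Hölder bound covers the gaps. *)
Lemma plim_uniform (g : nat -> pt -> R) (b K : R) : 0 < b ->
  (forall n, hol b K (g n)) -> forall e : R, 0 < e ->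
  \forall n \near U, forall x, `|g n x - plim U g x| <= e.
Proof.
move=> b0 gH e e0.
have K0 : 0 <= K := hol_ge0 (gH 0%N).
have [m mP] : exists m, K * mesh R m `^ b <= e / 4.
  have C : (K * mesh R n `^ b) @[n --> \oo] --> 0.
    rewrite [X in _ --> X](_ : _ = K * 0); last by rewrite mulr0.
    by apply: cvgM; [exact: cvg_cst|exact: mesh_powR_cvg0].
  move/cvgrPdist_le : C => /(_ (e / 4)); rewrite divr_gt0// => /(_ isT)[m _ H].
  exists m; have := H m (leqnn m); rewrite /= sub0r normrN ger0_norm//.
  by rewrite mulr_ge0 ?powR_ge0.
pose P (k : {ffun 'I_d -> 'I_m.+1}) : pt := \row_i ((k i)%:R * mesh R m).
have gB n x : `|g n x| <= K by case: (gH n).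
have G := @plim_cvg R d U ultraU leU g K gB.
have F : \forall n \near U, forall k, `|g n (P k) - plim U g (P k)| <= e / 2.
  apply: filter_forall => k; have e2 : 0 < e / 2 by rewrite divr_gt0.
  by have /cvgrPdist_le/(_ _ e2) := G (P k); apply: filterS => n; rewrite distrC.
apply: filterS F => n Hn x.
have [y [y01 E]] := fold_cube x.
have [gp _ gh] := gH n; have [Gp _ Gh] := plim_hol gH.
rewrite (E _ gp) (E _ Gp).
have h0 : 0 < mesh R m by rewrite invr_gt0 ltr0n.
have m0 : 0 < m.+1%:R :> R by rewrite ltr0n.
have ty i : y 0 i * m.+1%:R - 1 < (Num.truncn (y 0 i * m.+1%:R))%:R <= y 0 i * m.+1%:R.
  have /andP[yi0 yi1] := y01 i.
  have /andP[-> H] := Num.Theory.truncn_itv (mulr_ge0 yi0 (ltW m0)).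
  by rewrite andbT ltrBlDr natr1.
have tm i : (Num.truncn (y 0 i * m.+1%:R)%R < m.+1)%N.
  have /andP[yi0 yi1] := y01 i; have /andP[_ H] := ty i.
  by rewrite -(ltr_nat R) (le_lt_trans H)// gtr_pMl.
pose k := [ffun i => Ordinal (tm i)].
have yP : `|y - P k| <= mesh R m.
  apply: normr_row_le => [|i]; first exact: ltW.
  rewrite !mxE ffunE /=; have /andP[H1 H2] := ty i.
  rewrite ler_norml -(ler_pM2r m0) -[X in _ && X](ler_pM2r m0) mulNr mulrBl.
  by rewrite -mulrA /mesh mulVf ?gt_eqF// mulr1; apply/andP; split; lra.
have close (f : pt -> R) : holder b K f -> `|f y - f (P k)| <= e / 4.
  move=> fh; have := fh (P k) (y - P k).
  rewrite [P k + _]addrC subrK => /le_trans; apply.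
  by apply: le_trans mP; rewrite ler_wpM2l// powR_le// ltW.
have -> : g n y - plim U g y = (g n y - g n (P k)) +
    (g n (P k) - plim U g (P k)) - (plim U g y - plim U g (P k)) by ring.
have -> : e = e / 4 + e / 2 + e / 4 by field.
apply: (le_trans (ler_normB _ _)); apply: lerD; last exact: close.
by apply: (le_trans (ler_normD _ _)); apply: lerD; [exact: close|exact: Hn].
Qed.

(* Interpolation between uniform convergence and the uniform bound with the
   larger exponent. *)
Lemma plim_hol_cvg (g : nat -> pt -> R) (b s K : R) : 0 < s -> s < b ->
  (forall n, hol b K (g n)) -> forall e : R, 0 < e ->
  \forall n \near U, hol s e (fun x => g n x - plim U g x).
Proof.
move=> s0 sb gH e e0; have b0 := lt_trans s0 sb.
have K0 : 0 <= K := hol_ge0 (gH 0%N).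
(* Increments shorter than [r] are handled by the exponent [b], longer ones by the uniform distance
   [dl]; [r] is small enough for the short ones to give at most [e]. *)
pose r := (e / (2 * K + 1)) `^ (b - s)^-1.
have K1 : 0 < 2 * K + 1 by rewrite ltr_wpDl// mulr_ge0.
have r0 : 0 < r by apply: powR_gt0; rewrite divr_gt0.
have bs : 0 < b - s by rewrite subr_gt0.
have rE : r `^ (b - s) = e / (2 * K + 1).
  by rewrite /r -powRrM mulVf ?gt_eqF// powRr1// divr_ge0// ltW.
pose dl := Num.min e (e / 2 * r `^ s).
have dl0 : 0 < dl by rewrite lt_min e0 mulr_gt0//; [rewrite divr_gt0|apply: powR_gt0].
have := plim_uniform b0 gH dl0; apply: filterS => n Hn.
have [gp _ gh] := gH n; have [Gp _ Gh] := plim_hol gH.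
split.
- by move=> x i; rewrite gp Gp.
- by move=> x; apply: le_trans (Hn x) _; rewrite ge_min lexx.
move=> x y.
have [yr|ry] := leP `|y| r.
  have -> : g n (x + y) - plim U g (x + y) - (g n x - plim U g x) =
    (g n (x + y) - g n x) - (plim U g (x + y) - plim U g x) by ring.
  apply: le_trans (ler_normB _ _) _; apply: le_trans (lerD (gh x y) (Gh x y)) _.
  have -> : `|y| `^ b = `|y| `^ (b - s) * `|y| `^ s.
    by rewrite -powRD subrK// gt_eqF.
  have : `|y| `^ (b - s) <= e / (2 * K + 1) by rewrite -rE powR_le// ltW.
  set t := `|y| `^ (b - s) => t1.
  have -> : K * (t * `|y| `^ s) + K * (t * `|y| `^ s) = (2 * K * t) * `|y| `^ s by ring.
  apply: ler_wpM2r; first exact: powR_ge0.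
  have t0 : 0 <= t := powR_ge0 _ _.
  have : t * (2 * K + 1) <= e by rewrite -ler_pdivlMr.
  by rewrite mulrDr mulr1 mulrC => /(le_trans _); apply; rewrite lerDl.
apply: le_trans (ler_normB _ _) _; apply: le_trans (lerD (Hn _) (Hn _)) _.
apply: (@le_trans _ _ (e * r `^ s)).
  have : dl <= e / 2 * r `^ s by rewrite ge_min lexx orbT.
  by move=> H; apply: le_trans (lerD H H) _; rewrite -mulrDl -splitr.
by rewrite ler_wpM2l ?(ltW e0)// powR_le// ltW.
Qed.

End CompactEmbedding.

(* The normed space is the subspace P, on which alone K is linear. *)
Section Riesz.
Variables (R : realType) (V : lmodType R) (P : V -> Prop) (N : V -> R) (K : V -> V).
Hypotheses (P0 : P 0) (PD : forall x y, P x -> P y -> P (x + y))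
  (PZ : forall a x, P x -> P (a *: x)).
Hypotheses (N0 : forall x, P x -> 0 <= N x)
  (ND : forall x y, P x -> P y -> N (x + y) <= N x + N y)
  (NZ : forall a x, P x -> N (a *: x) = `|a| * N x)
  (Ndef : forall x, P x -> (forall e, 0 < e -> N x <= e) -> x = 0).
Hypotheses (PK : forall x, P x -> P (K x))
  (KD : forall x y, P x -> P y -> K (x + y) = K x + K y)
  (KZ : forall a x, P x -> K (a *: x) = a *: K x).
Hypothesis Kcpt : forall x : nat -> V, (forall n, P (x n) /\ N (x n) <= 1) ->
  exists2 k, P k & forall e, 0 < e -> forall m, exists2 n, (m <= n)%N &
    N (K (x n) - k) <= e.
Variable (B : R).
Hypothesis KB : forall x, P x -> N (K x) <= B * N x.
Hypothesis Kinj : forall x, P x -> x + K x = 0 -> x = 0.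

Let S x := x + K x.

Let PN x : P x -> P (- x). Proof. by rewrite -scaleN1r; exact: PZ. Qed.
Let PB x y : P x -> P y -> P (x - y).
Proof. by move=> ? ?; apply: PD => //; exact: PN. Qed.
Let NN x : P x -> N (- x) = N x.
Proof. by move=> ?; rewrite -scaleN1r NZ// normrN1 mul1r. Qed.
Let NB x y : P x -> P y -> N (x - y) <= N x + N y.
Proof. by move=> Px Py; rewrite -(NN Py) ND//; exact: PN. Qed.
Let NBC x y : P x -> P y -> N (x - y) = N (y - x).
Proof. by move=> Px Py; rewrite -NN ?opprB//; exact: PB. Qed.
Let PS x : P x -> P (S x). Proof. by move=> Px; apply: PD => //; exact: PK. Qed.
Let SD x y : P x -> P y -> S (x + y) = S x + S y.
Proof. by move=> Px Py; rewrite /S KD// addrACA. Qed.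
Let SZ a x : P x -> S (a *: x) = a *: S x.
Proof. by move=> Px; rewrite /S KZ// scalerDr. Qed.
Let SB x y : P x -> P y -> S (x - y) = S x - S y.
Proof.
move=> Px Py; have E : S (- y) = - S y by rewrite -(scaleN1r y) SZ// scaleN1r.
by rewrite SD ?E//; exact: PN.
Qed.
Let NS x : P x -> N (S x) <= (1 + `|B|) * N x.
Proof.
move=> Px; apply: le_trans (ND Px (PK Px)) _; rewrite mulrDl mul1r lerD2l.
by apply: le_trans (KB Px) _; rewrite ler_wpM2r ?N0// ler_norm.
Qed.

(** Compactness acts here: if S x_n tends to [y], then x_n = S x_n - K x_n comes close to y - k
    infinitely often, and boundedness of [S] identifies the image of y - k. [Kcpt] provides the
    limit inside [P], in place of completeness. *)
Let cluster (x : nat -> V) y : P y -> (forall n, P (x n) /\ N (x n) <= 1) ->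
  (forall e, 0 < e -> exists m, forall n, (m <= n)%N -> N (S (x n) - y) <= e) ->
  exists2 z, P z /\ S z = y & forall e, 0 < e -> exists n, N (x n - z) <= e.
Proof.
move=> Py xP xS; have [k Pk kx] := Kcpt xP.
have Px n : P (x n) by case: (xP n).
have PSy n : P (S (x n) - y) by apply: PB => //; apply: PS.
have close e : 0 < e -> exists n, N (x n - (y - k)) <= e /\ N (S (x n) - y) <= e.
  move=> e0; have e2 : 0 < e / 2 by rewrite divr_gt0.
  have [m Hm] := xS _ e2; have [n mn Hn] := kx _ e2 m; exists n.
  have H := Hm _ mn; split; last by apply: (le_trans H); lra.
  have -> : x n - (y - k) = (S (x n) - y) - (K (x n) - k).
    rewrite /S; move: (x n) (K (x n)) => a b.
    rewrite !opprB -[a + b - y]addrA -addrA; congr (a + _).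
    by rewrite [b - y]addrC -addrA [b + _]addrC subrK addrC.
  have PKk : P (K (x n) - k) by apply: PB => //; apply: PK.
  by apply: le_trans (NB (PSy n) PKk) _; rewrite [leRHS]splitr lerD.
have Pyk : P (y - k) by apply: PB.
exists (y - k); last by move=> e /close[n [H _]]; exists n.
split=> //; apply/eqP; rewrite -subr_eq0; apply/eqP; apply: Ndef => [|e e0].
  by apply: PB => //; exact: PS.
have b0 : 0 < 1 + `|B| + 1 by rewrite ltr_pwDr// addr_ge0.
have [n [H1 H2]] := close _ (divr_gt0 e0 b0).
have PxS : P (x n - (y - k)) by apply: PB.
have -> : S (y - k) - y = (S (x n) - y) - S (x n - (y - k)).
  by rewrite [in RHS]SB// opprB [in RHS]addrC addrA subrK.
apply: le_trans (NB (PSy n) (PS PxS)) _.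
apply: (@le_trans _ _ (e / (1 + `|B| + 1) + (1 + `|B|) * (e / (1 + `|B| + 1)))).
  rewrite lerD//; apply: le_trans (NS PxS) _; rewrite ler_wpM2l// addr_ge0//.
by rewrite le_eqVlt; apply/orP; left; apply/eqP; field; rewrite gt_eqF.
Qed.

(** Otherwise unit vectors exist with S x_n tending to 0; by [cluster] some of them are close to a
    kernel vector, which is 0 by injectivity. *)
Lemma riesz_bounded_below : exists2 c, 0 < c & forall x, P x -> c * N x <= N (x + K x).
Proof.
apply: contrapT => nc.
have ex n : exists x, (P x /\ N x = 1) /\ N (S x) <= n.+1%:R^-1.
  apply: contrapT => nex; apply: nc; exists n.+1%:R^-1; first by rewrite invr_gt0.
  move=> x Px; rewrite leNgt; apply/negP => H.
  have Nx0 : 0 < N x.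
    rewrite lt_neqAle N0// andbT; apply/negP => /eqP Nx.
    by move: H; rewrite -Nx mulr0 ltNge N0//; exact: PS.
  apply: nex; exists ((N x)^-1 *: x); split.
    split; first exact: PZ.
    by rewrite NZ// gtr0_norm ?invr_gt0// mulVf// gt_eqF.
  rewrite SZ// NZ//; last exact: PS.
  by rewrite gtr0_norm ?invr_gt0// mulrC ler_pdivrMr// ltW.
pose x n := projT1 (cid (ex n)).
have xP n : (P (x n) /\ N (x n) = 1) /\ N (S (x n)) <= n.+1%:R^-1.
  by rewrite /x; case: cid.
have xP1 n : P (x n) /\ N (x n) <= 1 by have [[? ->] _] := xP n.
have [|z [Pz Sz] zx] := cluster P0 xP1.
  move=> e e0; have := @cvg_harmonic R; move=> /cvgrPdist_le/(_ _ e0)[m _ Hm].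
  exists m => n mn; rewrite subr0; apply: le_trans (xP n).2 _.
  by have := Hm n mn; rewrite /= sub0r normrN ger0_norm// invr_ge0.
have z0 := Kinj Pz Sz.
have h2 : 0 < 2^-1 :> R by rewrite invr_gt0.
have [n] := zx _ h2; rewrite z0 subr0; have [[_ ->] _] := xP n.
by lra.
Qed.

Let iterP n x : P x -> P (iter n S x).
Proof. by move=> Px; elim: n => //= n IH; exact: PS. Qed.
Let itD n x y : P x -> P y -> iter n S (x + y) = iter n S x + iter n S y.
Proof. by move=> Px Py; elim: n => //= n ->; rewrite SD//; exact: iterP. Qed.
Let itZ n a x : P x -> iter n S (a *: x) = a *: iter n S x.
Proof. by move=> Px; elim: n => //= n ->; rewrite SZ//; exact: iterP. Qed.
Let itB n x y : P x -> P y -> iter n S (x - y) = iter n S x - iter n S y.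
Proof.
move=> Px Py; have E : iter n S (- y) = - iter n S y.
  by rewrite -(scaleN1r y) itZ// scaleN1r.
by rewrite itD ?E//; exact: PN.
Qed.

(** If [y] is missed, S^n y keeps a positive distance from the range of S^(n+1), so the ranges
    decrease strictly. Almost orthogonal vectors of norm at most 1 in successive ranges then have
    images under [K] at mutual distance at least 1/2, against compactness. *)
Lemma riesz_surjective y : P y -> exists2 x, P x & x + K x = y.
Proof.
move=> Py; apply: contrapT => ny.
have [c c0 Hc] := riesz_bounded_below.
(* The range of [S] is closed: approximate preimages of [y] are bounded by the lower bound on [S],
   and after scaling by 1/M they cluster at a preimage. *)
have [d0 d00 Hd] : exists2 d0, 0 < d0 & forall z, P z -> d0 <= N (y - S z).
  apply: contrapT => nd.
  have ex n : exists z, P z /\ N (y - S z) <= n.+1%:R^-1.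
    apply: contrapT => nex; apply: nd; exists n.+1%:R^-1; first by rewrite invr_gt0.
    by move=> z Pz; rewrite leNgt; apply/negP => /ltW H; apply: nex; exists z.
  pose z n := projT1 (cid (ex n)).
  have zP n : P (z n) /\ N (y - S (z n)) <= n.+1%:R^-1 by rewrite /z; case: cid.
  pose M := (N y + 1) / c.
  have M0 : 0 < M by rewrite divr_gt0// ltr_wpDl ?N0.
  have zM n : N (z n) <= M.
    rewrite ler_pdivlMr// mulrC; have [Pz H] := zP n.
    apply: le_trans (Hc _ Pz) _; rewrite -/(S _).
    have -> : S (z n) = y - (y - S (z n)) by rewrite opprB addrC subrK.
    have PyS : P (y - S (z n)) by apply: PB => //; exact: PS.
    apply: le_trans (NB Py PyS) _; rewrite lerD2l; apply: (le_trans H).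
    by rewrite invf_le1// ler1n.
  have [|||w [Pw Sw] _] := @cluster (fun n => M^-1 *: z n) (M^-1 *: y).
  - exact: PZ.
  - move=> n; have [Pz _] := zP n; split; first exact: PZ.
    rewrite NZ// gtr0_norm ?invr_gt0// mulrC ler_pdivrMr// mul1r; exact: zM.
  - move=> e e0; have := @cvg_harmonic R.
    move=> /cvgrPdist_le/(_ _ (mulr_gt0 e0 M0))[m _ Hm].
    exists m => n mn; have [Pz Hz] := zP n; rewrite SZ// -scalerBr NZ; last first.
      by apply: PB => //; exact: PS.
    rewrite gtr0_norm ?invr_gt0// mulrC ler_pdivrMr// NBC//; last exact: PS.
    apply: (le_trans Hz).
    by have := Hm n mn; rewrite /= sub0r normrN ger0_norm// invr_ge0.
  apply: ny; exists (M *: w); first exact: PZ.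
  by rewrite -/(S _) SZ// Sw scalerA divff ?gt_eqF// scale1r.
pose Q n z := N (iter n S y - iter n.+1 S z).
have Qlow n z : P z -> c ^+ n * d0 <= Q n z.
  move=> Pz; have E : Q n z = N (iter n S (y - S z)).
    by rewrite /Q itB// ?iterSr//; exact: PS.
  rewrite E; have PyS : P (y - S z) by apply: PB => //; exact: PS.
  apply: (@le_trans _ _ (c ^+ n * N (y - S z))).
    by rewrite ler_wpM2l ?exprn_ge0 ?(ltW c0)// Hd.
  elim: n {E} => [|n IH]; first by rewrite expr0 mul1r.
  rewrite exprS -mulrA; apply: le_trans (Hc _ (iterP n PyS)).
  by rewrite ler_wpM2l// ltW.
have cd0 n : 0 < c ^+ n * d0 by rewrite mulr_gt0 ?exprn_gt0.
(* The distance need not be attained, but as it is positive some point is within a factor two of it;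
   this is the origin of the 1/2 in [far]. *)
have near_inf n : exists z, P z /\ forall w, P w -> Q n z <= 2 * Q n w.
  pose I := inf [set Q n z | z in P].
  have hI : has_inf [set Q n z | z in P].
    split; first by exists (Q n 0), 0.
    by exists (c ^+ n * d0) => _ [z Pz <-]; exact: Qlow.
  have I0 : 0 < I.
    apply: (lt_le_trans (cd0 n)); apply: lb_le_inf; first by case: hI.
    by move=> _ [z Pz <-]; exact: Qlow.
  have [_ [z Pz <-] zI] := inf_adherent I0 hI.
  exists z; split=> // w Pw; apply: (le_trans (ltW zI)); rewrite -/I.
  have : I <= Q n w by apply: ge_inf; [case: hI|exists w].
  by lra.
pose z n := projT1 (cid (near_inf n)).
have zP n : P (z n) /\ forall w, P w -> Q n (z n) <= 2 * Q n w.
  by rewrite /z; case: cid.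
have Q0 n : 0 < Q n (z n).
  by apply: (lt_le_trans (cd0 n)); apply: Qlow; case: (zP n).
pose v n := (Q n (z n))^-1 *: (y - S (z n)).
pose x n := iter n S (v n).
have Pv n : P (v n).
  by apply: PZ; apply: PB => //; apply: PS; case: (zP n).
have Px n : P (x n) by exact: iterP.
have xP n : P (x n) /\ N (x n) <= 1.
  split=> //; have [Pz _] := zP n.
  have PyS : P (y - S (z n)) by apply: PB => //; exact: PS.
  rewrite /x /v itZ// NZ; last exact: iterP.
  rewrite gtr0_norm ?invr_gt0// itB//; last exact: PS.
  by rewrite -iterSr mulVf// gt_eqF.
have far n w : P w -> 2^-1 <= N (x n - iter n.+1 S w).
  move=> Pw; have [Pz Hz] := zP n.
  have PyS : P (y - S (z n)) by apply: PB => //; exact: PS.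
  pose w' := z n + Q n (z n) *: w.
  have Pw' : P w' by apply: PD => //; exact: PZ.
  have -> : x n - iter n.+1 S w =
      (Q n (z n))^-1 *: (iter n S y - iter n.+1 S w').
    have -> : iter n.+1 S w' = iter n.+1 S (z n) + Q n (z n) *: iter n.+1 S w.
      by rewrite /w' itD ?itZ//; exact: PZ.
    rewrite /x /v itZ// itB//; last exact: PS.
    rewrite -iterSr; move: (iter n.+1 S (z n)) (iter n.+1 S w) (iter n S y).
    move=> a b e; rewrite opprD addrA [in RHS]scalerDr scalerN scalerA.
    by rewrite mulVf ?gt_eqF// scale1r.
  rewrite NZ; last by apply: PB; exact: iterP.
  rewrite gtr0_norm ?invr_gt0// mulrC ler_pdivlMr// mulrC ler_pdivrMr// mulrC.
  exact: Hz.
have [k Pk Hk] := Kcpt xP.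
(* Two images within 1/5 of the same cluster point are within 2/5 < 1/2 of each other. The vector
   [w] below is built so that x_n - S^(n+1) w equals K x_m - K x_n. *)
have q0 : 0 < 5^-1 :> R by rewrite invr_gt0.
have [n _ Hn] := Hk _ q0 0%N.
have [m nm Hm] := Hk _ q0 n.+1.
pose w := v n - iter (m - n) S (v m) + iter (m - n.+1) S (v m).
have Pw : P w by apply: PD; [apply: PB|]; rewrite //; exact: iterP.
have E : x n - iter n.+1 S w = - (K (x n) - K (x m)).
  have Ev : iter n.+1 S (v n) = S (x n) by [].
  have E1 : iter n.+1 S (iter (m - n) S (v m)) = S (x m).
    by rewrite -ssrnat.iterD addSn subnKC// ltnW.
  have E2 : iter n.+1 S (iter (m - n.+1) S (v m)) = x m.
    by rewrite -ssrnat.iterD subnKC.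
  rewrite /w itD ?itB//; try (apply: PB => //); try exact: iterP.
  rewrite Ev E1 E2 /S; move: (x n) (K (x n)) (x m) (K (x m)) => a b a' b'.
  have -> : a + b - (a' + b') + a' = a + b - b'.
    by rewrite opprD addrA addrAC subrK.
  by rewrite -addrA opprD addrA subrr add0r.
have := far n w Pw; rewrite E NN; last by apply: PB; exact: PK.
have -> : K (x n) - K (x m) = (K (x n) - k) - (K (x m) - k).
  by rewrite opprB addrA subrK.
have PKn j : P (K (x j) - k) by apply: PB => //; exact: PK.
move=> H; have := le_trans H (NB (PKn n) (PKn m)).
by move: Hn Hm; lra.
Qed.

End Riesz.

(** * Calculus of Hölder and C^2 gauges *)

Section Gauges.
Variables (R : realType) (d : nat).
Notation pt := 'rV[R]_d.
Implicit Types (x y : pt) (g k : pt -> R) (b K L : R).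

Lemma hol_mono b K L g : K <= L -> hol b K g -> hol b L g.
Proof.
move=> KL [gp gK gh]; split=> // [x|x y]; first exact: le_trans (gK x) KL.
by apply: le_trans (gh x y) _; rewrite ler_wpM2r ?powR_ge0.
Qed.

Lemma hol_lin b K L a g k : hol b K g -> hol b L k ->
  hol b (`|a| * K + L) (fun x => a * g x + k x).
Proof.
move=> [gp gK gh] [kp kK kh]; split=> [x i|x|x y]; first by rewrite gp kp.
  by rewrite (le_trans (ler_normD _ _))// lerD// normrM ler_wpM2l.
have -> : a * g (x + y) + k (x + y) - (a * g x + k x) =
  a * (g (x + y) - g x) + (k (x + y) - k x) by ring.
by rewrite (le_trans (ler_normD _ _))// mulrDl lerD// normrM -mulrA ler_wpM2l.
Qed.

Lemma hol0 b : hol b 0 (fun _ : pt => 0 : R).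
Proof. by split=> // [x|x y]; rewrite ?subrr normr0 ?mul0r. Qed.

Lemma hol_add b K L g k : hol b K g -> hol b L k -> hol b (K + L) (fun x => g x + k x).
Proof.
move=> gH kH; have := hol_lin 1 gH kH; rewrite normr1 mul1r.
by have -> : (fun x => 1 * g x + k x) = (fun x => g x + k x)
  by apply/funext => x; rewrite mul1r.
Qed.

Lemma hol_opp b K g : hol b K g -> hol b K (fun x => - g x).
Proof.
move=> gH; have := hol_lin (-1) gH (hol0 b); rewrite normrN1 mul1r addr0.
by have -> : (fun x => -1 * g x + 0) = (fun x => - g x)
  by apply/funext => x; rewrite mulN1r addr0.
Qed.

Lemma hol_sub b K L g k : hol b K g -> hol b L k -> hol b (K + L) (fun x => g x - k x).
Proof. by move=> gH /hol_opp; exact: hol_add. Qed.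

Lemma hol_scale b K a g : hol b K g -> hol b (`|a| * K) (fun x => a * g x).
Proof.
move=> gH; have := hol_lin a gH (hol0 b); rewrite addr0.
by have -> : (fun x => a * g x + 0) = (fun x => a * g x)
  by apply/funext => x; rewrite addr0.
Qed.

Lemma hol_mul b K L g k : hol b K g -> hol b L k ->
  hol b (2 * K * L) (fun x => g x * k x).
Proof.
move=> gH kH; have K0 := hol_ge0 gH; have L0 := hol_ge0 kH.
case: gH kH => [gp gK gh] [kp kK kh]; split=> [x i|x|x y]; first by rewrite gp kp.
  rewrite normrM; apply: (@le_trans _ _ (K * L)); first exact: ler_pM.
  by rewrite -mulrA ler_peMl ?mulr_ge0// ler1n.
have -> : g (x + y) * k (x + y) - g x * k x =
  (g (x + y) - g x) * k (x + y) + g x * (k (x + y) - k x) by ring.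
have -> : 2 * K * L * `|y| `^ b = K * `|y| `^ b * L + K * (L * `|y| `^ b) by ring.
by rewrite (le_trans (ler_normD _ _))// lerD// normrM ler_pM// ?gh ?kh.
Qed.

Lemma hol_sum b K (g : 'I_d -> pt -> R) : (forall i, hol b K (g i)) ->
  hol b (d%:R * K) (fun x => \sum_(i < d) g i x).
Proof.
move=> gH; split=> [x i|x|x y].
- by apply: eq_bigr => j _; case: (gH j) => ->.
- rewrite (le_trans (ler_norm_sum _ _ _))// mulr_natl -[X in K *+ X]card_ord.
  by rewrite -sumr_const; apply: ler_sum => i _; case: (gH i).
rewrite -sumrB (le_trans (ler_norm_sum _ _ _))//.
rewrite -mulrA mulr_natl -[X in _ *+ X]card_ord -sumr_const.
by apply: ler_sum => i _; case: (gH i).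
Qed.

(** An increment t is at most 2K and at most L |y|; in t = t^(1-b) t^b each factor uses one of the
    bounds. For b < 1 the result is small with [K], even if [L] is not. *)
Lemma hol_interp b K L g : 0 < b <= 1 -> periodic g -> (forall x, `|g x| <= K) ->
  (forall x y, `|g (x + y) - g x| <= L * `|y|) ->
  hol b (K + (2 * K) `^ (1 - b) * L `^ b) g.
Proof.
move=> /andP[b0 b1] gp gK gL; have K0 : 0 <= K by apply: le_trans (gK 0).
have q0 : 0 <= (2 * K) `^ (1 - b) * L `^ b by rewrite mulr_ge0 ?powR_ge0.
split=> // [x|x y]; first by rewrite (le_trans (gK x))// lerDl.
have [->|y0] := eqVneq y 0.
  by rewrite addr0 subrr normr0 mulr_ge0 ?powR_ge0// addr_ge0.
have L0 : 0 <= L.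
  rewrite -(pmulr_lge0 _ (_ : 0 < `|y|)) ?normr_gt0//.
  by apply: le_trans (gL x y).
set t := `|_|; have t0 : 0 <= t by exact: normr_ge0.
have t1 : t <= 2 * K.
  by rewrite /t mulr_natl mulr2n (le_trans (ler_normB _ _))// lerD.
have t2 : t <= L * `|y| := gL x y.
apply: (@le_trans _ _ ((2 * K) `^ (1 - b) * (L * `|y|) `^ b)).
  have -> : t = t `^ (1 - b) * t `^ b.
    have [->|tn0] := eqVneq t 0; first by rewrite (powR0 (_ : b != 0)) ?mulr0// gt_eqF.
    by rewrite -powRD ?subrK ?powRr1// tn0 implybT.
  by rewrite ler_pM ?powR_ge0// powR_le ?subr_ge0// ltW.
by rewrite [(L * _) `^ _]powRM// mulrA ler_wpM2r ?powR_ge0// lerDr.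
Qed.

Lemma hol_lip b K g : 0 < b <= 1 -> periodic g -> (forall x, `|g x| <= K) ->
  (forall x y, `|g (x + y) - g x| <= K * `|y|) -> hol b (3 * K) g.
Proof.
move=> b01 gp gK gL; have K0 : 0 <= K by apply: le_trans (gK 0).
apply: hol_mono (hol_interp b01 gp gK gL).
have -> : 3 * K = K + 2 * K by ring.
case/andP: b01 => b0 b1; rewrite lerD2l.
apply: (@le_trans _ _ ((2 * K) `^ (1 - b) * (2 * K) `^ b)).
  rewrite ler_wpM2l ?powR_ge0// powR_le ?(ltW b0)//.
  by rewrite mulr_natl mulr2n lerDl.
have [->|Kn0] := eqVneq K 0; first by rewrite mulr0 (powR0 (_ : b != 0)) ?mulr0// gt_eqF.
by rewrite -powRD ?subrK ?powRr1 ?mulr_ge0// mulf_eq0 pnatr_eq0 (negPf Kn0) implybT.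
Qed.

(** The C^2 gauge without Hölder control of second derivatives, which is all that the lower order
    terms need from the unknown. *)
Definition c2 K g :=
  [/\ periodic g, C2 g, forall x, `|g x| <= K,
      forall i x, `|partial i g x| <= K &
      forall i j x, `|partial j (partial i g) x| <= K].

Lemma c2h_c2 b K g : c2h b K g -> c2 K g.
Proof. by move=> [gp gC g0 g1 g2]; split=> // i j; case: (g2 i j). Qed.

Lemma c2_mono K L g : K <= L -> c2 K g -> c2 L g.
Proof.
move=> KL [gp gC g0 g1 g2]; split=> // *.
- exact: le_trans (g0 _) KL.
- exact: le_trans (g1 _ _) KL.
- exact: le_trans (g2 _ _ _) KL.
Qed.

Lemma c2h_mono b K L g : K <= L -> c2h b K g -> c2h b L g.
Proof.
move=> KL gH; have [gp gC g0 g1 _] := c2_mono KL (c2h_c2 gH).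
split=> // i j; have [_ _ _ _ /(_ i j)[H1 H2]] := gH; split=> [x|x y].
  exact: le_trans (H1 x) KL.
by apply: le_trans (H2 x y) _; rewrite ler_wpM2r ?powR_ge0.
Qed.

Lemma c2_ge0 K g : c2 K g -> 0 <= K.
Proof. by move=> [_ _ g0 _ _]; apply: le_trans (g0 0). Qed.

(** Stability speaks of classical solutions, which carry no quantitative bound; compactness of the
    torus supplies one. *)
Lemma C2_c2 g : periodic g -> C2 g -> exists K, c2 K g.
Proof.
move=> gp gC; have [dg [dp cp]] := gC.
have [K0 H0] := periodic_bounded gp (C2_continuous gC).
have ex1 i : exists K, forall x, `|partial i g x| <= K.
  apply: periodic_bounded; first exact: periodic_partial.
  by move=> x; apply: differentiable_continuous.
have ex2 i j : exists K, forall x, `|partial j (partial i g) x| <= K.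
  by apply: periodic_bounded; [do 2! apply: periodic_partial; exact: gp|exact: cp].
pose K1 i := projT1 (cid (ex1 i)); pose K2 i j := projT1 (cid (ex2 i j)).
have H1 i x : `|partial i g x| <= K1 i by rewrite /K1; case: cid.
have H2 i j x : `|partial j (partial i g) x| <= K2 i j by rewrite /K2; case: cid.
have K00 : 0 <= K0 by apply: le_trans (H0 0).
have K10 i : 0 <= K1 i by apply: le_trans (H1 i 0).
have K20 i j : 0 <= K2 i j by apply: le_trans (H2 i j 0).
have S1 : 0 <= \sum_(i < d) K1 i by apply: sumr_ge0.
have S2 : 0 <= \sum_(i < d) \sum_(j < d) K2 i j.
  by do 2! (apply: sumr_ge0 => ? _).
have L1 i : K1 i <= \sum_(i < d) K1 i by rewrite (bigD1 i)//= lerDl sumr_ge0.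
have L2 i j : K2 i j <= \sum_(i < d) \sum_(j < d) K2 i j.
  apply: (@le_trans _ _ (\sum_(j < d) K2 i j)).
    by rewrite (bigD1 j)//= lerDl sumr_ge0.
  by rewrite [leRHS](bigD1 i)//= lerDl sumr_ge0// => k _; rewrite sumr_ge0.
exists (K0 + \sum_(i < d) K1 i + \sum_(i < d) \sum_(j < d) K2 i j).
move: S1 S2 L1 L2; set T1 := \sum_(i < d) K1 i; set T2 := \sum_(i < d) _.
move=> S1 S2 L1 L2; split; [exact: gp|exact: gC|move=> x|move=> i x|move=> i j x].
- by apply: le_trans (H0 x) _; lra.
- by apply: le_trans (H1 i x) _; apply: le_trans (L1 i) _; lra.
- by apply: le_trans (H2 i j x) _; apply: le_trans (L2 i j) _; lra.
Qed.

Lemma partial_lin i a g k : (forall x, differentiable g x) ->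
  (forall x, differentiable k x) ->
  partial i (fun x => a * g x + k x) = (fun x => a * partial i g x + partial i k x).
Proof.
move=> dg dk; apply/funext => x; rewrite /partial.
rewrite (_ : (fun x => a * g x + k x) = a *: g + k)//.
rewrite deriveD ?deriveZ//; first exact: diff_derivable.
- exact/diff_derivable/differentiableZ.
- exact: diff_derivable.
Qed.

Lemma differentiable_lin a g k x : differentiable g x -> differentiable k x ->
  differentiable (fun x => a * g x + k x) x.
Proof.
move=> dg dk; rewrite (_ : (fun x => a * g x + k x) = a *: g + k)//.
by apply: differentiableD => //; exact: differentiableZ.
Qed.

Lemma partial2_lin i j a g k : C2 g -> C2 k ->
  partial j (partial i (fun x => a * g x + k x)) =
  (fun x => a * partial j (partial i g) x + partial j (partial i k) x).
Proof. by move=> [dg [dpg _]] [dk [dpk _]]; rewrite partial_lin// partial_lin. Qed.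

Lemma C2_lin a g k : C2 g -> C2 k -> C2 (fun x => a * g x + k x).
Proof.
move=> gC kC; have [dg [dpg cpg]] := gC; have [dk [dpk cpk]] := kC.
split; first by move=> x; exact: differentiable_lin.
split=> [i x|i j]; first by rewrite partial_lin//; exact: differentiable_lin.
rewrite partial2_lin// => x.
apply: (@continuousD _ _ _ (fun x => a * partial j (partial i g) x)).
  by apply: continuousM; [exact: cst_continuous|exact: cpg].
exact: cpk.
Qed.

Lemma lap_lin a g k x : C2 g -> C2 k ->
  lap (fun x => a * g x + k x) x = a * lap g x + lap k x.
Proof.
move=> gC kC; rewrite /lap mulr_sumr -big_split; apply: eq_bigr => i _ /=.
by rewrite partial2_lin.
Qed.

Lemma c2_lin K L a g k : c2 K g -> c2 L k -> c2 (`|a| * K + L) (fun x => a * g x + k x).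
Proof.
move=> [gp gC g0 g1 g2] [kp kC k0 k1 k2].
have [dg _] := gC; have [dk _] := kC.
have H (s t : R) : `|s| <= K -> `|t| <= L -> `|a * s + t| <= `|a| * K + L.
  by move=> sK tL; rewrite (le_trans (ler_normD _ _))// lerD// normrM ler_wpM2l.
split=> [x i||x|i x|i j x].
- by rewrite gp kp.
- exact: C2_lin.
- exact: H.
- by rewrite partial_lin//; exact: H.
- by rewrite partial2_lin//; exact: H.
Qed.

Lemma c2_hol b K g : 0 < b <= 1 -> c2 K g ->
  hol b (3 * ((1 + d%:R) * K)) g /\ forall i, hol b (3 * ((1 + d%:R) * K)) (partial i g).
Proof.
move=> b01 gH; have K0 := c2_ge0 gH; case: gH => [gp [dg [dp _]] g0 g1 g2].
have K1 : K <= (1 + d%:R) * K by rewrite mulrDl mul1r lerDl mulr_ge0.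
have K2 : d%:R * K <= (1 + d%:R) * K by rewrite mulrDl mul1r lerDr.
split=> [|i].
  apply: hol_lip => // [x|x y]; first exact: le_trans (g0 x) K1.
  by apply: le_trans (lipschitz_partial dg g1 x y) _; rewrite ler_wpM2r.
apply: hol_lip => // [|x|x y].
- exact: periodic_partial.
- exact: le_trans (g1 i x) K1.
- by apply: le_trans (lipschitz_partial (dp i) (g2 i) x y) _; rewrite ler_wpM2r.
Qed.

Lemma c2h_partial2_hol b K g i j : c2h b K g -> hol b K (partial j (partial i g)).
Proof.
move=> [gp _ _ _ /(_ i j)[H1 H2]]; split; [|exact: H1|exact: H2].
by do 2! apply: periodic_partial.
Qed.

End Gauges.

(** * Uniqueness and regularity for the resolvent *)

Section SchauderRegularity.
Variables (R : realType) (d : nat) (lam : R) (lam0 : 0 < lam).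
Notation pt := 'rV[R]_d.
Implicit Types (x y : pt) (g k : pt -> R).

Lemma resolvent_unique g k : periodic g -> periodic k -> C2 g -> C2 k ->
  (forall x, lam * g x - lap g x = lam * k x - lap k x) -> g = k.
Proof.
have le g' k' : periodic g' -> periodic k' -> C2 g' -> C2 k' ->
    (forall x, lam * g' x - lap g' x = lam * k' x - lap k' x) -> forall x, g' x <= k' x.
  move=> gp kp gC kC H x; rewrite -subr_le0 addrC -[- k' x]mulN1r.
  apply: (@max_principle R d lam (fun x => -1 * k' x + g' x) lam0) => [z i||z].
  - by rewrite gp kp.
  - exact: C2_lin.
  rewrite lap_lin//; move: (H z); move: (lap g' z) (lap k' z) => p q Hz.
  have -> : lam * (-1 * k' z + g' z) - (-1 * q + p) =
    (lam * g' z - p) - (lam * k' z - q) by ring.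
  by rewrite Hz subrr.
move=> gp kp gC kC H; apply/funext => x; apply/eqP; rewrite eq_le.
rewrite (le _ _ gp kp gC kC H x); exact: (le _ _ kp gp kC gC (fun y => esym (H y)) x).
Qed.

(** By uniqueness a C^2 solution is the one obtained from the mesh, so the bounds of the
    construction become an a priori estimate. *)
Lemma schauder_regularity (b b' : R) : 0 < b' -> b' < b -> b < 1 ->
  exists2 C : R, 0 <= C & forall H g, periodic g -> C2 g ->
    hol b H (fun x => lam * g x - lap g x) -> c2h b' (C * H) g.
Proof.
move=> b0 bb b1; have [C C0 HC] := @schauder_existence R d _ _ _ lam0 b0 bb b1.
exists C => // H g gp gC gH; have [w wH wE] := HC _ _ gH.
have [wp wC _ _ _] := wH.
have -> : g = w by exact: (resolvent_unique gp wp gC wC (fun x => esym (wE x))).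
exact: wH.
Qed.

End SchauderRegularity.

(** * Product rules and Hölder bounds for the transport terms *)

Section DivergenceForm.
Variables (R : realType) (d : nat).
Notation pt := 'rV[R]_d.
Implicit Types (x : pt) (g k v rho : pt -> R).

Lemma subfE g k : g \- k = (fun x => -1 * k x + g x).
Proof. by apply/funext => x /=; rewrite mulN1r addrC. Qed.

Lemma C2_sub g k : C2 g -> C2 k -> C2 (g \- k).
Proof. by move=> gC kC; rewrite subfE; exact: C2_lin. Qed.

Lemma lap_sub g k x : C2 g -> C2 k -> lap (g \- k) x = lap g x - lap k x.
Proof. by move=> gC kC; rewrite subfE lap_lin// mulN1r addrC. Qed.

Lemma gdotC g k x : gdot g k x = gdot k g x.
Proof. by apply: eq_bigr => i _; rewrite mulrC. Qed.

Lemma gdot_linr v (a : R) g k x : C2 g -> C2 k ->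
  gdot v (fun x => a * g x + k x) x = a * gdot v g x + gdot v k x.
Proof.
move=> [dg _] [dk _]; rewrite /gdot mulr_sumr -big_split; apply: eq_bigr => i _ /=.
by rewrite partial_lin//; move: (partial i v x) (partial i g x) (partial i k x) => p q r; ring.
Qed.

Lemma gdot_linl v (a : R) g k x : C2 g -> C2 k ->
  gdot (fun x => a * g x + k x) v x = a * gdot g v x + gdot k v x.
Proof. by move=> gC kC; rewrite gdotC gdot_linr// ![gdot v _ x]gdotC. Qed.

Lemma gdot_subr v g k x : C2 g -> C2 k -> gdot v (g \- k) x = gdot v g x - gdot v k x.
Proof. by move=> gC kC; rewrite subfE gdot_linr// mulN1r addrC. Qed.

Lemma gdot_subl v g k x : C2 g -> C2 k -> gdot (g \- k) v x = gdot g v x - gdot k v x.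
Proof. by move=> gC kC; rewrite gdotC gdot_subr// ![gdot v _ x]gdotC. Qed.

Lemma div_mul_gradE rho v x : C2 rho -> C2 v ->
  div_mul_grad rho v x = gdot rho v x + rho x * lap v x.
Proof.
move=> [dr _] [_ [dv _]]; rewrite /div_mul_grad /gdot /lap mulr_sumr -big_split.
apply: eq_bigr => i _ /=; rewrite {1}/partial deriveM; last 2 first.
- exact: diff_derivable.
- exact/diff_derivable/dv.
rewrite /GRing.scale /= -!/(partial i _ x) addrC.
by congr (_ + _); rewrite mulrC.
Qed.

(** Bounds the embeddings of C^2 into C^{0,b} and C^{1,b} at the level of gauges, uniformly in b. *)
Definition embed_const : R := 3 * (1 + d%:R).
Local Notation cd := embed_const.

Lemma embed_const_ge0 : 0 <= cd. Proof. by rewrite mulr_ge0// addr_ge0. Qed.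

Lemma c2_hol_fun (b K : R) g : 0 < b <= 1 -> c2 K g -> hol b (cd * K) g.
Proof. by move=> b01 /(c2_hol b01)[+ _]; rewrite mulrA; exact. Qed.

Lemma c2_hol_partial (b K : R) g i : 0 < b <= 1 -> c2 K g -> hol b (cd * K) (partial i g).
Proof. by move=> b01 /(c2_hol b01)[_ +]; rewrite mulrA; exact. Qed.

Lemma gdot_hol (b K L : R) g k : 0 < b <= 1 -> c2 K g -> c2 L k ->
  hol b (d%:R * (2 * cd * cd) * (K * L)) (gdot g k).
Proof.
move=> b01 gK kL.
have -> : d%:R * (2 * cd * cd) * (K * L) = d%:R * (2 * (cd * K) * (cd * L)) by ring.
by apply: hol_sum => i; apply: hol_mul; exact: c2_hol_partial.
Qed.

Lemma lap_hol (b K : R) g : c2h b K g -> hol b (d%:R * K) (lap g).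
Proof. by move=> gK; apply: hol_sum => i; exact: c2h_partial2_hol. Qed.

(** Only rho times [lap v] contains second derivatives, hence the asymmetry: [v] is controlled at
    the Hölder exponent, [rho] by its C^2 gauge. *)
Lemma div_hol (b K L : R) rho v : 0 < b <= 1 -> c2 K rho -> c2h b L v ->
  hol b (d%:R * (2 * cd * cd + 2 * cd) * (K * L)) (div_mul_grad rho v).
Proof.
move=> b01 rK vL; have [_ rC _ _ _] := rK; have [_ vC _ _ _] := vL.
have -> : div_mul_grad rho v = (fun x => gdot rho v x + rho x * lap v x).
  by apply/funext => x; exact: div_mul_gradE.
have -> : d%:R * (2 * cd * cd + 2 * cd) * (K * L) =
  d%:R * (2 * cd * cd) * (K * L) + 2 * (cd * K) * (d%:R * L) by ring.
apply: hol_add; first exact: gdot_hol b01 rK (c2h_c2 vL).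
by apply: hol_mul; [exact: c2_hol_fun|exact: lap_hol].
Qed.

End DivergenceForm.

Local Opaque partial lap.

(** * Fredholm alternative for perturbations of the resolvent *)

Section Fredholm.
Variables (R : realType) (d : nat) (lam : R) (lam0 : 0 < lam).
Notation pt := 'rV[R]_d.
Notation fp := ((pt -> R) * (pt -> R))%type.
Implicit Types (x y : pt) (z w : fp).

Definition holp (b K : R) z := hol b K z.1 /\ hol b K z.2.
Definition C2p w := [/\ periodic w.1, periodic w.2, C2 w.1 & C2 w.2].
Definition c2p (K : R) w := c2 K w.1 /\ c2 K w.2.
Definition respair w : fp :=
  (fun x => lam * w.1 x - lap w.1 x, fun x => lam * w.2 x - lap w.2 x).

Lemma C2p_lin (a : R) w w' : C2p w -> C2p w' -> C2p (a *: w + w').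
Proof.
move=> [p1 p2 q1 q2] [p1' p2' q1' q2']; split=> /=.
- by move=> x i /=; congr (_ *: _ + _); [exact: p1|exact: p1'].
- by move=> x i /=; congr (_ *: _ + _); [exact: p2|exact: p2'].
- exact: C2_lin.
- exact: C2_lin.
Qed.

Lemma C2p_c2p w : C2p w -> exists K, c2p K w.
Proof.
move=> [p1 p2 q1 q2]; have [K1 H1] := C2_c2 p1 q1; have [K2 H2] := C2_c2 p2 q2.
exists (Num.max K1 K2); split; [apply: c2_mono H1|apply: c2_mono H2];
  by rewrite le_max lexx ?orbT.
Qed.

Lemma respair_lin (a : R) w w' : C2p w -> C2p w' ->
  respair (a *: w + w') = a *: respair w + respair w'.
Proof.
have H (g k : pt -> R) x : C2 g -> C2 k ->
    lam * (a * g x + k x) - lap (fun y => a * g y + k y) x =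
    a * (lam * g x - lap g x) + (lam * k x - lap k x).
  by move=> gC kC; rewrite lap_lin//; move: (lap g x) (lap k x) => p q; ring.
move=> [_ _ q1 q2] [_ _ q1' q2']; congr (_, _); apply/funext => x.
  exact: H q1 q1'.
exact: H q2 q2'.
Qed.

Lemma respair_inj w w' : C2p w -> C2p w' -> respair w = respair w' -> w = w'.
Proof.
move=> [p1 p2 q1 q2] [p1' p2' q1' q2'] E.
rewrite [w]surjective_pairing [w']surjective_pairing; congr (_, _).
  exact: (resolvent_unique lam0 p1 p1' q1 q1' (fun x => congr1 (fun h : fp => h.1 x) E)).
exact: (resolvent_unique lam0 p2 p2' q2 q2' (fun x => congr1 (fun h : fp => h.2 x) E)).
Qed.

Variables (beta gamma : R).
Hypotheses (gamma0 : 0 < gamma) (gammabeta : gamma < beta) (beta1 : beta < 1).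

Definition holpP z := exists K, holp gamma K z.
(** Riesz's argument needs a norm, so the optimal gauge constant is taken; the value is meaningful
    on [holpP]. *)
Definition holpN z := inf [set K | holp gamma K z].

Lemma holpN_le K z : holp gamma K z -> holpN z <= K.
Proof.
move=> zK; apply: ge_inf => //; exists 0 => L [zL _]; exact: hol_ge0 zL.
Qed.

(** Each inequality in the gauge is closed in the constant, so the infimum is admissible. *)
Lemma holpN_attained z : holpP z -> holp gamma (holpN z) z.
Proof.
move=> [K zK]; have hI : has_inf [set K | holp gamma K z].
  by split; [exists K|exists 0 => L [zL _]; exact: hol_ge0 zL].
have close (a b : R) : 0 <= b -> (forall L, holp gamma L z -> a <= L * b) ->
    a <= holpN z * b.
  rewrite le_eqVlt => /predU1P[<-|b0] H.
    by have := H _ zK; rewrite !mulr0.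
  rewrite -ler_pdivrMr//; apply: lb_le_inf; first by case: hI.
  by move=> L /= /H; rewrite ler_pdivrMr.
have [[p1 _ _] [p2 _ _]] := zK.
split; split=> [|x|x y].
- exact: p1.
- by rewrite -[holpN z]mulr1; apply: close => // L [[_ H _] _]; rewrite mulr1.
- by apply: close => [|L [[_ _ H] _]]; rewrite ?powR_ge0.
- exact: p2.
- by rewrite -[holpN z]mulr1; apply: close => // L [_ [_ H _]]; rewrite mulr1.
- by apply: close => [|L [_ [_ _ H]]]; rewrite ?powR_ge0.
Qed.

Lemma holp_lin (a K L : R) z w : holp gamma K z -> holp gamma L w ->
  holp gamma (`|a| * K + L) (a *: z + w).
Proof. by move=> [z1 z2] [w1 w2]; split; exact: hol_lin. Qed.

Lemma holp_scale (a K : R) z : holp gamma K z -> holp gamma (`|a| * K) (a *: z).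
Proof. by move=> [z1 z2]; split; exact: hol_scale. Qed.

Lemma holp_add (K L : R) z w : holp gamma K z -> holp gamma L w ->
  holp gamma (K + L) (z + w).
Proof. by move=> [z1 z2] [w1 w2]; split; exact: hol_add. Qed.

Lemma holp0 : holp gamma 0 0.
Proof. by split; exact: hol0. Qed.

Lemma holpN_ge0 z : holpP z -> 0 <= holpN z.
Proof. by move=> /holpN_attained[/hol_ge0]. Qed.

Lemma holpNZ a z : holpP z -> holpN (a *: z) = `|a| * holpN z.
Proof.
move=> Pz; have H b w : holpP w -> holpN (b *: w) <= `|b| * holpN w.
  by move=> /holpN_attained Hw; apply: holpN_le; exact: holp_scale.
apply/eqP; rewrite eq_le H//=; have [->|a0] := eqVneq a 0.
  rewrite normr0 mul0r scale0r holpN_ge0//; exists 0; exact: holp0.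
have Paz : holpP (a *: z).
  by case: Pz => K Kz; exists (`|a| * K); exact: holp_scale.
have := H a^-1 _ Paz; rewrite scalerA mulVf// scale1r normfV.
by rewrite mulrC ler_pdivlMr ?normr_gt0// mulrC.
Qed.

Lemma holpN_def z : holpP z -> (forall e, 0 < e -> holpN z <= e) -> z = 0.
Proof.
move=> Pz H; have N0 : holpN z = 0.
  apply/eqP; rewrite eq_le holpN_ge0// andbT; apply/ler_addgt0Pr => e e0.
  by rewrite add0r H.
have [[_ H1 _] [_ H2 _]] := holpN_attained Pz; rewrite N0 in H1 H2.
rewrite [z]surjective_pairing; congr (_, _); apply/funext => x.
  by apply/normr0_eq0/eqP; rewrite eq_le H1 normr_ge0.
by apply/normr0_eq0/eqP; rewrite eq_le H2 normr_ge0.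
Qed.

(* The operator lam - Laplacian + B with lower order part B. *)
Variable B : fp -> fp.
Hypothesis Blin : forall (a : R) w w', C2p w -> C2p w' ->
  B (a *: w + w') = a *: B w + B w'.
Variable CB : R.
Hypothesis Bbd : forall K w, c2p K w -> holp beta (CB * K) (B w).
Hypothesis Bker : forall w, C2p w -> respair w + B w = 0 -> w = 0.

(** With z = [respair w] and T the resolvent, the equation reads z + B (T z) = data in C^{0,gamma}.
    The map z |-> B (T z) takes values in C^{0,beta}, whose embedding into C^{0,gamma} is
    compact. *)
Lemma fredholm : (forall z, holpP z -> exists2 w, C2p w & respair w + B w = z) /\
  exists2 C, 0 <= C & forall K w, C2p w -> holp gamma K (respair w + B w) ->
    c2p (C * K) w.
Proof.
have gamma1 : gamma < 1 := lt_trans gammabeta beta1.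
(* Only C^2 bounds of the resolvent are used below, so any positive exponent less than [gamma]
   serves. *)
have g20 : 0 < gamma / 2 by rewrite divr_gt0.
have g2g : gamma / 2 < gamma by lra.
have [C0 C00 HC0] := @schauder_existence R d _ _ _ lam0 g20 g2g gamma1.
(* The resolvent is made total by choice; off [holpP] its value is arbitrary. *)
have exT z : exists w, holpP z -> [/\ C2p w, respair w = z &
    forall K, holp gamma K z -> c2p (C0 * K) w].
  have [[K [z1 z2]]|] := pselect (holpP z); last by move=> nz; exists 0.
  have [w1 w1H w1E] := HC0 _ _ z1; have [w2 w2H w2E] := HC0 _ _ z2.
  exists (w1, w2) => _; have [p1 q1 _ _ _] := w1H; have [p2 q2 _ _ _] := w2H.
  split.
  - by split; [exact: p1|exact: p2|exact: q1|exact: q2].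
  - rewrite [RHS]surjective_pairing; congr (_, _); apply/funext => x; [exact: w1E|exact: w2E].
  move=> L [z1L z2L]; split.
    have [w w_H wE] := HC0 _ _ z1L; have [p q _ _ _] := w_H.
    have -> : w1 = w.
      by apply: (resolvent_unique lam0 p1 p q1 q) => x; rewrite w1E wE.
    exact: c2h_c2 w_H.
  have [w w_H wE] := HC0 _ _ z2L; have [p q _ _ _] := w_H.
  have -> : w2 = w.
    by apply: (resolvent_unique lam0 p2 p q2 q) => x; rewrite w2E wE.
  exact: c2h_c2 w_H.
pose T z := projT1 (cid (exT z)).
have TP z : holpP z -> [/\ C2p (T z), respair (T z) = z &
    forall K, holp gamma K z -> c2p (C0 * K) (T z)].
  by rewrite /T; case: cid.
have P_lin (a : R) z w : holpP z -> holpP w -> holpP (a *: z + w).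
  by move=> [K Kz] [L Lw]; exists (`|a| * K + L); exact: holp_lin.
have P_0 : holpP 0 by exists 0; exact: holp0.
have P_Z (a : R) z : holpP z -> holpP (a *: z).
  by move=> Pz; rewrite -[_ *: _]addr0; exact: P_lin.
have P_D z w : holpP z -> holpP w -> holpP (z + w).
  by move=> Pz Pw; rewrite -[z]scale1r; exact: P_lin.
have T_lin (a : R) z w : holpP z -> holpP w -> T (a *: z + w) = a *: T z + T w.
  move=> Pz Pw; have [c e _] := TP _ Pz; have [c' e' _] := TP _ Pw.
  have [c'' e'' _] := TP _ (P_lin a _ _ Pz Pw).
  apply: (respair_inj c'' (C2p_lin a c c')).
  by rewrite (respair_lin a c c') e e' e''.
have T_0 : T 0 = 0.
  have := T_lin (-1) 0 0 P_0 P_0; rewrite scaler0 addr0 scaleN1r addNr. exact.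
pose K z := B (T z).
have K_lin (a : R) z w : holpP z -> holpP w -> K (a *: z + w) = a *: K z + K w.
  move=> Pz Pw; have [c _ _] := TP _ Pz; have [c' _ _] := TP _ Pw.
  by rewrite /K (T_lin a _ _ Pz Pw) (Blin a c c').
have K_0 : K 0 = 0.
  have := K_lin (-1) 0 0 P_0 P_0; rewrite scaler0 addr0 scaleN1r addNr. exact.
have Kbeta L z : holp gamma L z -> holp beta (CB * (C0 * L)) (K z).
  move=> zL; have [_ _ H] := TP z (ex_intro _ L zL); exact/Bbd/H.
have Kgamma L z : holp gamma L z -> holp gamma (2 * (CB * (C0 * L))) (K z).
  move=> /Kbeta[H1 H2]; split; exact: hol_lower (ltW gammabeta) _.
have P_K z : holpP z -> holpP (K z).
  by move=> [L zL]; exists (2 * (CB * (C0 * L))); exact: Kgamma.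
have N_K z : holpP z -> holpN (K z) <= (2 * CB * C0) * holpN z.
  move=> Pz; rewrite -!mulrA; apply: holpN_le; apply: Kgamma.
  exact: holpN_attained.
have K_D z w : holpP z -> holpP w -> K (z + w) = K z + K w.
  by move=> Pz Pw; have := K_lin 1 _ _ Pz Pw; rewrite !scale1r.
have K_Z (a : R) z : holpP z -> K (a *: z) = a *: K z.
  by move=> Pz; have := K_lin a _ _ Pz P_0; rewrite !addr0 K_0 addr0.
have N_D z w : holpP z -> holpP w -> holpN (z + w) <= holpN z + holpN w.
  move=> Pz Pw; apply: holpN_le; apply: holp_add; exact: holpN_attained.
have K_inj z : holpP z -> z + K z = 0 -> z = 0.
  move=> Pz E; have [c e _] := TP _ Pz.
  have T0 : T z = 0 by apply: (Bker c); rewrite e.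
  by rewrite -e T0; have [_ + _] := TP _ P_0; rewrite T_0.
have K_cpt (z : nat -> fp) : (forall n, holpP (z n) /\ holpN (z n) <= 1) ->
    exists2 k, holpP k & forall e, 0 < e -> forall m, exists2 n, (m <= n)%N &
      holpN (K (z n) - k) <= e.
  move=> zP; have z1 n : holp gamma 1 (z n).
    have [Pz N1] := zP n; have [H1 H2] := holpN_attained Pz.
    by split; [exact: hol_mono H1|exact: hol_mono H2].
  have Kz n := Kbeta 1 _ (z1 n).
  have Kz1 n : hol beta (CB * (C0 * 1)) (K (z n)).1 by case: (Kz n).
  have Kz2 n : hol beta (CB * (C0 * 1)) (K (z n)).2 by case: (Kz n).
  have [U [uU leU]] := ultra_nat.
  pose k : fp := (plim U (fun n => (K (z n)).1), plim U (fun n => (K (z n)).2)).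
  exists k.
    exists (2 * (CB * (C0 * 1))); split; apply: (hol_lower gamma0 (ltW gammabeta)).
      exact: (plim_hol uU leU Kz1).
    exact: (plim_hol uU leU Kz2).
  move=> e e0 m.
  have F1 := plim_hol_cvg uU leU gamma0 gammabeta Kz1 e0.
  have F2 := plim_hol_cvg uU leU gamma0 gammabeta Kz2 e0.
  have F3 : \forall n \near U, (m <= n)%N by apply: leU; exists m.
  have [n [mn [H1 H2]]] := filter_ex (filterI F3 (filterI F1 F2)).
  by exists n => //; apply: holpN_le.
split.
  move=> z Pz.
  have [z' Pz' E] := riesz_surjective P_0 P_D P_Z holpN_ge0 N_D holpNZ holpN_def
    P_K K_D K_Z K_cpt N_K K_inj Pz.
  by have [c e _] := TP _ Pz'; exists (T z') => //; rewrite e.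
have [c c0 Hc] := riesz_bounded_below P_0 P_D P_Z holpN_ge0 N_D holpNZ holpN_def
    P_K K_D K_Z K_cpt N_K K_inj.
exists (C0 / c); first by rewrite divr_ge0// ltW.
move=> L w wC wL; have [K' wK'] := C2p_c2p wC.
(* A priori [respair w] is merely continuous, but it is the datum minus [B w], both Hölder, so the
   lower bound of Riesz's theorem applies to it. *)
have Pw : holpP (respair w).
  have -> : respair w = (-1) *: B w + (respair w + B w).
    by rewrite scaleN1r addrCA addNr addr0.
  apply: P_lin; last by exists L.
  have [H1 H2] := Bbd wK'; exists (2 * (CB * K')).
  by split; exact: hol_lower (ltW gammabeta) _.
have [cT eT HT] := TP _ Pw.
have Tw : T (respair w) = w := respair_inj cT wC eT.
have := Hc _ Pw; rewrite /K Tw => H.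
have NL : holpN (respair w) <= L / c.
  by rewrite (ler_pdivlMr _ _ c0) mulrC; exact: le_trans H (holpN_le wL).
have [h1 h2] := HT _ (holpN_attained Pw); rewrite Tw in h1 h2.
have le : C0 * holpN (respair w) <= C0 / c * L.
  by rewrite mulrAC -mulrA ler_wpM2l.
by split; [exact: c2_mono h1|exact: c2_mono h2].
Qed.

End Fredholm.

(** * The Taylor remainder of the coupling *)

Section TaylorRemainder.
Variables (R : realType) (f : R -> R).
Hypotheses (df : forall x, derivable f x 1) (ddf : forall x, derivable (derive1 f) x 1)
  (cf2 : continuous (derive1 (derive1 f))).
Local Notation f1 := (derive1 f).
Local Notation f2 := (derive1 (derive1 f)).

Let is_derive1 (g : R -> R) (x : R) : (forall x, derivable g x 1) -> is_derive x 1 g (derive1 g x).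
Proof. by move=> dg; split; rewrite ?derive1E. Qed.

Lemma MVT_between (g : R -> R) (a b B : R) : (forall x, derivable g x 1) ->
  `|a| <= B -> `|b| <= B -> exists c, [/\ `|c| <= B, `|a - c| <= `|a - b| &
    g a - g b = derive1 g c * (a - b)].
Proof.
move=> dg aB bB.
have D (x : R) : is_derive x 1 g (derive1 g x) by exact: is_derive1.
have C (s t : R) : {within `[s, t], continuous g}.
  apply: continuous_subspaceT => x.
  exact/differentiable_continuous/derivable1_diffP.
move: aB bB; rewrite !ler_norml => /andP[a1 a2] /andP[b1 b2].
have [ab|ba|ab] := ltgtP a b.
- have [c] := MVT ab (fun x _ => D x) (C _ _); rewrite in_itv /= => /andP[ac cb] E.
  exists c; split.
  + by rewrite ler_norml; apply/andP; split; lra.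
  + by rewrite ler_norml ltr0_norm ?subr_lt0//; apply/andP; split; lra.
  + by rewrite -opprB E; ring.
- have [c] := MVT ba (fun x _ => D x) (C _ _); rewrite in_itv /= => /andP[bc ca] E.
  exists c; split.
  + by rewrite ler_norml; apply/andP; split; lra.
  + by rewrite ler_norml gtr0_norm ?subr_gt0//; apply/andP; split; lra.
  + exact: E.
- exists a; rewrite -ab !subrr mulr0 normr0; split => //.
  by rewrite ler_norml a1.
Qed.

Lemma derive2_bounded (B : R) : 0 <= B -> exists2 L, 0 <= L &
  forall x, `|x| <= B -> `|f2 x| <= L.
Proof.
move=> B0; have cN : {within `[- B, B], continuous (fun x => `|f2 x|)}.
  apply: continuous_subspaceT => x.
  by apply: (@continuous_comp _ _ _ f2 Num.norm); [exact: cf2|exact: norm_continuous].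
have BB : - B <= B by lra.
have [c _ cmax] := EVT_max BB cN; exists `|f2 c|; first exact: normr_ge0.
by move=> x; rewrite ler_norml => xB; apply: cmax; rewrite in_itv.
Qed.

(** Uniform continuity on a bounded interval: two sequences of violating points would share an
    ultralimit, against continuity there. *)
Lemma derive2_modulus (B e : R) : 0 < e -> exists2 dl : R, 0 < dl &
  forall x y, `|x| <= B -> `|y| <= B -> `|x - y| <= dl -> `|f2 x - f2 y| <= e.
Proof.
move=> e0; apply: contrapT => nd.
have ex n : exists p : R * R, [/\ `|p.1| <= B, `|p.2| <= B, `|p.1 - p.2| <= n.+1%:R^-1 &
    e < `|f2 p.1 - f2 p.2|].
  apply: contrapT => nex; apply: nd; exists n.+1%:R^-1; first by rewrite invr_gt0.
  move=> x y xB yB xy; rewrite leNgt; apply/negP => H.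
  by apply: nex; exists (x, y).
pose p n := projT1 (cid (ex n)).
have pP n : [/\ `|(p n).1| <= B, `|(p n).2| <= B, `|(p n).1 - (p n).2| <= n.+1%:R^-1 &
    e < `|f2 (p n).1 - f2 (p n).2|] by rewrite /p; case: cid.
have [U [uU leU]] := ultra_nat.
have b1 n : `|(p n).1| <= B by case: (pP n).
have c1 := ulim_cvg uU leU b1; set l := ulim U _ in c1.
have c2 : (p n).2 @[n --> U] --> l.
  have H : ((p n).2 - (p n).1) @[n --> U] --> 0.
    apply/cvgrPdist_le => r r0.
    have := @cvg_harmonic R; move=> /cvgrPdist_le/(_ _ r0)/leU; apply: filterS => n.
    rewrite sub0r normrN ger0_norm ?invr_ge0// sub0r normrN distrC.
    by case: (pP n) => _ _ H _; exact: le_trans.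
  have -> : (fun n => (p n).2) = (fun n => ((p n).2 - (p n).1) + (p n).1).
    by apply/funext => n; rewrite subrK.
  by rewrite -[l]add0r; exact: cvgD H c1.
have C1 := cvg_comp _ _ c1 (@cf2 l); have C2 := cvg_comp _ _ c2 (@cf2 l).
have C3 : (f2 (p n).1 - f2 (p n).2) @[n --> U] --> 0.
  by rewrite -(subrr (f2 l)); exact: cvgB C1 C2.
move/cvgrPdist_le : C3 => /(_ _ e0) F.
have [n] := filter_ex F; rewrite sub0r normrN leNgt; case: (pP n) => _ _ _ H.
by rewrite H.
Qed.

(** The expansion point is the iterate [a] and not the solution [b], because a Newton step uses the
    derivative at the iterate. *)
Definition rem1 (a b : R) := f a - f b - f1 a * (a - b).

Variables (B L dl om : R).
Hypotheses (fL : forall x, `|x| <= B -> `|f2 x| <= L)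
  (fom : forall x y, `|x| <= B -> `|y| <= B -> `|x - y| <= dl -> `|f2 x - f2 y| <= om).

Lemma derive1_lip a b : `|a| <= B -> `|b| <= B -> `|f1 a - f1 b| <= L * `|a - b|.
Proof.
move=> aB bB; have [c [cB _ ->]] := MVT_between ddf aB bB.
by rewrite normrM ler_wpM2r// fL.
Qed.

Lemma rem1_le a b : `|a| <= B -> `|b| <= B -> `|rem1 a b| <= L * `|a - b| ^+ 2.
Proof.
move=> aB bB; have [c [cB ac E]] := MVT_between df aB bB.
rewrite /rem1 E -mulrBl normrM expr2 mulrA ler_wpM2r// distrC.
apply: le_trans (derive1_lip aB cB) _; rewrite ler_wpM2l//.
exact: le_trans (normr_ge0 _) (fL aB).
Qed.

(** The remainder is differentiated along the segment from (a', b') to (a, b), and the derivative is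
    grouped by the increments of [b] and of a - b. The increment of [b] is that of the fixed
    solution and has no small factor, so its coefficient f'(A) - f'(D) - f''(A) (A - D) must be
    small: it is at most om dl. *)
Lemma rem1_diff a b a' b' : `|a| <= B -> `|b| <= B -> `|a'| <= B -> `|b'| <= B ->
  `|a - b| <= dl -> `|a' - b'| <= dl ->
  `|rem1 a b - rem1 a' b'| <=
    om * dl * `|b - b'| + L * dl * `|(a - b) - (a' - b')|.
Proof.
move=> aB bB a'B b'B ab ab'.
have dl0 : 0 <= dl by exact: le_trans (normr_ge0 _) ab.
have L0 : 0 <= L by exact: le_trans (normr_ge0 _) (fL aB).
have om0 : 0 <= om.
  by apply: le_trans (fom aB aB _); rewrite subrr normr0.
pose A (s : R) := a' + s * (a - a'); pose D (s : R) := b' + s * (b - b').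
pose phi s := rem1 (A s) (D s).
have dA (s : R) : is_derive s 1 A (a - a').
  by rewrite /A; apply: is_derive_eq; rewrite ?add0r; rewrite /GRing.scale /=; ring.
have dD (s : R) : is_derive s 1 D (b - b').
  by rewrite /D; apply: is_derive_eq; rewrite ?add0r; rewrite /GRing.scale /=; ring.
have comp (g E : R -> R) (s k : R) : (forall x, derivable g x 1) ->
    is_derive s 1 E k -> is_derive s 1 (g \o E) (derive1 g (E s) * k).
  move=> dg dE; have dgE : is_derive (E s) 1 g (derive1 g (E s)) by exact: is_derive1.
  by apply: is_derive_eq; rewrite /GRing.scale /=; ring.
pose dphi s := (f1 (A s) - f1 (D s) - f2 (A s) * (A s - D s)) * (b - b') -
    f2 (A s) * (A s - D s) * ((a - b) - (a' - b')).
have dP (s : R) : is_derive s 1 phi (dphi s).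
  have H1 := comp f A s _ df (dA s); have H2 := comp f D s _ df (dD s).
  have H3 := comp f1 A s _ ddf (dA s).
  have H4 := is_deriveM H3 (is_deriveB (dA s) (dD s)).
  have H := is_deriveB (is_deriveB H1 H2) H4.
  by apply: (@is_derive_eq _ _ _ phi s 1 _ _ H); rewrite /dphi !fctE /GRing.scale /=; ring.
have cphi : {within `[0, 1], continuous phi}.
  apply: continuous_subspaceT => s; have [ds _] := dP s.
  exact/differentiable_continuous/derivable1_diffP.
have [s] := MVT ltr01 (fun s _ => dP s) cphi; rewrite in_itv /= => /andP[s0 s1].
have -> : phi 1 = rem1 a b by rewrite /phi /A /D !mul1r !(addrC _ (_ - _)) !subrK.
have -> : phi 0 = rem1 a' b' by rewrite /phi /A /D !mul0r !addr0.
rewrite subr0 mulr1 => ->.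
have conv (x y c : R) : `|x| <= c -> `|y| <= c -> `|y + s * (x - y)| <= c.
  move=> xc yc; have -> : y + s * (x - y) = (1 - s) * y + s * x by ring.
  apply: le_trans (ler_normD _ _) _; rewrite !normrM (gtr0_norm s0).
  rewrite ger0_norm ?subr_ge0 ?(ltW s1)//.
  have -> : c = (1 - s) * c + s * c by ring.
  by rewrite lerD// ler_wpM2l// ?(ltW s0)// subr_ge0 ltW.
have AB : `|A s| <= B by exact: conv.
have DB : `|D s| <= B by exact: conv.
have AD : `|A s - D s| <= dl.
  have -> : A s - D s = (a' - b') + s * ((a - b) - (a' - b')) by rewrite /A /D; ring.
  exact: conv.
have T1 : `|f1 (A s) - f1 (D s) - f2 (A s) * (A s - D s)| <= om * dl.
  have [c [cB Ac ->]] := MVT_between ddf AB DB.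
  rewrite -mulrBl normrM ler_pM// fom// distrC; exact: le_trans Ac AD.
apply: le_trans (ler_normB _ _) _; rewrite !normrM lerD//; first by rewrite ler_wpM2r.
by rewrite ler_wpM2r// ler_pM// fL.
Qed.

End TaylorRemainder.

(** * The linearized system at an arbitrary base point *)

Section LinearizedSystem.
Variables (R : realType) (d : nat).
Notation pt := 'rV[R]_d.
Notation fp := ((pt -> R) * (pt -> R))%type.
Implicit Types (x y : pt) (w : fp).

Local Notation cd := (embed_const R d).

Variables (lam alpha beta gamma : R).
Hypotheses (lam0 : 0 < lam) (alpha1 : alpha < 1).
Hypotheses (gamma0 : 0 < gamma) (gammabeta : gamma < beta) (betaalpha : beta < alpha).

(** The coefficient [q] stands for f'(M). The system is needed at the solution, where stability
    applies, and at every iterate. *)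
Definition linsys (U M q : pt -> R) w (F1 F2 : pt -> R) :=
  (forall x, - lap w.1 x + gdot U w.1 x + lam * w.1 x - q x * w.2 x = F1 x) /\
  (forall x, - lap w.2 x - div_mul_grad w.2 U x + lam * w.2 x -
     div_mul_grad M w.1 x = F2 x).

(* The second equation contains M lap w.1, which the first equation expresses
   by terms of lower order. *)
Definition lower_order (U M q : pt -> R) w : fp :=
  (fun x => gdot U w.1 x - q x * w.2 x,
   fun x => - gdot w.2 U x - w.2 x * lap U x - gdot M w.1 x -
     M x * (lam * w.1 x + gdot U w.1 x - q x * w.2 x)).

Lemma linsysP (U M q : pt -> R) w (F1 F2 : pt -> R) : C2 U -> C2 M -> C2p w ->
  linsys U M q w F1 F2 <->
  respair lam w + lower_order U M q w = (F1, fun x => F2 x - M x * F1 x).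
Proof.
move=> UC MC [_ _ c1 c2].
have D x : - lap w.2 x - div_mul_grad w.2 U x + lam * w.2 x - div_mul_grad M w.1 x =
    - lap w.2 x - (gdot w.2 U x + w.2 x * lap U x) + lam * w.2 x -
    (gdot M w.1 x + M x * lap w.1 x) by rewrite !div_mul_gradE.
split=> [[E1 E2]|E].
  congr (_, _); apply/funext => x.
    move: (E1 x); rewrite !fctE /=; move: (lap w.1 x) (gdot U w.1 x) => p r <-; ring.
  move: (E1 x) (E2 x); rewrite D !fctE /=.
  move: (lap w.1 x) (lap w.2 x) (lap U x) (gdot U w.1 x) (gdot M w.1 x) (gdot w.2 U x).
  by move=> p1 p2 p3 r1 r2 r3 <- <-; ring.
have e1 x : lam * w.1 x - lap w.1 x + (gdot U w.1 x - q x * w.2 x) = F1 x.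
  exact: (congr1 (fun h : fp => h.1 x) E).
have e2 x : lam * w.2 x - lap w.2 x + (- gdot w.2 U x - w.2 x * lap U x -
    gdot M w.1 x - M x * (lam * w.1 x + gdot U w.1 x - q x * w.2 x)) =
    F2 x - M x * F1 x.
  exact: (congr1 (fun h : fp => h.2 x) E).
split=> x.
  by rewrite -e1; move: (lap w.1 x) (gdot U w.1 x) => p r; ring.
rewrite D -[F2 x](subrK (M x * F1 x)) -e2 -e1.
move: (lap w.1 x) (lap w.2 x) (lap U x) (gdot U w.1 x) (gdot M w.1 x) (gdot w.2 U x).
by move=> p1 p2 p3 r1 r2 r3; ring.
Qed.

Let alpha01 : 0 < alpha <= 1.
Proof.
by rewrite (lt_trans gamma0 (lt_trans gammabeta betaalpha)) (ltW alpha1).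
Qed.
Let beta0 : 0 < beta. Proof. exact: lt_trans gamma0 gammabeta. Qed.
Let beta1 : beta < 1. Proof. exact: lt_trans betaalpha alpha1. Qed.
Let beta01 : 0 < beta <= 1. Proof. by rewrite beta0 (ltW beta1). Qed.
Let gamma01 : 0 < gamma <= 1.
Proof. by rewrite gamma0 (ltW (lt_trans gammabeta beta1)). Qed.

Variables (U M q : pt -> R) (KU KM Kq : R).
Hypotheses (UK : c2h beta KU U) (MK : c2 KM M) (qK : hol alpha Kq q).

Let UC : C2 U. Proof. by case: UK. Qed.
Let MC : C2 M. Proof. by case: MK. Qed.

Lemma lower_order_lin (a : R) w w' : C2p w -> C2p w' ->
  lower_order U M q (a *: w + w') = a *: lower_order U M q w + lower_order U M q w'.
Proof.
move=> [_ _ c1 c2] [_ _ c1' c2']; congr (_, _); apply/funext => x.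
  change (gdot U (fun x => a * w.1 x + w'.1 x) x - q x * (a * w.2 x + w'.2 x) =
    a * (gdot U w.1 x - q x * w.2 x) + (gdot U w'.1 x - q x * w'.2 x)).
  by rewrite gdot_linr//; move: (gdot U w.1 x) (gdot U w'.1 x) => p r; ring.
change (- gdot (fun x => a * w.2 x + w'.2 x) U x - (a * w.2 x + w'.2 x) * lap U x -
    gdot M (fun x => a * w.1 x + w'.1 x) x - M x * (lam * (a * w.1 x + w'.1 x) +
    gdot U (fun x => a * w.1 x + w'.1 x) x - q x * (a * w.2 x + w'.2 x)) =
  a * (- gdot w.2 U x - w.2 x * lap U x - gdot M w.1 x -
     M x * (lam * w.1 x + gdot U w.1 x - q x * w.2 x)) +
  (- gdot w'.2 U x - w'.2 x * lap U x - gdot M w'.1 x -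
     M x * (lam * w'.1 x + gdot U w'.1 x - q x * w'.2 x))).
rewrite gdot_linl// !gdot_linr//.
move: (lap U x) (gdot U w.1 x) (gdot M w.1 x) (gdot w.2 U x).
move: (gdot U w'.1 x) (gdot M w'.1 x) (gdot w'.2 U x) => p1 p2 p3 p4 p5 p6 p7; ring.
Qed.

(** The coefficient [lap U] holds the second component at [beta], while the first one has no second
    derivatives and reaches [alpha]; this higher exponent brings w.1 to C^{2,beta} later. *)
Lemma lower_order_bound : exists2 C, 0 <= C & forall K w, c2p K w ->
  holp beta (C * K) (lower_order U M q w) /\ hol alpha (C * K) (lower_order U M q w).1.
Proof.
pose G := d%:R * (2 * cd * cd).
have first b Kq' K w : 0 < b <= 1 -> hol b Kq' q -> c2p K w ->
    hol b ((G * KU + 2 * Kq' * cd) * K) (fun x => gdot U w.1 x - q x * w.2 x).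
  move=> b01 qb [w1 w2].
  have -> : (G * KU + 2 * Kq' * cd) * K = G * (KU * K) + 2 * Kq' * (cd * K) by ring.
  apply: hol_sub; first exact: gdot_hol b01 (c2h_c2 UK) w1.
  by apply: hol_mul => //; exact: c2_hol_fun.
have qb : hol beta (2 * Kq) q by exact: hol_lower beta0 (ltW betaalpha) qK.
pose c1 := G * KU + 2 * Kq * cd.
pose c2' := G * KU + 2 * (2 * Kq) * cd.
pose c3 := G * KU + 2 * cd * (d%:R * KU) + G * KM +
  2 * (cd * KM) * (`|lam| * cd + G * KU + 2 * (2 * Kq) * cd).
exists (`|c1| + `|c2'| + `|c3|); first by rewrite !addr_ge0.
move=> K w wK; have K0 := c2_ge0 wK.1; have [w1 w2] := wK.
have L1 : c1 <= `|c1| + `|c2'| + `|c3|.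
  by rewrite -addrA (le_trans (ler_norm c1))// lerDl addr_ge0.
have L2 : c2' <= `|c1| + `|c2'| + `|c3|.
  by rewrite addrAC (le_trans (ler_norm c2'))// lerDr addr_ge0.
have L3 : c3 <= `|c1| + `|c2'| + `|c3|.
  by rewrite (le_trans (ler_norm c3))// lerDr addr_ge0.
split; last by apply: hol_mono (first _ _ _ _ alpha01 qK wK); rewrite ler_wpM2r.
split; first by apply: hol_mono (first _ _ _ _ beta01 qb wK); rewrite ler_wpM2r.
apply: (@hol_mono _ _ _ (c3 * K)); first by rewrite ler_wpM2r.
have -> : c3 * K = G * (K * KU) + 2 * (cd * K) * (d%:R * KU) + G * (KM * K) +
    2 * (cd * KM) * (`|lam| * (cd * K) + G * (KU * K) + 2 * (2 * Kq) * (cd * K)).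
  by rewrite /c3; ring.
apply: hol_sub; last first.
  apply: hol_mul; first exact: c2_hol_fun.
  apply: hol_sub; last by apply: hol_mul => //; exact: c2_hol_fun.
  apply: hol_add; last exact: gdot_hol beta01 (c2h_c2 UK) w1.
  by apply: hol_scale; exact: c2_hol_fun.
apply: hol_sub; last exact: gdot_hol beta01 MK w1.
apply: hol_sub; first by apply: hol_opp; exact: gdot_hol beta01 w2 (c2h_c2 UK).
by apply: hol_mul; [exact: c2_hol_fun|exact: lap_hol].
Qed.

(** With the lower order terms on the right, the components solve resolvent equations from
    C^{0,alpha} to C^{2,beta} and from C^{0,beta} to C^{2,gamma}. The C^2 bound on [w] is an input,
    supplied by [fredholm] or by compactness of the torus. *)
Lemma linsys_regularity : exists2 C, 0 <= C & forall K w F1 F2, C2p w -> c2p K w ->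
  linsys U M q w F1 F2 -> hol alpha K F1 -> hol beta K F2 ->
  c2h beta (C * K) w.1 /\ c2h gamma (C * K) w.2.
Proof.
have [CB CB0 HB] := lower_order_bound.
have [C1 C10 H1] := @schauder_regularity R d lam lam0 alpha beta beta0 betaalpha alpha1.
have [C2' C20 H2] := @schauder_regularity R d lam lam0 beta gamma gamma0 gammabeta beta1.
have KM0 := c2_ge0 MK.
have cd0 : 0 <= cd := embed_const_ge0 R d.
pose c := 1 + 2 * (cd * KM) * 2 + CB.
have c0 : 0 <= c by rewrite !addr_ge0// !mulr_ge0.
exists ((C1 + C2') * c); first by rewrite mulr_ge0// addr_ge0.
move=> K w F1 F2 wC wK S F1K F2K; have K0 := hol_ge0 F1K.
have E := (linsysP q F1 F2 UC MC wC).1 S.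
have [[_ B2] B1] := HB K w wK.
have [p1 p2 c1 c2] := wC.
have e1 : (fun x => lam * w.1 x - lap w.1 x) = (fun x => F1 x - (lower_order U M q w).1 x).
  apply/funext => x; have := congr1 (fun h : fp => h.1 x) E; rewrite /= => <-.
  by rewrite fctE addrK.
have e2 : (fun x => lam * w.2 x - lap w.2 x) =
    (fun x => F2 x - M x * F1 x - (lower_order U M q w).2 x).
  apply/funext => x; have := congr1 (fun h : fp => h.2 x) E; rewrite /= => <-.
  by rewrite fctE addrK.
have F1b : hol beta (2 * K) F1 by exact: hol_lower beta0 (ltW betaalpha) F1K.
split.
  apply: (@c2h_mono _ _ _ (C1 * (K + CB * K))).
    have -> : C1 * (K + CB * K) = C1 * (1 + CB) * K by ring.
    rewrite ler_wpM2r// ler_pM// ?addr_ge0// ?lerDl// /c.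
    by rewrite [leRHS]addrAC lerDl !mulr_ge0.
  by apply: (H1 _ _ p1 c1); rewrite e1; exact: (hol_sub F1K B1).
apply: (@c2h_mono _ _ _ (C2' * (K + 2 * (cd * KM) * (2 * K) + CB * K))).
  have -> : C2' * (K + 2 * (cd * KM) * (2 * K) + CB * K) = C2' * c * K by rewrite /c; ring.
  by rewrite ler_wpM2r// ler_wpM2r// lerDr.
apply: (H2 _ _ p2 c2); rewrite e2; apply: (hol_sub _ B2); apply: (hol_sub F2K).
exact: (hol_mul (c2_hol_fun beta01 MK) F1b).
Qed.

Hypothesis ker : forall w, C2p w -> linsys U M q w (fun=> 0) (fun=> 0) -> w = 0.

Let data_hol K F1 F2 : hol alpha K F1 -> hol beta K F2 ->
  holp gamma ((4 + 4 * (cd * KM)) * K) (F1, fun x => F2 x - M x * F1 x).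
Proof.
move=> F1K F2K; have K0 := hol_ge0 F1K; have KM0 := c2_ge0 MK.
have cd0 : 0 <= cd := embed_const_ge0 R d.
have t0 : 0 <= cd * KM * K by rewrite !mulr_ge0.
have F1g : hol gamma (2 * K) F1.
  exact: hol_lower gamma0 (ltW (lt_trans gammabeta betaalpha)) F1K.
split; first by apply: hol_mono F1g; move: K0 t0; lra.
have -> : (4 + 4 * (cd * KM)) * K = 4 * K + 2 * (cd * KM) * (2 * K) by ring.
apply: (@hol_mono _ _ _ (2 * K + 2 * (cd * KM) * (2 * K))).
  by rewrite lerD2r; move: K0; lra.
apply: hol_sub; first exact: hol_lower gamma0 (ltW gammabeta) F2K.
by apply: hol_mul => //; exact: c2_hol_fun.
Qed.

(** [fredholm] works in C^{0,gamma} and returns C^2 bounds, which [linsys_regularity] raises to the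
    Hölder spaces of the errors. *)
Lemma linsys_fredholm :
  (forall K F1 F2, hol alpha K F1 -> hol beta K F2 ->
    exists2 w, C2p w & linsys U M q w F1 F2) /\
  exists2 C, 0 <= C & forall K w F1 F2, C2p w -> linsys U M q w F1 F2 ->
    hol alpha K F1 -> hol beta K F2 -> c2h beta (C * K) w.1 /\ c2h gamma (C * K) w.2.
Proof.
have [CB CB0 HB] := lower_order_bound.
have KM0 := c2_ge0 MK.
have cd0 : 0 <= cd := embed_const_ge0 R d.
have Bker w : C2p w -> respair lam w + lower_order U M q w = 0 -> w = 0.
  move=> wC E; apply: (ker wC); apply/(linsysP q _ _ UC MC wC); rewrite E.
  by congr (_, _); apply/funext => x; rewrite mulr0 subr0.
have [solve [C C0 HC]] := fredholm lam0 gamma0 gammabeta beta1 lower_order_lin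
  (fun K w wK => (HB K w wK).1) Bker.
split.
  move=> K F1 F2 F1K F2K.
  have [|w wC wE] := solve (F1, fun x => F2 x - M x * F1 x).
    by exists ((4 + 4 * (cd * KM)) * K); exact: data_hol.
  by exists w => //; exact/(linsysP q F1 F2 UC MC wC).
have [C' C'0 HC'] := linsys_regularity.
pose c := C * (4 + 4 * (cd * KM)) + 1.
have c1 : 1 <= c by rewrite lerDr mulr_ge0// addr_ge0// !mulr_ge0.
exists (C' * c); first by rewrite mulr_ge0// (le_trans _ c1).
move=> K w F1 F2 wC S F1K F2K; have K0 := hol_ge0 F1K.
have wK : c2p (C * ((4 + 4 * (cd * KM)) * K)) w.
  apply: (HC _ _ wC); rewrite ((linsysP q F1 F2 UC MC wC).1 S); exact: data_hol.
have le1 : C * ((4 + 4 * (cd * KM)) * K) <= c * K.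
  by rewrite [leLHS]mulrA ler_wpM2r// lerDl.
have le2 : K <= c * K by rewrite ler_peMl.
have wK' : c2p (c * K) w.
  by case: wK => w1 w2; split; [exact: c2_mono w1|exact: c2_mono w2].
have -> : C' * c * K = C' * (c * K) by rewrite mulrA.
exact: (HC' _ _ _ _ wC wK' S (hol_mono le2 F1K) (hol_mono le2 F2K)).
Qed.

End LinearizedSystem.

Local Opaque gdot div_mul_grad.

(** * C^{2,b} gauges and absorption *)

Section HolderC2.
Variables (R : realType) (d : nat).
Notation pt := 'rV[R]_d.
Implicit Types (x y : pt) (g k : pt -> R).

Lemma c2hP (b K : R) g : c2h b K g <->
  c2 K g /\ forall i j, hol b K (partial j (partial i g)).
Proof.
split=> [gK|[[gp gC g0 g1 g2] gH]].
  by split; [exact: c2h_c2 gK|move=> i j; exact: c2h_partial2_hol].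
split; [exact: gp|exact: gC|exact: g0|exact: g1|move=> i j].
by split; [exact: g2|case: (gH i j)].
Qed.

Lemma c2h_lin (b K L a : R) g k : c2h b K g -> c2h b L k ->
  c2h b (`|a| * K + L) (fun x => a * g x + k x).
Proof.
move=> /c2hP[gK gH] /c2hP[kL kH]; apply/c2hP; split; first exact: c2_lin.
move=> i j; rewrite partial2_lin; [|by case: gK|by case: kL].
exact: hol_lin.
Qed.

Lemma c2h_sub (b K L : R) g k : c2h b K g -> c2h b L k -> c2h b (K + L) (g \- k).
Proof.
move=> gK kL; have := c2h_lin (-1) kL gK.
by rewrite subfE normrN1 mul1r addrC.
Qed.

Lemma c2h_add (b K L : R) g k : c2h b K g -> c2h b L k ->
  c2h b (K + L) (fun x => g x + k x).
Proof.
move=> gK kL; have := c2h_lin 1 gK kL; rewrite normr1 mul1r.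
by have -> : (fun x => 1 * g x + k x) = (fun x => g x + k x)
  by apply/funext => x; rewrite mul1r.
Qed.

Lemma c2h_lower (b s K : R) g : 0 < s -> s <= b -> c2h b K g -> c2h s (2 * K) g.
Proof.
move=> s0 sb /c2hP[gK gH]; apply/c2hP; split.
  by apply: c2_mono (gK); rewrite mulr_natl mulr2n lerDl (c2_ge0 gK).
by move=> i j; apply: hol_lower (gH i j).
Qed.

Lemma ler_closed (s K t : R) : 0 <= t -> (forall e, 0 < e -> s <= (K + e) * t) ->
  s <= K * t.
Proof.
move=> t0 H; apply/ler_addgt0Pr => e e0.
have t1 : 0 < t + 1 by rewrite ltr_wpDl.
apply: le_trans (H _ (divr_gt0 e0 t1)) _; rewrite mulrDl lerD2l.
by rewrite mulrAC ler_pdivrMr// ler_pM2l// lerDl.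
Qed.

Lemma c2h_closed (b K : R) g : (forall e, 0 < e -> c2h b (K + e) g) -> c2h b K g.
Proof.
move=> H; have [gp gC _ _ _] := H 1 ltr01.
split; [exact: gp|exact: gC|move=> x|move=> i x|move=> i j; split=> [x|x y]].
- by apply/ler_addgt0Pr => e /H[].
- by apply/ler_addgt0Pr => e /H[_ _ _ + _]; exact.
- by apply/ler_addgt0Pr => e /H[_ _ _ _ /(_ i j)[+ _]]; exact.
- apply: ler_closed; first exact: powR_ge0.
  by move=> e /H[_ _ _ _ /(_ i j)[_ +]]; exact.
Qed.

(** The gauge form of deducing Y <= 2A from Y <= A + Y/2: starting at a finite [Y0], iteration
    halves the excess over 2A. The leftover [e] is removed by [c2h_closed]. *)
Lemma absorb (P : R -> Prop) (A Y0 : R) : (forall K L, K <= L -> P K -> P L) ->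
  0 <= A -> P Y0 -> (forall Y, P Y -> P (A + Y / 2)) ->
  forall e, 0 < e -> P (2 * A + e).
Proof.
move=> mono A0 PY0 step e e0.
have H n : P (2 * A + `|Y0| / 2 ^+ n).
  elim: n => [|n IH].
    by apply: mono PY0; rewrite expr0 divr1 (le_trans (ler_norm Y0))// lerDr mulr_ge0.
  have := step _ IH; congr P; rewrite exprS; field.
  by rewrite expf_neq0.
have [n Hn] : exists n, `|Y0| / 2 ^+ n <= e.
  have := @cvg_geometric R `|Y0| 2^-1; rewrite gtr0_norm ?invr_gt0// => C.
  have {}C := C (ltac:(lra)).
  move/cvgrPdist_le : C => /(_ _ e0)[n _ Hn]; exists n.
  have := Hn n (leqnn n); rewrite /= sub0r normrN /geometric /= exprVn.
  exact: le_trans (ler_norm _).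
by apply: mono (H n); rewrite lerD2l.
Qed.

Lemma div_subl (r r' v : pt -> R) x : C2 r -> C2 r' -> C2 v ->
  div_mul_grad (r \- r') v x = div_mul_grad r v x - div_mul_grad r' v x.
Proof.
move=> rC r'C vC; rewrite (div_mul_gradE x (C2_sub rC r'C) vC).
rewrite (div_mul_gradE x rC vC) (div_mul_gradE x r'C vC) (gdot_subl v x rC r'C) /=.
move: (gdot r v x) (gdot r' v x) (lap v x) => p1 p2 p3; ring.
Qed.

Lemma div_subr (r v v' : pt -> R) x : C2 r -> C2 v -> C2 v' ->
  div_mul_grad r (v \- v') x = div_mul_grad r v x - div_mul_grad r v' x.
Proof.
move=> rC vC v'C; rewrite (div_mul_gradE x rC (C2_sub vC v'C)).
rewrite (div_mul_gradE x rC vC) (div_mul_gradE x rC v'C).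
rewrite (gdot_subr r x vC v'C) (lap_sub x vC v'C).
by move: (gdot r v x) (gdot r v' x) (lap v x) (lap v' x) => p1 p2 p3 p4; ring.
Qed.

End HolderC2.

(** * Error equation and estimate for one Newton step *)

Section NewtonStep.
Variables (R : realType) (d : nat) (lam alpha beta gamma : R).
Notation pt := 'rV[R]_d.
Notation fp := ((pt -> R) * (pt -> R))%type.
Local Notation cd := (embed_const R d).
Implicit Types (x y : pt) (U M : pt -> R) (w : fp).
Hypotheses (lam0 : 0 < lam) (alpha1 : alpha < 1).
Hypotheses (gamma0 : 0 < gamma) (gammabeta : gamma < beta) (betaalpha : beta < alpha).
Variables (f : R -> R) (m0 u m : pt -> R).
Hypotheses (df : forall t, derivable f t 1) (ddf : forall t, derivable (derive1 f) t 1)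
  (cf2 : continuous (derive1 (derive1 f))).
Variables (Fb Ku Km : R).
Hypothesis fb : forall t, `|derive1 f t| <= Fb.
Hypotheses (uK : c2h beta Ku u) (mK : c2h gamma Km m).
Hypothesis sol : MFG_classical_solution f lam m0 u m.
Local Notation f1 := (derive1 f).
Local Notation f2 := (derive1 (derive1 f)).

Let alpha0 : 0 < alpha. Proof. exact: lt_trans gamma0 (lt_trans gammabeta betaalpha). Qed.
Let alpha01 : 0 < alpha <= 1. Proof. by rewrite alpha0 ltW. Qed.
Let beta0 : 0 < beta. Proof. exact: lt_trans gamma0 gammabeta. Qed.
Let beta01 : 0 < beta <= 1.
Proof. by rewrite beta0 (ltW (lt_trans betaalpha alpha1)). Qed.
Let gamma01 : 0 < gamma <= 1.
Proof. by rewrite gamma0 (ltW (lt_trans gammabeta (lt_trans betaalpha alpha1))). Qed.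
Let uC : C2 u. Proof. by case: uK. Qed.
Let mC : C2 m. Proof. by case: mK. Qed.
Let Km0 : 0 <= Km. Proof. exact: c2_ge0 (c2h_c2 mK). Qed.
Let Fb0 : 0 <= Fb. Proof. exact: le_trans (normr_ge0 _) (fb 0). Qed.

Let lip g K : c2 K g -> forall x y, `|g (x + y) - g x| <= d%:R * K * `|y|.
Proof. by move=> [_ [dg _] _ g1 _]; exact: lipschitz_partial. Qed.

Definition newton_rhs1 U M x := gdot (U \- u) (U \- u) x / 2 + rem1 f (M x) (m x).
Definition newton_rhs2 U M x := - div_mul_grad (M \- m) (U \- u) x.

(** Subtracting the equations of (u, m) leaves the linearized operator at (U, M) acting on the new
    error, with data of second order in the old error. *)
Lemma newton_linsys U M u' m' : C2 U -> C2 M -> C2 u' -> C2 m' ->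
  newton_step f lam m0 U M u' m' <->
  linsys lam U M (f1 \o M) (u' \- u, m' \- m) (newton_rhs1 U M) (newton_rhs2 U M).
Proof.
move=> UC MC u'C m'C; have [_ [_ [_ [_ [S1 S2]]]]] := sol.
rewrite /newton_step /linsys /newton_rhs1 /newton_rhs2 /=.
have E1 x : gdot (U \- u) (U \- u) x = gdot U U x - 2 * gdot U u x + gdot u u x.
  rewrite (gdot_subl _ x UC uC) (gdot_subr U x UC uC) (gdot_subr u x UC uC) (gdotC u U).
  by move: (gdot U U x) (gdot U u x) (gdot u u x) => p q r; ring.
have E2 x : div_mul_grad (M \- m) (U \- u) x = div_mul_grad M U x -
    div_mul_grad M u x - div_mul_grad m U x + div_mul_grad m u x.
  rewrite (div_subl x MC mC (C2_sub UC uC)) (div_subr x MC UC uC) (div_subr x mC UC uC).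
  by move: (div_mul_grad M U x) (div_mul_grad M u x) (div_mul_grad m U x)
    (div_mul_grad m u x) => p q r s; ring.
have G1 x : gdot U (u' \- U) x = gdot U u' x - gdot U U x := gdot_subr U x u'C UC.
have G2 x : gdot U (u' \- u) x = gdot U u' x - gdot U u x := gdot_subr U x u'C uC.
have G3 x : lap (u' \- u) x = lap u' x - lap u x := lap_sub x u'C uC.
have G4 x : lap (m' \- m) x = lap m' x - lap m x := lap_sub x m'C mC.
have G5 x : div_mul_grad (m' \- M) U x = div_mul_grad m' U x - div_mul_grad M U x.
  exact: div_subl x m'C MC UC.
have G6 x : div_mul_grad (m' \- m) U x = div_mul_grad m' U x - div_mul_grad m U x.
  exact: div_subl x m'C mC UC.
have G7 x : div_mul_grad M (u' \- U) x = div_mul_grad M u' x - div_mul_grad M U x.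
  exact: div_subr x MC u'C UC.
have G8 x : div_mul_grad M (u' \- u) x = div_mul_grad M u' x - div_mul_grad M u x.
  exact: div_subr x MC u'C uC.
split=> -[N1 N2]; split=> x.
- move: (N1 x) (S1 x); rewrite E1 /rem1 G1 G2 G3 /=.
  move: (lap u' x) (lap u x) (gdot U U x) (gdot U u x) (gdot u u x) (gdot U u' x).
  by move=> p1 p2 p3 p4 p5 p6; lra.
- move: (N2 x) (S2 x); rewrite E2 G4 G5 G6 G7 G8 /=.
  move: (lap m' x) (lap m x) (div_mul_grad M U x) (div_mul_grad M u x)
    (div_mul_grad m U x) (div_mul_grad m u x) (div_mul_grad m' U x)
    (div_mul_grad M u' x).
  by move=> p1 p2 p3 p4 p5 p6 p7 p8; lra.
- move: (N1 x) (S1 x); rewrite E1 /rem1 G1 G2 G3 /=.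
  move: (lap u' x) (lap u x) (gdot U U x) (gdot U u x) (gdot u u x) (gdot U u' x).
  by move=> p1 p2 p3 p4 p5 p6; lra.
- move: (N2 x) (S2 x); rewrite E2 G4 G5 G6 G7 G8 /=.
  move: (lap m' x) (lap m x) (div_mul_grad M U x) (div_mul_grad M u x)
    (div_mul_grad m U x) (div_mul_grad m u x) (div_mul_grad m' U x)
    (div_mul_grad M u' x).
  by move=> p1 p2 p3 p4 p5 p6 p7 p8; lra.
Qed.

(** Coefficient differences become data, so the estimate at the stable solution can be applied to
    the system at (U, M). *)
Lemma linsys_perturb U M w F1 F2 : C2 U -> C2 M -> C2p w ->
  linsys lam U M (f1 \o M) w F1 F2 ->
  linsys lam u m (f1 \o m) w
    (fun x => F1 x - gdot (U \- u) w.1 x + (f1 (M x) - f1 (m x)) * w.2 x)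
    (fun x => F2 x + div_mul_grad w.2 (U \- u) x + div_mul_grad (M \- m) w.1 x).
Proof.
move=> UC MC [_ _ c1 c2] [E1 E2]; split=> x.
  move: (E1 x); rewrite (gdot_subl w.1 x UC uC) /= => <-.
  by move: (lap w.1 x) (gdot U w.1 x) (gdot u w.1 x) => p q r; ring.
move: (E2 x); rewrite (div_subl x MC mC c1) (div_subr x c2 UC uC) => <-.
move: (lap w.2 x) (div_mul_grad w.2 U x) (div_mul_grad M w.1 x)
  (div_mul_grad w.2 u x) (div_mul_grad m w.1 x).
by move=> p q r s t; ring.
Qed.

Variable L2 : R.
Hypotheses (L20 : 0 <= L2) (fL : forall t, `|t| <= Km + 1 -> `|f2 t| <= L2).

Let m_le x : `|m x| <= Km + 1.
Proof. by have [_ _ H _ _] := mK; apply: le_trans (H x) _; rewrite lerDl. Qed.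

Let M_le dl M x : dl <= 1 -> c2 dl (M \- m) -> `|M x| <= Km + 1.
Proof.
move=> dl1 [_ _ H _ _]; have [_ _ Hm _ _] := mK.
have -> : M x = m x + (M \- m) x by rewrite /= addrC subrK.
apply: le_trans (ler_normD _ _) _; rewrite lerD// ?Hm//; exact: le_trans (H x) dl1.
Qed.

Lemma comp_hol (K : R) M : c2 K M -> (forall x, `|M x| <= Km + 1) ->
  hol alpha (3 * (Fb + L2 * (d%:R * K))) (f1 \o M).
Proof.
move=> MK MB; have K0 := c2_ge0 MK; apply: hol_lip => //.
- by move=> x i /=; have [-> _ _ _ _] := MK.
- by move=> x /=; apply: le_trans (fb _) _; rewrite lerDl !mulr_ge0.
move=> x y /=; apply: le_trans (derive1_lip ddf fL (MB _) (MB _)) _.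
apply: (@le_trans _ _ (L2 * (d%:R * K * `|y|))); first by rewrite ler_wpM2l// lip.
by rewrite mulrA ler_wpM2r// lerDr.
Qed.

(** The supremum is of order [dl], but the Lipschitz constant is only bounded because f'' need not
    be Lipschitz; interpolation keeps the small factor dl^(1-alpha). *)
Lemma comp_diff_hol (dl : R) M : dl <= 1 -> c2 dl (M \- m) ->
  hol alpha (L2 * dl + (2 * (L2 * dl)) `^ (1 - alpha) *
    (L2 * (d%:R * (2 * Km + 1))) `^ alpha) (fun x => f1 (M x) - f1 (m x)).
Proof.
move=> dl1 eK; have dl0 := c2_ge0 eK; have MB := fun x => @M_le dl M x dl1 eK.
have ME x : M x = (M \- m) x + m x by rewrite /= subrK.
apply: hol_interp => //.
- move=> x i; have [-> _ _ _ _] := mK; have [ep _ _ _ _] := eK.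
  have [mp _ _ _ _] := mK.
  by rewrite (ME (x + _)) ep mp -ME.
- move=> x; apply: le_trans (derive1_lip ddf fL (MB x) (m_le x)) _.
  by rewrite ler_wpM2l//; have [_ _ H _ _] := eK; exact: H.
move=> x y; have T1 := derive1_lip ddf fL (MB (x + y)) (MB x).
have T2 := derive1_lip ddf fL (m_le (x + y)) (m_le x).
have Lm := lip (c2h_c2 mK) x y; have Le := lip eK x y.
have LM : `|M (x + y) - M x| <= d%:R * (Km + 1) * `|y|.
  rewrite !ME opprD addrACA (le_trans (ler_normD _ _))//.
  apply: le_trans (lerD Le Lm) _; rewrite -mulrDl -mulrDr ler_wpM2r// ler_wpM2l//.
  by rewrite addrC lerD2l.
have -> : f1 (M (x + y)) - f1 (m (x + y)) - (f1 (M x) - f1 (m x)) =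
  (f1 (M (x + y)) - f1 (M x)) - (f1 (m (x + y)) - f1 (m x)) by ring.
apply: le_trans (ler_normB _ _) _; apply: le_trans (lerD T1 T2) _.
rewrite -mulrDr -mulrA ler_wpM2l//; apply: le_trans (lerD LM Lm) _.
by rewrite -mulrDl -mulrDr le_eqVlt; apply/orP; left; apply/eqP; ring.
Qed.

(** Values come from [rem1_le] and increments from [rem1_diff], where a - b is the error, with
    gradient at most [dl], and b is [m], with gradient at most [Km]. *)
Lemma rem_hol (dl om : R) M : dl <= 1 -> 0 <= om -> c2 dl (M \- m) ->
  (forall s t, `|s| <= Km + 1 -> `|t| <= Km + 1 -> `|s - t| <= dl ->
    `|f2 s - f2 t| <= om) ->
  hol alpha (3 * ((L2 * (1 + d%:R) + d%:R * Km) * ((dl + om) * dl)))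
    (fun x => rem1 f (M x) (m x)).
Proof.
move=> dl1 om0 eK fom; have dl0 := c2_ge0 eK; have MB := fun x => @M_le dl M x dl1 eK.
have ME x : M x = (M \- m) x + m x by rewrite /= subrK.
have [ep _ e0 _ _] := eK; have [mp _ _ _ _] := mK.
have dd : 0 <= dl * dl by rewrite mulr_ge0.
have od : 0 <= om * dl by rewrite mulr_ge0.
have nd : 0 <= d%:R :> R by [].
apply: hol_lip => // [x i|x|x y].
- by rewrite (ME (x + _)) ep mp -ME.
- apply: le_trans (rem1_le df ddf fL (MB x) (m_le x)) _.
  apply: (@le_trans _ _ (L2 * (dl * dl))).
    by rewrite ler_wpM2l// expr2 ler_pM// e0.
  have : 0 <= L2 * d%:R * (dl * dl) + d%:R * Km * (dl * dl) +
    (L2 * (1 + d%:R) + d%:R * Km) * (om * dl).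
    by rewrite !addr_ge0// !mulr_ge0// !addr_ge0// !mulr_ge0// addr_ge0.
  by move=> T; rewrite -subr_ge0; apply: le_trans T _; rewrite le_eqVlt;
    apply/orP; left; apply/eqP; ring.
apply: le_trans (rem1_diff df ddf fL fom (MB _) (m_le _) (MB _) (m_le _) (e0 _) (e0 _)) _.
have Lm := lip (c2h_c2 mK) x y; have Le := lip eK x y.
apply: (@le_trans _ _ (om * dl * (d%:R * Km * `|y|) + L2 * dl * (d%:R * dl * `|y|))).
  by rewrite lerD// ler_wpM2l// mulr_ge0.
have : 0 <= (L2 * (dl * dl) + d%:R * Km * (dl * dl) + L2 * (1 + d%:R) * (om * dl)) * `|y|.
  by rewrite mulr_ge0// !addr_ge0// !mulr_ge0// addr_ge0.
by move=> T; rewrite -subr_ge0; apply: le_trans T _; rewrite le_eqVlt;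
  apply/orP; left; apply/eqP; ring.
Qed.

Hypothesis ker : forall w, C2p w ->
  linsys lam u m (f1 \o m) w (fun=> 0) (fun=> 0) -> w = 0.

(* The stability estimate at (u, m) persists in a neighbourhood, because the
   difference of the linearized systems is absorbed. *)
Lemma linsys_estimate : exists2 C, 0 <= C & exists dl1, 0 < dl1 <= 1 /\
  forall dl U M KU KM, dl <= dl1 -> c2h beta KU U -> c2h gamma KM M ->
  c2h beta dl (U \- u) -> c2h gamma dl (M \- m) ->
  forall K w F1 F2, C2p w -> linsys lam U M (f1 \o M) w F1 F2 ->
  hol alpha K F1 -> hol beta K F2 ->
  c2h beta (C * K) w.1 /\ c2h gamma (C * K) w.2.
Proof.
have [_ [C C0 HC]] := linsys_fredholm lam0 alpha1 gamma0 gammabeta betaalpha uK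
  (c2h_c2 mK) (comp_hol (c2h_c2 mK) m_le) ker.
have cd0 : 0 <= cd := embed_const_ge0 R d.
pose A1 := d%:R * (2 * cd * cd) + 2 * L2 * cd +
  2 * (d%:R * (2 * cd * cd + 2 * cd)).
pose A2 := 2 * cd * (2 * L2) `^ (1 - alpha) * (L2 * (d%:R * (2 * Km + 1))) `^ alpha.
have A10 : 0 <= A1.
  by rewrite !addr_ge0// !mulr_ge0// addr_ge0// !mulr_ge0.
have A20 : 0 <= A2 by rewrite !mulr_ge0// powR_ge0.
pose A := A1 + A2; have AA : 0 <= A by rewrite addr_ge0.
have T0 : 0 < 2 * (C * A) + 1 by rewrite ltr_wpDl// !mulr_ge0.
have a1 : 0 < 1 - alpha by rewrite subr_gt0.
(* [A] collects the sizes of all coefficient differences, each of order dl^(1-alpha) since dl <= 1;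
   the threshold makes C A dl^(1-alpha) at most 1/2. *)
pose r := (2 * (C * A) + 1)^-1.
have r0 : 0 < r by rewrite invr_gt0.
pose dl1 := Num.min 1 (r `^ (1 - alpha)^-1).
exists (2 * C); first by rewrite mulr_ge0.
exists dl1; split.
  by rewrite lt_min ltr01 powR_gt0//= ge_min lexx.
move=> dl U M KU KM dldl1 UK MK eK eK' K w F1 F2 wC S F1K F2K.
have K0 := hol_ge0 F1K.
have dl0 := c2_ge0 (c2h_c2 eK).
have dl_1 : dl <= 1 by apply: le_trans dldl1 _; rewrite ge_min lexx.
have dlr : dl `^ (1 - alpha) <= r.
  have -> : r = (r `^ (1 - alpha)^-1) `^ (1 - alpha).
    by rewrite -powRrM mulVf ?gt_eqF// powRr1// ltW.
  apply: powR_le => //; first exact: ltW.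
  by apply: le_trans dldl1 _; rewrite ge_min lexx orbT.
have dla : dl <= dl `^ (1 - alpha).
  have [->|dln] := eqVneq dl 0; first exact: powR_ge0.
  have dlp : 0 < dl by rewrite lt_neqAle eq_sym dln.
  rewrite -[leLHS](powRr1 dl0) ger_powR ?dlp//.
  by rewrite lerBlDr lerDl ltW.
have UC : C2 U by case: UK.
have MC : C2 M by case: MK.
pose P Y := c2h beta Y w.1 /\ c2h gamma Y w.2.
have monoP X Y : X <= Y -> P X -> P Y.
  by move=> XY [h1 h2]; split; [exact: c2h_mono h1|exact: c2h_mono h2].
(* Absorption has to start from a finite bound. This one depends on [KU], [KM] and [w], and
   disappears from the final estimate. *)
have [Y0 PY0] : exists Y, P Y.
  have MB x : `|M x| <= Km + 1 := @M_le dl M x dl_1 (c2h_c2 eK').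
  have [C' _ HC'] := linsys_regularity lam0 alpha1 gamma0 gammabeta betaalpha UK
    (c2h_c2 MK) (comp_hol (c2h_c2 MK) MB).
  have [K' [w1 w2]] := C2p_c2p wC.
  exists (C' * Num.max K K').
  have le1 : K <= Num.max K K' by rewrite le_max lexx.
  have le2 : K' <= Num.max K K' by rewrite le_max lexx orbT.
  exact: (HC' _ _ _ _ wC (conj (c2_mono le2 w1) (c2_mono le2 w2)) S
    (hol_mono le1 F1K) (hol_mono le1 F2K)).
have stepP Y : P Y -> P (C * K + Y / 2).
  move=> [w1 w2]; have Y_0 := c2_ge0 (c2h_c2 w1).
  have XY0 : 0 <= dl `^ (1 - alpha) * Y by rewrite mulr_ge0 ?powR_ge0.
  have Dv0 : 0 <= d%:R * (2 * cd * cd + 2 * cd) by rewrite !mulr_ge0// addr_ge0// !mulr_ge0.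
  have ler02 : 0 <= 2 :> R by [].
  have [h1 h2] : P (C * (K + A * dl `^ (1 - alpha) * Y)).
    apply: (HC _ _ _ _ wC (linsys_perturb UC MC wC S)).
      apply: (@hol_mono _ _ _ (K + d%:R * (2 * cd * cd) * (dl * Y) +
        2 * (L2 * dl + (2 * (L2 * dl)) `^ (1 - alpha) *
        (L2 * (d%:R * (2 * Km + 1))) `^ alpha) * (cd * Y))).
        rewrite -addrA lerD2l [2 * (L2 * dl)]mulrA powRM ?mulr_ge0//.
        have -> : d%:R * (2 * cd * cd) * (dl * Y) + 2 * (L2 * dl +
            (2 * L2) `^ (1 - alpha) * dl `^ (1 - alpha) *
            (L2 * (d%:R * (2 * Km + 1))) `^ alpha) * (cd * Y) =
          (d%:R * (2 * cd * cd) + 2 * L2 * cd) * (dl * Y) +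
          A2 * (dl `^ (1 - alpha) * Y) by rewrite /A2; ring.
        have -> : A * dl `^ (1 - alpha) * Y =
          (d%:R * (2 * cd * cd) + 2 * L2 * cd) * (dl `^ (1 - alpha) * Y) +
          2 * (d%:R * (2 * cd * cd + 2 * cd)) * (dl `^ (1 - alpha) * Y) +
          A2 * (dl `^ (1 - alpha) * Y) by rewrite /A /A1; ring.
        rewrite lerD2r; apply: ler_wpDr; first exact: mulr_ge0 (mulr_ge0 ler02 Dv0) XY0.
        by apply: ler_wpM2l; [rewrite addr_ge0// !mulr_ge0|rewrite ler_wpM2r].
      apply: hol_add; first apply: (hol_sub F1K).
        exact: (gdot_hol alpha01 (c2h_c2 eK) (c2h_c2 w1)).
      exact: (hol_mul (comp_diff_hol dl_1 (c2h_c2 eK')) (c2_hol_fun alpha01 (c2h_c2 w2))).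
    apply: (@hol_mono _ _ _ (K + d%:R * (2 * cd * cd + 2 * cd) * (Y * dl) +
      d%:R * (2 * cd * cd + 2 * cd) * (dl * Y))).
      rewrite -addrA lerD2l [Y * dl]mulrC.
      have -> : d%:R * (2 * cd * cd + 2 * cd) * (dl * Y) +
          d%:R * (2 * cd * cd + 2 * cd) * (dl * Y) =
        2 * (d%:R * (2 * cd * cd + 2 * cd)) * (dl * Y) by ring.
      have -> : A * dl `^ (1 - alpha) * Y =
        2 * (d%:R * (2 * cd * cd + 2 * cd)) * (dl `^ (1 - alpha) * Y) +
        (d%:R * (2 * cd * cd) + 2 * L2 * cd + A2) * (dl `^ (1 - alpha) * Y).
        by rewrite /A /A1; ring.
      apply: ler_wpDr; first by apply: mulr_ge0 XY0; rewrite !addr_ge0// !mulr_ge0.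
      by apply: ler_wpM2l; [rewrite !mulr_ge0// addr_ge0// !mulr_ge0|rewrite ler_wpM2r].
    apply: hol_add; first apply: (hol_add F2K).
      exact: (div_hol beta01 (c2h_c2 w2) eK).
    exact: (div_hol beta01 (c2h_c2 eK') w1).
  have le : C * (K + A * dl `^ (1 - alpha) * Y) <= C * K + Y / 2.
    rewrite mulrDr lerD2l.
    have CAr : C * A * r <= 2^-1.
      rewrite /r ler_pdivrMr//; move: (mulr_ge0 C0 AA); lra.
    have -> : C * (A * dl `^ (1 - alpha) * Y) = C * A * dl `^ (1 - alpha) * Y by ring.
    rewrite mulrC ler_wpM2l//; apply: le_trans CAr.
    by rewrite ler_wpM2l// mulr_ge0.
  exact: monoP le (conj h1 h2).
have CK : 0 <= C * K by rewrite mulr_ge0.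
have F := absorb monoP CK PY0 stepP.
have -> : 2 * C * K = 2 * (C * K) by rewrite mulrA.
by split; apply: c2h_closed => e e0; [exact: (F e e0).1|exact: (F e e0).2].
Qed.

(** [linsys_estimate] serves twice: with zero data it gives injectivity at (U, M), hence a next
    iterate by the Fredholm alternative; with the second order data it bounds the new error. *)
Lemma newton_step_estimate : exists2 C, 0 <= C & exists dl1, 0 < dl1 <= 1 /\
  forall dl om U M KU KM, dl <= dl1 -> 0 <= om ->
  (forall s t, `|s| <= Km + 1 -> `|t| <= Km + 1 -> `|s - t| <= dl ->
    `|f2 s - f2 t| <= om) ->
  c2h beta KU U -> c2h gamma KM M ->
  c2h beta dl (U \- u) -> c2h gamma dl (M \- m) ->
  (exists u' m' K', [/\ c2h beta K' u', c2h gamma K' m' &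
     newton_step f lam m0 U M u' m']) /\
  (forall u' m', periodic u' -> periodic m' -> C2 u' -> C2 m' ->
    newton_step f lam m0 U M u' m' ->
    c2h beta (C * ((dl + om) * dl)) (u' \- u) /\
    c2h gamma (C * ((dl + om) * dl)) (m' \- m)).
Proof.
have [C0 C00 [dl1 [/andP[dl10 dl11] HC]]] := linsys_estimate.
have cd0 : 0 <= cd := embed_const_ge0 R d.
pose G := d%:R * (2 * cd * cd).
pose H := 3 * (L2 * (1 + d%:R) + d%:R * Km).
pose D := d%:R * (2 * cd * cd + 2 * cd).
have G0 : 0 <= G by rewrite !mulr_ge0.
have H0 : 0 <= H by rewrite !mulr_ge0// addr_ge0// !mulr_ge0// addr_ge0.
have D0 : 0 <= D by rewrite !mulr_ge0// addr_ge0// !mulr_ge0.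
exists (C0 * (G + H + D)); first by rewrite mulr_ge0// !addr_ge0.
exists dl1; split; first by rewrite dl10.
move=> dl om U M KU KM dldl1 om0 fom UK MK eK eK'.
have dl_1 : dl <= 1 := le_trans dldl1 dl11.
have dl0 := c2_ge0 (c2h_c2 eK).
have UC : C2 U by case: UK.
have MC : C2 M by case: MK.
have dd : 0 <= dl * dl by rewrite mulr_ge0.
have od : 0 <= om * dl by rewrite mulr_ge0.
pose K := (G + H + D) * ((dl + om) * dl).
have r1 : hol alpha K (newton_rhs1 U M).
  have h1 := hol_scale 2^-1 (gdot_hol alpha01 (c2h_c2 eK) (c2h_c2 eK)).
  have h2 := rem_hol dl_1 om0 (c2h_c2 eK') fom.
  have := hol_add h1 h2.
  have -> : (fun x => 2^-1 * gdot (U \- u) (U \- u) x + rem1 f (M x) (m x)) =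
    newton_rhs1 U M by apply/funext => x; rewrite /newton_rhs1 mulrC.
  apply: hol_mono; rewrite gtr0_norm ?invr_gt0// /K -/G -/D.
  have -> : 3 * ((L2 * (1 + d%:R) + d%:R * Km) * ((dl + om) * dl)) =
    H * (dl * dl) + H * (om * dl) by rewrite /H; ring.
  have -> : (G + H + D) * ((dl + om) * dl) = G * (dl * dl) + G * (om * dl) +
    H * (dl * dl) + H * (om * dl) + D * (dl * dl) + D * (om * dl) by ring.
  move: (mulr_ge0 G0 dd) (mulr_ge0 G0 od) (mulr_ge0 D0 dd) (mulr_ge0 D0 od).
  move: (G * (dl * dl)) (G * (om * dl)) (H * (dl * dl)) (H * (om * dl))
    (D * (dl * dl)) (D * (om * dl)) => a1 a2 a3 a4 a5 a6; lra.
have r2 : hol beta K (newton_rhs2 U M).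
  apply: (@hol_mono _ _ _ (D * (dl * dl))); last first.
    by apply: hol_opp; exact: (div_hol beta01 (c2h_c2 eK') eK).
  rewrite /K.
  have -> : (G + H + D) * ((dl + om) * dl) = G * (dl * dl) + G * (om * dl) +
    H * (dl * dl) + H * (om * dl) + D * (dl * dl) + D * (om * dl) by ring.
  move: (mulr_ge0 G0 dd) (mulr_ge0 G0 od) (mulr_ge0 D0 od).
  move: (mulr_ge0 H0 dd) (mulr_ge0 H0 od).
  move: (G * (dl * dl)) (G * (om * dl)) (H * (dl * dl)) (H * (om * dl))
    (D * (dl * dl)) (D * (om * dl)) => a1 a2 a3 a4 a5 a6; lra.
have est w : C2p w -> linsys lam U M (f1 \o M) w (newton_rhs1 U M) (newton_rhs2 U M) ->
    c2h beta (C0 * K) w.1 /\ c2h gamma (C0 * K) w.2.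
  by move=> wC S; exact: (HC _ _ _ _ _ dldl1 UK MK eK eK' _ _ _ _ wC S r1 r2).
split; last first.
  move=> u' m' u'p m'p u'C m'C N.
  have wC : C2p (u' \- u, m' \- m).
    split; [|..|exact: C2_sub|exact: C2_sub].
      by move=> x i /=; have [up _ _ _ _] := uK; rewrite u'p up.
    by move=> x i /=; have [mp _ _ _ _] := mK; rewrite m'p mp.
  have := est _ wC ((newton_linsys UC MC u'C m'C).1 N).
  by rewrite /K mulrA.
have kerU w : C2p w -> linsys lam U M (f1 \o M) w (fun=> 0) (fun=> 0) -> w = 0.
  move=> wC S; have [] := HC _ _ _ _ _ dldl1 UK MK eK eK' 0 _ _ _ wC S
    (hol0 d alpha) (hol0 d beta).
  rewrite mulr0 => -[_ _ w1 _ _] [_ _ w2 _ _].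
  rewrite [w]surjective_pairing; congr (_, _); apply/funext => x.
    by apply/normr0_eq0/eqP; rewrite eq_le w1 normr_ge0.
  by apply/normr0_eq0/eqP; rewrite eq_le w2 normr_ge0.
have MB x : `|M x| <= Km + 1 := @M_le dl M x dl_1 (c2h_c2 eK').
have [solve _] := linsys_fredholm lam0 alpha1 gamma0 gammabeta betaalpha UK
  (c2h_c2 MK) (comp_hol (c2h_c2 MK) MB) kerU.
have [w wC S] := solve _ _ _ r1 r2.
have [h1 h2] := est _ wC S.
have u'K := c2h_add h1 uK; have m'K := c2h_add h2 mK.
have u'C : C2 (fun x => w.1 x + u x) by case: u'K.
have m'C : C2 (fun x => w.2 x + m x) by case: m'K.
exists (fun x => w.1 x + u x), (fun x => w.2 x + m x), (C0 * K + Num.max Ku Km).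
split.
- by apply: c2h_mono u'K; rewrite lerD2l le_max lexx.
- by apply: c2h_mono m'K; rewrite lerD2l le_max lexx orbT.
apply/(newton_linsys UC MC u'C m'C).
have -> : ((fun x => w.1 x + u x) \- u, (fun x => w.2 x + m x) \- m) = w.
  rewrite [RHS]surjective_pairing; congr (_, _); apply/funext => x /=; exact: addrK.
exact: S.
Qed.

End NewtonStep.

(** * Comparison of the extended real norms with gauges *)

Section HolderNorms.
Variables (R : realType) (d : nat).
Notation pt := 'rV[R]_d.
Implicit Types (x y : pt) (g : pt -> R) (b K : R).
Local Open Scope ereal_scope.

Lemma supnorm_ub g x : (`|g x|%R)%:E <= supnorm g.
Proof. by apply: ereal_sup_ubound; exists x. Qed.

Lemma supnorm_ge0 g : 0 <= supnorm g.
Proof. by apply: le_trans (supnorm_ub g 0%R); rewrite lee_fin. Qed.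

Lemma supnorm_le g K : (forall x, `|g x| <= K)%R -> supnorm g <= K%:E.
Proof. by move=> gK; apply: ge_ereal_sup => _ [x _ <-]; rewrite lee_fin. Qed.

Lemma holder_semi_ub b g x y : x != y ->
  (`|g x - g y| / (`|x - y| `^ b))%:E <= holder_semi b g.
Proof. by move=> xy; apply: ereal_sup_ubound; exists x, y. Qed.

(* In dimension 0 the set of difference quotients is empty and its supremum
   is -oo. *)
Lemma holder_semi_ge0 b g : (0 < d)%N -> 0 <= holder_semi b g.
Proof.
move=> hd; have ne : (e_ R (Ordinal hd)) != 0%R.
  by rewrite -normr_eq0 norm_e oner_eq0.
by apply: le_trans (holder_semi_ub b g ne); rewrite lee_fin divr_ge0 ?powR_ge0.
Qed.

Lemma holder_semi_le b K g : (0 <= K)%R -> holder b K g -> holder_semi b g <= K%:E.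
Proof.
move=> K0 gK; apply: ge_ereal_sup => _ [x [y [xy ->]]].
rewrite lee_fin ler_pdivrMr ?powR_gt0 ?normr_gt0 ?subr_eq0//.
by have := gK y (x - y)%R; rewrite [(y + _)%R]addrC subrK.
Qed.

Lemma lee_sum_term (F : 'I_d -> \bar R) i : (forall j, 0 <= F j) ->
  F i <= \sum_(j < d) F j.
Proof. by move=> F0; rewrite (bigD1 i)//= leeDl// sume_ge0. Qed.

Lemma norm2_ge0 b g : (0 < d)%N -> 0 <= norm2 b g.
Proof.
move=> hd; rewrite /norm2 !adde_ge0 ?supnorm_ge0//.
- by apply: sume_ge0 => i _; exact: supnorm_ge0.
- by do 2! (apply: sume_ge0 => ? _); exact: supnorm_ge0.
- by do 2! (apply: sume_ge0 => ? _); exact: holder_semi_ge0.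
Qed.

(** The terms of [norm2] are nonnegative, so each is below the total, and [fine] is faithful because
    the total is finite. *)
Lemma C2holder_c2h b g : (0 < d)%N -> C2holder b g -> c2h b (fine (norm2 b g)) g.
Proof.
move=> hd [gp [gC gN]].
have NE : norm2 b g = (fine (norm2 b g))%:E.
  by rewrite fineK// ge0_fin_numE// norm2_ge0.
set N := fine _ in NE *.
pose S1 := \sum_(i < d) supnorm (partial i g).
pose S2 := \sum_(i < d) \sum_(j < d) supnorm (partial j (partial i g)).
pose S3 := \sum_(i < d) \sum_(j < d) holder_semi b (partial j (partial i g)).
have S10 : 0 <= S1 by apply: sume_ge0 => i _; exact: supnorm_ge0.
have S20 : 0 <= S2 by do 2! (apply: sume_ge0 => ? _); exact: supnorm_ge0.
have S30 : 0 <= S3 by do 2! (apply: sume_ge0 => ? _); exact: holder_semi_ge0.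
have E : N%:E = supnorm g + S1 + S2 + S3 by rewrite -NE.
have S0 := supnorm_ge0 g.
have L0 : supnorm g <= N%:E by rewrite E -!addeA leeDl// !adde_ge0.
have L1 : S1 <= N%:E by rewrite E (addeC (supnorm g)) -!addeA leeDl// !adde_ge0.
have L2 : S2 <= N%:E by rewrite E (addeC _ S2) -!addeA leeDl// !adde_ge0.
have L3 : S3 <= N%:E by rewrite E addeC leeDl// !adde_ge0.
have M2 i j : supnorm (partial j (partial i g)) <= S2.
  apply: le_trans (@lee_sum_term (fun j => supnorm (partial j (partial i g))) j
    (fun k => supnorm_ge0 _)) _.
  apply: (@lee_sum_term (fun i => \sum_(j < d) supnorm (partial j (partial i g))) i) => k.
  by apply: sume_ge0 => l _; exact: supnorm_ge0.
have M3 i j : holder_semi b (partial j (partial i g)) <= S3.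
  apply: le_trans (@lee_sum_term (fun j => holder_semi b (partial j (partial i g))) j
    (fun k => holder_semi_ge0 b _ hd)) _.
  apply: (@lee_sum_term
    (fun i => \sum_(j < d) holder_semi b (partial j (partial i g))) i) => k.
  by apply: sume_ge0 => l _; exact: holder_semi_ge0.
split; [exact: gp|exact: gC|move=> x|move=> i x|move=> i j; split=> [x|x y]].
- by rewrite -lee_fin; apply: le_trans (supnorm_ub g x) L0.
- rewrite -lee_fin; apply: le_trans (supnorm_ub _ x) (le_trans _ L1).
  exact: (@lee_sum_term (fun i => supnorm (partial i g)) i (fun k => supnorm_ge0 _)).
- rewrite -lee_fin; apply: le_trans (supnorm_ub _ x) (le_trans (M2 i j) L2).
have [->|y0] := eqVneq y 0%R.
  rewrite addr0 subrr normr0 mulr_ge0 ?powR_ge0// -lee_fin.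
  exact: le_trans S0 L0.
have ne : (x + y)%R != x by rewrite -subr_eq0 addrAC subrr add0r.
rewrite -ler_pdivrMr ?powR_gt0 ?normr_gt0// -lee_fin.
have -> : (`|y| = `|x + y - x|)%R by rewrite addrAC subrr add0r.
exact: le_trans (holder_semi_ub b _ ne) (le_trans (M3 i j) L3).
Qed.

(** Counts the terms of [norm2]: one value, d first derivatives, and d^2 second derivatives entering
    twice. *)
Definition norm_const : R := 1 + d%:R + 2 * d%:R ^+ 2.

Lemma c2h_norm2 b K g : c2h b K g -> norm2 b g <= (norm_const * K)%:E.
Proof.
move=> gK; have K0 := c2_ge0 (c2h_c2 gK); case: gK => gp gC g0 g1 g2.
have sum_le (F : 'I_d -> \bar R) L : (forall i, F i <= L%:E) ->
    \sum_(i < d) F i <= (d%:R * L)%:E.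
  move=> FL; apply: (@le_trans _ _ (\sum_(i < d) L%:E)); first exact: lee_sum.
  by rewrite sumEFin sumr_const card_ord mulr_natl.
have -> : (norm_const * K = K + d%:R * K + d%:R * (d%:R * K) + d%:R * (d%:R * K))%R.
  by rewrite /norm_const; ring.
rewrite /norm2 !EFinD; apply: leeD; [apply: leeD; [apply: leeD|]|].
- exact: supnorm_le.
- by apply: (sum_le _ _) => i; apply: supnorm_le; exact: g1.
- apply: (sum_le _ _) => i; apply: (sum_le _ _) => j; apply: supnorm_le; exact: (g2 i j).1.
- apply: (sum_le _ _) => i; apply: (sum_le _ _) => j; exact: (holder_semi_le K0 (g2 i j).2).
Qed.

Lemma c2h_C2holder b K g : c2h b K g -> C2holder b g.
Proof.
move=> gK; have [gp gC _ _ _] := gK; split; [exact: gp|split; [exact: gC|]].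
exact: le_lt_trans (c2h_norm2 gK) (ltry _).
Qed.

End HolderNorms.

Section Distance.
Variables (R : realType) (d : nat) (hd : (0 < d)%N) (b : R).
Notation pt := 'rV[R]_d.
Implicit Types (g k : pt -> R).

Lemma dist2_ge0 g k : 0 <= dist2 b g k.
Proof. by apply: fine_ge0; exact: norm2_ge0. Qed.

Lemma dist2_c2h g k : C2holder b g -> C2holder b k -> c2h b (dist2 b g k) (g \- k).
Proof.
move=> gH kH; apply: (C2holder_c2h hd); apply: c2h_C2holder.
exact: c2h_sub (C2holder_c2h hd gH) (C2holder_c2h hd kH).
Qed.

Lemma dist2_le (K : R) g k : c2h b K (g \- k) -> dist2 b g k <= norm_const R d * K.
Proof.
move=> /c2h_norm2 H; rewrite -lee_fin /dist2 fineK// ge0_fin_numE ?norm2_ge0//.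
exact: le_lt_trans H (ltry _).
Qed.

End Distance.

(** * The one-step bound in terms of distances, and convergence *)

Section NewtonConvergence.
Variables (R : realType) (d : nat) (hd : (0 < d)%N).
Notation pt := 'rV[R]_d.

(* om bounds the oscillation of f'' on the scale dl. *)
Lemma newton_one_step (lam alpha beta gamma : R) (m0 : pt -> R) (f : R -> R)
  (u m : pt -> R) :
  0 < lam -> 0 < alpha < 1 -> C1b_C2 f ->
  0 < gamma -> gamma < beta -> beta < alpha ->
  C2holder alpha u -> C2holder alpha m -> stable f lam m0 u m ->
  exists C dl1 B : R, [/\ 0 <= C, 0 < dl1 &
  forall dl om (U M : pt -> R), dl <= dl1 -> 0 <= om ->
  (forall s t, `|s| <= B -> `|t| <= B -> `|s - t| <= dl ->
    `|derive1 (derive1 f) s - derive1 (derive1 f) t| <= om) ->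
  C2holder beta U -> C2holder gamma M ->
  dist2 beta U u + dist2 gamma M m <= dl ->
  (exists u' m', [/\ C2holder beta u', C2holder gamma m' &
     newton_step f lam m0 U M u' m']) /\
  (forall u' m', C2holder beta u' -> C2holder gamma m' ->
    newton_step f lam m0 U M u' m' ->
    dist2 beta u' u + dist2 gamma m' m <= C * ((dl + om) * dl))].
Proof.
move=> lam0 /andP[alpha0 alpha1] [df [ddf [_ [cf2 [Fb fb]]]]] g0 gb ba uH mH [sol st].
have b0 := lt_trans g0 gb.
have uK := c2h_lower b0 (ltW ba) (C2holder_c2h hd uH).
have mK := c2h_lower g0 (ltW (lt_trans gb ba)) (C2holder_c2h hd mH).
set Ku := 2 * _ in uK; set Km := 2 * _ in mK.
have Km0 := c2_ge0 (c2h_c2 mK).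
have [L2 L20 fL] := derive2_bounded cf2 (addr_ge0 Km0 ler01).
have fb1 t : `|derive1 f t| <= Fb by case: (fb t).
(* Stability rewritten as injectivity, with all terms on the left. *)
have ker w : C2p w -> linsys lam u m (derive1 f \o m) w (fun=> 0) (fun=> 0) -> w = 0.
  move=> [p1 p2 c1 c2] [E1 E2].
  have [||v0 r0] := st w.1 w.2 p1 p2 c1 c2.
  - by move=> x; have := E1 x; move/subr0_eq.
  - by move=> x; have := E2 x; move/subr0_eq.
  by rewrite [w]surjective_pairing v0 r0.
have [C C0 [dl1 [/andP[dl10 _] H]]] := newton_step_estimate lam0 alpha1 g0 gb ba
  df ddf fb1 uK mK sol L20 fL ker.
have nc0 : 0 <= norm_const R d by rewrite /norm_const !addr_ge0// mulr_ge0// exprn_ge0.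
(* Each of the two distances costs [norm_const]; [Km + 1] bounds the values of [m] and of every
   iterate within [dl1] <= 1 of it. *)
exists (2 * norm_const R d * C), dl1, (Km + 1); split => //.
  by rewrite !mulr_ge0.
move=> dl om U M dldl1 om0 fom UH MH UM.
have uHb := c2h_C2holder uK; have mHg := c2h_C2holder mK.
have eU : c2h beta dl (U \- u).
  apply: c2h_mono (dist2_c2h hd UH uHb); apply: le_trans UM.
  by rewrite lerDl dist2_ge0.
have eM : c2h gamma dl (M \- m).
  apply: c2h_mono (dist2_c2h hd MH mHg); apply: le_trans UM.
  by rewrite lerDr dist2_ge0.
have [[u' [m' [K' [u'K m'K N]]]] est] := H dl om U M _ _ dldl1 om0 fom
  (C2holder_c2h hd UH) (C2holder_c2h hd MH) eU eM.
split.
  by exists u', m'; split; [exact: c2h_C2holder u'K|exact: c2h_C2holder m'K|].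
move=> v n vH nH Nvn.
have [vp [vC _]] := vH; have [np [nC _]] := nH.
have [h1 h2] := est v n vp np vC nC Nvn.
have := lerD (dist2_le hd h1) (dist2_le hd h2); move/le_trans; apply.
by rewrite le_eqVlt; apply/orP; left; apply/eqP; ring.
Qed.

End NewtonConvergence.

(** The bound C (dl + om) dl, with dl the current error, is used with three choices of om: a fixed
    one makes the error halve, an arbitrarily small one gives superlinear convergence, and a
    multiple of dl gives quadratic convergence. *)
Theorem theorem5p8 (R : realType) (d : nat) (hd : (0 < d)%N)
  (lam alpha beta gamma : R) (m0 : 'rV[R]_d -> R) (f : R -> R)
  (u m : 'rV[R]_d -> R) :
  0 < lam -> 0 < alpha < 1 ->
  C0holder alpha m0 -> prob_density m0 ->
  C1b_C2 f ->
  0 < gamma -> gamma < beta -> beta < alpha ->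
  C2holder alpha u -> C2holder alpha m ->
  stable f lam m0 u m ->
  exists delta : R, 0 < delta /\
    forall u0 m0' : 'rV[R]_d -> R,
      C2holder beta u0 -> C2holder gamma m0' ->
      dist2 beta u0 u + dist2 gamma m0' m < delta ->
      (exists us ms, us 0%N = u0 /\ ms 0%N = m0' /\
          newton_sequence f lam beta gamma m0 us ms) /\
      forall us ms, us 0%N = u0 -> ms 0%N = m0' ->
        newton_sequence f lam beta gamma m0 us ms ->
        let e := fun k => dist2 beta (us k) u + dist2 gamma (ms k) m in
        e @ \oo --> 0 /\
        (forall eps : R, 0 < eps -> \forall k \near \oo, e k.+1 <= eps * e k) /\
        (C21loc f -> exists C : R, \forall k \near \oo, e k.+1 <= C * (e k) ^+ 2).
Proof.
move=> lam0 alpha01 _ _ fC g0 gb ba uH mH st.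
have half1 : `|2^-1 : R| < 1 by rewrite gtr0_norm ?invr_gt0//; lra.
have [C [dl1 [B [C0 dl10 step]]]] :=
  newton_one_step hd lam0 alpha01 fC g0 gb ba uH mH st.
have [_ [_ [_ [cf2 _]]]] := fC.
pose E (U M : 'rV[R]_d -> R) := dist2 beta U u + dist2 gamma M m.
have E0 U M : 0 <= E U M by rewrite addr_ge0 ?dist2_ge0.
(* With the error and the oscillation both at most this value, C (dl + om) is at most 1/2. *)
pose om := (4 * C + 1)^-1.
have om0 : 0 < om by rewrite invr_gt0 ltr_wpDl// mulr_ge0.
have [dl2 dl20 mod2] := derive2_modulus cf2 B om0.
pose delta := Num.min (Num.min dl1 dl2) om.
have delta0 : 0 < delta by rewrite !lt_min dl10 dl20 om0.
have [dd1 dd2 dd3] : [/\ delta <= dl1, delta <= dl2 & delta <= om].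
  by rewrite /delta !ge_min !lexx !orbT.
have Com : C * om <= 4^-1.
  rewrite /om ler_pdivrMr ?ltr_wpDl ?mulr_ge0//; move: C0; lra.
have half U M : C2holder beta U -> C2holder gamma M -> E U M < delta ->
    (exists u' m', [/\ C2holder beta u', C2holder gamma m' &
      newton_step f lam m0 U M u' m']) /\
    (forall u' m', C2holder beta u' -> C2holder gamma m' ->
      newton_step f lam m0 U M u' m' -> E u' m' <= E U M / 2).
  move=> UH MH EUM; have Ed := ltW EUM.
  have [ex est] := step (E U M) om U M (le_trans Ed dd1) (ltW om0)
    (fun s t sB tB st => mod2 s t sB tB (le_trans st (le_trans Ed dd2))) UH MH (lexx _).
  split=> // u' m' u'H m'H N; apply: le_trans (est u' m' u'H m'H N) _.
  rewrite mulrA mulrC ler_wpM2l// mulrDr.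
  have : C * E U M <= C * om by rewrite ler_wpM2l// (le_trans Ed).
  by move: Com; lra.
exists delta; split=> // u0 m0' u0H m0'H Ed0.
split.
  (* Solvability is known only inside the neighbourhood, so a choice function preserving it is
     iterated. *)
  pose good (p : ('rV[R]_d -> R) * ('rV[R]_d -> R)) :=
    [/\ C2holder beta p.1, C2holder gamma p.2 & E p.1 p.2 < delta].
  have ex p : exists p', good p -> good p' /\
      newton_step f lam m0 p.1 p.2 p'.1 p'.2.
    have [[h1 h2 h3]|ng] := pselect (good p); last by exists p.
    have [[u' [m' [u'H m'H N]]] est] := half _ _ h1 h2 h3.
    exists (u', m') => _; split; last exact: N.
    split; [exact: u'H|exact: m'H|].
    apply: le_lt_trans (est _ _ u'H m'H N) _; apply: le_lt_trans h3.
    by rewrite ler_pdivrMr// ler_peMr// ler1n.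
  pose nx p := projT1 (cid (ex p)).
  have nxP p : good p -> good (nx p) /\ newton_step f lam m0 p.1 p.2 (nx p).1 (nx p).2.
    by rewrite /nx; case: cid.
  have gk k : good (iter k nx (u0, m0')).
    elim: k => [|k IH]; first by split; [exact: u0H|exact: m0'H|exact: Ed0].
    by have [] := nxP _ IH.
  exists (fun k => (iter k nx (u0, m0')).1), (fun k => (iter k nx (u0, m0')).2).
  split; first reflexivity; split; first reflexivity.
  split=> k; first by have [] := gk k.
  by have [] := nxP _ (gk k).
move=> us ms us0 ms0 [H N] e.
have eE k : e k = E (us k) (ms k) by [].
have eEle k : dist2 beta (us k) u + dist2 gamma (ms k) m <= e k by rewrite eE.
have e0 k : 0 <= e k by rewrite eE; exact: E0.
clearbody e.
have ed k : e k < delta /\ e k.+1 <= e k / 2.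
  elim: k => [|k [IH1 IH2]].
    have e0d : e 0%N < delta by rewrite eE us0 ms0.
    have [h1 h2] := H 0%N; have [h3 h4] := H 1%N.
    have [_ est] := half (us 0%N) (ms 0%N) h1 h2 (ltac:(by rewrite -eE)).
    by split; [exact: e0d|rewrite !eE; exact: est (N 0%N)].
  have ekd : e k.+1 < delta.
    apply: le_lt_trans IH2 (le_lt_trans _ IH1).
    by rewrite ler_pdivrMr// ler_peMr// ler1n.
  have [h1 h2] := H k.+1; have [h3 h4] := H k.+2.
  have [_ est] := half (us k.+1) (ms k.+1) h1 h2 (ltac:(by rewrite -eE)).
  by split; [exact: ekd|rewrite (eE k.+2) (eE k.+1); exact: est (N k.+1)].
have egeo k : e k <= e 0%N / 2 ^+ k.
  elim: k => [|k IH]; first by rewrite expr0 divr1.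
  have [_ H2] := ed k; apply: (le_trans H2).
  have -> : e 0%N / 2 ^+ k.+1 = e 0%N / 2 ^+ k / 2.
    by rewrite exprSr invfM mulrA.
  by apply: ler_wpM2r IH; rewrite invr_ge0.
have ecvg : e @ \oo --> 0.
  have G := cvg_geometric (e 0%N) half1.
  apply: (@squeeze_cvgr _ _ _ _ (fun=> 0) _ _ _ _ (cvg_cst 0) G).
  by apply: nearW => k; rewrite e0 /geometric /= exprVn egeo.
split; first exact: ecvg.
split.
  (* Once the error is below both om' and a scale on which f'' oscillates by at most om', the factor
     is at most 2 C om' <= eps. *)
  move=> eps eps0; pose om' := eps / (2 * C + 1).
  have c0 : 0 < 2 * C + 1 by rewrite ltr_wpDl// mulr_ge0.
  have om'0 : 0 < om' by rewrite divr_gt0.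
  have [dl3 dl30 mod3] := derive2_modulus cf2 B om'0.
  have mn0 : 0 < Num.min dl3 om' by rewrite lt_min dl30.
  move/cvgrPdist_le : ecvg => /(_ _ mn0); apply: filterS => k.
  rewrite sub0r normrN ger0_norm// le_min => /andP[k1 k2].
  have [h1 h2] := H k; have [h3 h4] := H k.+1; have [edk _] := ed k.
  have [_ est] := step (e k) om' _ _ (le_trans (ltW edk) dd1) (ltW om'0)
    (fun s t sB tB st => mod3 s t sB tB (le_trans st k1)) h1 h2 (eEle k).
  rewrite (eE k.+1); apply: le_trans (est _ _ h3 h4 (N k)) _.
  rewrite mulrA ler_wpM2r//.
  apply: (@le_trans _ _ (C * (om' + om'))); first by rewrite ler_wpM2l// lerD2r.
  have -> : eps = om' * (2 * C + 1) by rewrite /om' divfK// gt_eqF.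
  rewrite -subr_ge0.
  have -> : om' * (2 * C + 1) - C * (om' + om') = om' by ring.
  exact: ltW.
(* On the scale of the error e_k a Lipschitz f'' oscillates by at most |L| e_k; the absolute value
   covers a negative [L]. *)
move=> [_ [_ [_ Hlip]]]; have [L HL] := Hlip B.
exists (C * (1 + `|L|)); apply: nearW => k.
have [h1 h2] := H k; have [h3 h4] := H k.+1; have [edk _] := ed k.
have [_ est] := step (e k) (`|L| * e k) _ _ (le_trans (ltW edk) dd1)
  (mulr_ge0 (normr_ge0 _) (e0 k))
  (fun s t sB tB st => le_trans (HL s t sB tB)
     (le_trans (ler_wpM2r (normr_ge0 _) (ler_norm L)) (ler_wpM2l (normr_ge0 L) st)))
  h1 h2 (eEle k).
rewrite (eE k.+1); apply: le_trans (est _ _ h3 h4 (N k)) _.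
by rewrite le_eqVlt; apply/orP; left; apply/eqP; ring.
Qed.
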